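(* Let $Q\in\mathscr{I}_{1,\mathrm{loc}}(E,\mu)$ be the operator of orthogonal projection onto a closed subspace $L\subset L_2(E,\mu)$, let $V$ be a finite-dimensional subspace of $L_{2,\mathrm{loc}}(E,\mu)$, let $E_0\subset E$ be a Borel subset, and set $H=L+V$. Assume that: (a) $\chi_{E\setminus E_0}Q\chi_{E\setminus E_0}\in\mathscr{I}_1(E,\mu)$; (b) $\chi_{E_0}V\subset L_2(E,\mu)$; (c) if $\varphi\in V$ satisfies $\chi_{E_0}\varphi\in\chi_{E_0}L$, then $\varphi=0$; (d) if $\varphi\in L$ satisfies $\chi_{E_0}\varphi=0$, then $\varphi=0$; and assume additionally that $V\cap L_2(E,\mu)=0$. Let $B_n$, $n\in\mathbb{N}$, be an increasing sequence of bounded Borel sets exhausting $E\setminus E_0$. If there exists $\alpha_0>0$ such that for all $n$ we have $$\alpha(\chi_{E_0\cup B_n}L,\chi_{E_0\cup B_n}V)\ge\alpha_0,$$ then, as $n\to\infty$, $\Pi^{E_0\cup B_n}\to Q$ in $\mathscr{I}_{1,\mathrm{loc}}(E,\mu)$.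
   Context: $E$ is a locally compact complete metric space and $\mu$ is a $\sigma$-finite Borel measure on $E$. $\chi_A$ denotes the indicator function of $A$ and also the operator of multiplication by it. $L_{2,\mathrm{loc}}(E,\mu)$ is the space of measurable functions $f:E\to\mathbb{C}$ with $\int_B|f|^2d\mu<\infty$ for every bounded $B\subset E$. $\mathscr{I}_1(E,\mu)$ is the space of trace-class operators on $L_2(E,\mu)$; $\mathscr{I}_{1,\mathrm{loc}}(E,\mu)$ is the space of operators $K$ on $L_2(E,\mu)$ such that $\chi_BK\chi_B\in\mathscr{I}_1(E,\mu)$ for every bounded Borel $B\subset E$, with the topology given by the seminorms $\|\chi_BK\chi_B\|_{\mathscr{I}_1}$, $B$ bounded Borel. That $B_n$ is increasing and exhausts $E\setminus E_0$ means $B_1\subset B_2\subset\cdots$ and $\bigcup_nB_n=E\setminus E_0$. Under the stated assumptions $\chi_{E_0\cup B_n}H$ is a closed subspace of $L_2(E,\mu)$, and $\Pi^{E_0\cup B_n}$ denotes the operator of orthogonal projection onto it. For two closed subspaces $H_1,H_2\subset L_2(E,\mu)$, $\alpha(H_1,H_2)$ denotes the angle between them, defined as the infimum of the angles between nonzero vectors of $H_1$ and nonzero vectors of $H_2$. *)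

(* Defs.v *)
From HB Require Import structures.
From mathcomp Require Import all_boot all_order all_algebra generic_quotient.
From mathcomp Require Import ring_quotient.
From mathcomp Require Import all_classical all_reals all_analysis.
From mathcomp Require Import measurable_realfun complex.

Set Implicit Arguments.
Unset Strict Implicit.
Unset Printing Implicit Defensive.

Import Order.TTheory GRing.Theory Num.Theory.
Import numFieldTopology.Exports numFieldNormedType.Exports.

Local Open Scope classical_set_scope.
Local Open Scope ring_scope.

(* The library's complete uniform spaces are pointed, and so are its measurable
   spaces: these are the nonempty complete metric spaces. *)
#[short(type="completeMetricType")]
HB.structure Definition CompleteMetric (R : numDomainType) :=
  {T of Metric R T & CompletePseudoMetric R T}.

Notation cabs := ComplexField.Normc.normc.

Notation borel E := (g_sigma_algebraType (@open E)).

Definition metric_bounded (R : numDomainType) (E : metricType R) (A : set E) :=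
  exists (x : E) (r : R), forall y, A y -> mdist x y <= r.

Section MeasurableFunctions.
Context d (T : measurableType d) (R : realType).

Definition cmeasurable (f : T -> R[i]) :=
  measurable_fun setT (fun x => complex.Re (f x)) /\
  measurable_fun setT (fun x => complex.Im (f x)).

Definition cmeas : {pred T -> R[i]} := mem [set f | cmeasurable f].

Lemma cmeas_submod : submod_closed cmeas.
Proof.
split; first by rewrite inE; split; exact: measurable_cst.
move=> a f g; rewrite !inE => -[fr fi] [gr gi]; split.
- rewrite (_ : (fun _ => _) = (fun x => (complex.Re a * complex.Re (f x) -
     complex.Im a * complex.Im (f x)) + complex.Re (g x))).
    apply: measurable_funD => //; apply: measurable_funB;
      exact: measurable_funM.
  by apply/funext => x; rewrite /GRing.add/= /GRing.scale/=; case: a (f x) (g x)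
    => ? ? [? ?] [? ?].
- rewrite (_ : (fun _ => _) = (fun x => (complex.Re a * complex.Im (f x) +
     complex.Im a * complex.Re (f x)) + complex.Im (g x))).
    apply: measurable_funD => //; apply: measurable_funD;
      exact: measurable_funM.
  by apply/funext => x; rewrite /GRing.add/= /GRing.scale/=; case: a (f x) (g x)
    => ? ? [? ?] [? ?].
Qed.

HB.instance Definition _ := GRing.isOppClosed.Build _ cmeas
  (GRing.zmod_closedN (GRing.submod_closedB cmeas_submod)).
HB.instance Definition _ := GRing.isSubmodClosed.Build _ _ cmeas cmeas_submod.

Record cmfun := CMFun { cmfun_fun :> T -> R[i]; _ : cmfun_fun \in cmeas }.
HB.instance Definition _ := [isSub for cmfun_fun].
HB.instance Definition _ := [Choice of cmfun by <:].
HB.instance Definition _ := [SubChoice_isSubLmodule of cmfun by <:].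

Lemma cmfunDE (f g : cmfun) x : (f + g) x = f x + g x. Proof. by []. Qed.

Lemma cmfunBE (f g : cmfun) x : (f - g) x = f x - g x. Proof. by []. Qed.

Lemma cmfunZE a (f : cmfun) x : (a *: f) x = a * f x. Proof. by []. Qed.

Variable mu : {measure set T -> \bar R}.

Definition cnull : {pred cmfun} :=
  mem [set f : cmfun | {ae mu, forall x, f x = 0}].

Lemma cnull_submod : submod_closed cnull.
Proof.
split; first by rewrite inE; apply: aeW.
move=> a f g; rewrite !inE /= => f0 g0.
move: f0 g0; apply: filterS2 => x f0 g0.
by rewrite [LHS](_ : _ = a * f x + g x)// f0 g0 mulr0 addr0.
Qed.

HB.instance Definition _ := GRing.isZmodClosed.Build _ cnull
  (GRing.submod_closedB cnull_submod).

(* Complex measurable functions modulo a.e. equality.  L_2 and L_{2,loc} are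
   subsets of this space, so that subspaces of either of them, their sums and
   their intersections all live in one vector space. *)
Definition L0 : Type := {ideal_quot cnull}.
HB.instance Definition _ := EqQuotient.on L0.
HB.instance Definition _ := Choice.on L0.
HB.instance Definition _ := GRing.Zmodule.on L0.
HB.instance Definition _ := ZmodQuotient.on L0.

Local Open Scope quotient_scope.

Lemma pi_L0P (f g : cmfun) :
  \pi_L0 f = \pi_L0 g <-> {ae mu, forall x, f x = g x}.
Proof.
split=> [/eqP|fg].
  rewrite -Quotient.idealrBE inE /=; apply: filterS => x.
  by rewrite [LHS](_ : _ = f x - g x)// => /eqP; rewrite subr_eq0 => /eqP.
apply/eqP; rewrite -Quotient.idealrBE inE /=; move: fg; apply: filterS => x fg.
by rewrite [LHS](_ : _ = f x - g x)// fg subrr.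
Qed.

Definition L0_scale (a : R[i]) (f : L0) : L0 := \pi_L0 (a *: repr f).

Lemma pi_L0_scale a (f : cmfun) : L0_scale a (\pi_L0 f) = \pi_L0 (a *: f).
Proof.
apply/pi_L0P; have /pi_L0P : \pi_L0 (repr (\pi_L0 f)) = \pi_L0 f by rewrite reprK.
apply: filterS => x xf.
by rewrite !cmfunZE xf.
Qed.

Lemma L0_scaleA a b f : L0_scale a (L0_scale b f) = L0_scale (a * b) f.
Proof. by elim/quotW: f => f; rewrite (pi_L0_scale b f) !pi_L0_scale scalerA. Qed.

Lemma L0_scale1 : left_id 1 L0_scale.
Proof. by elim/quotW=> f; rewrite pi_L0_scale scale1r. Qed.

Lemma L0_scaleDr : right_distributive L0_scale +%R.
Proof.
move=> a; elim/quotW=> f; elim/quotW=> g.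
by rewrite -raddfD !pi_L0_scale scalerDr raddfD.
Qed.

Lemma L0_scaleDl f : {morph L0_scale^~ f : a b / a + b}.
Proof. by elim/quotW: f => f a b; rewrite !pi_L0_scale scalerDl raddfD. Qed.

HB.instance Definition _ := GRing.Zmodule_isLmodule.Build R[i] L0
  L0_scaleA L0_scale1 L0_scaleDr L0_scaleDl.

End MeasurableFunctions.

Section HilbertSpace.
Context d (T : measurableType d) (R : realType).
Variable mu : {measure set T -> \bar R}.
Local Open Scope quotient_scope.
Local Notation L0 := (@L0 d T R mu).
Implicit Types (f g : L0) (A : set T) (H : set L0) (K : L0 -> L0).

Definition fun_of f : T -> R[i] := cmfun_fun (repr f).

(* Class of a function; junk value 0 if the function is not measurable. *)
Definition class_of (h : T -> R[i]) : L0 := \pi_L0 (insubd (0 : cmfun T R) h).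

Lemma fun_of_class (h : T -> R[i]) : cmeasurable h ->
  {ae mu, forall x, fun_of (class_of h) x = h x}.
Proof.
move=> mh; have /pi_L0P : \pi_L0 (repr (class_of h)) = class_of h.
  by rewrite reprK.
by apply: filterS => x; rewrite /fun_of => ->; rewrite insubdK// inE.
Qed.

Lemma class_of_fun f : class_of (fun_of f) = f.
Proof. by rewrite /class_of /fun_of valKd reprK. Qed.

(* Multiplication by the indicator function of a measurable set. *)
Definition chi A f : L0 :=
  class_of (fun x => (\1_A x : R)%:C%C * fun_of f x).

Definition sqnorm_on A f : \bar R :=
  \int[mu]_(x in A) ((cabs (fun_of f x)) ^+ 2)%:E.

Definition L2 : set L0 := [set f | (sqnorm_on setT f < +oo)%E].

Definition inner f g : R[i] :=
  let h x := fun_of f x * (fun_of g x)^*%C in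
  ((\int[mu]_x complex.Re (h x)) +i* (\int[mu]_x complex.Im (h x)))%C.

Definition norm2 f : R := Num.sqrt (fine (sqnorm_on setT f)).

Definition linear_subspace H :=
  H 0 /\ forall (a : R[i]) f g, H f -> H g -> H (a *: f + g).

Definition finite_dim H :=
  exists (n : nat) (v : 'I_n -> L0),
    H `<=` [set \sum_(i < n) c i *: v i | c in [set: 'I_n -> R[i]]].

Definition closed_subspace H :=
  [/\ linear_subspace H, H `<=` L2 &
      forall (u : nat -> L0) f, (forall n, H (u n)) -> L2 f ->
        norm2 (u n - f) @[n --> \oo] --> (0 : R) -> H f].

Definition sum_space H1 H2 : set L0 := [set f + g | f in H1 & g in H2].

(* Operators on L_2 are represented by maps on L0, of which only the values on
   L_2 matter. *)
Definition bounded_op K :=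
  [/\ forall f, L2 f -> L2 (K f),
      forall (a : R[i]) f g, L2 f -> L2 g -> K (a *: f + g) = a *: K f + K g &
      exists M : R, forall f, L2 f -> norm2 (K f) <= M * norm2 f].

Definition adjoint_of K Ks :=
  bounded_op Ks /\
  forall f g, L2 f -> L2 g -> inner (K f) g = inner f (Ks g).

(* The order of R[i] makes [0 <= z] mean that z is real and nonnegative. *)
Definition positive_op K :=
  bounded_op K /\ forall f, L2 f -> 0 <= inner (K f) f.

(* P = |K| = (K^* K)^(1/2) *)
Definition is_absolute_value K P :=
  positive_op P /\
  exists2 Ks, adjoint_of K Ks & forall f, L2 f -> P (P f) = Ks (K f).

Definition absolute_value K : L0 -> L0 :=
  xget (idfun : L0 -> L0) (is_absolute_value K).

Definition orthonormal_basis (e : set L0) :=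
  [/\ e `<=` L2,
      forall f g, e f -> e g -> inner f g = (f == g)%:R &
      forall f, L2 f -> (forall g, e g -> inner f g = 0) -> f = 0].

(* Trace of a positive operator; it does not depend on the basis. *)
Definition op_trace K : \bar R :=
  \esum_(f in xget set0 orthonormal_basis) (complex.Re (inner (K f) f))%:E.

(* ||K||_{I_1} = tr |K|, with value +oo when K is bounded but not trace class. *)
Definition trace_norm K : \bar R := op_trace (absolute_value K).

Definition trace_class K := bounded_op K /\ (trace_norm K < +oo)%E.

(* Orthogonal projection onto a closed subspace H of L_2. *)
Definition oproj H f : L0 :=
  xget 0 [set g | H g /\ forall h, H h -> inner (f - g) h = 0].

Definition cutoff A K : L0 -> L0 := fun f => chi A (K (chi A f)).

Definition vector_angle f g : R :=
  acos (cabs (inner f g) / (norm2 f * norm2 g)).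

(* Extended-real infimum: +oo if one of the subspaces is zero. *)
Definition subspace_angle H1 H2 : \bar R :=
  ereal_inf [set (vector_angle f g)%:E | f in H1 `\ 0 & g in H2 `\ 0].

End HilbertSpace.

Section Local.
Context (R : realType) (E : completeMetricType R).
Variable mu : {measure set (borel E) -> \bar R}.

Definition L2loc : set (L0 mu) :=
  [set f | forall B : set (borel E), metric_bounded B -> measurable B ->
     (sqnorm_on B f < +oo)%E].

Definition I1loc (K : L0 mu -> L0 mu) :=
  bounded_op K /\ forall B : set (borel E), metric_bounded B -> measurable B ->
    trace_class (cutoff B K).

Definition cvg_I1loc (Kn : nat -> L0 mu -> L0 mu) (K : L0 mu -> L0 mu) :=
  [/\ forall n, I1loc (Kn n), I1loc K &
      forall B : set (borel E), metric_bounded B -> measurable B ->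
        trace_norm (cutoff B (fun f => Kn n f - K f)) @[n --> \oo] --> 0%E].

End Local.

(* Main.v *)
(* Write A_n = E_0 u B_n, chi_n for the multiplication by the indicator of A_n, and
   P_n for the projection onto chi_n L + chi_n V.  By (a) and (d), chi_{E_0} is bounded
   below on L, hence so are all the chi_n, uniformly; with the angle condition,
   decomposing P_n f = chi_n l + chi_n v yields
     |P_n f|^2 <= C |Q chi_n f|^2 + k_n C' sum_i <chi_n v_i, f>^2,
   where v_i is a basis of V and the constants k_n with |c_i|^2 <= k_n |chi_n v|^2
   (c_i the coordinates of v) tend to 0 because V meets L_2 trivially.  This gives the
   strong convergence P_n -> Q and, on f = chi_B e with e in an orthonormal basis, a
   domination that turns it into Hilbert-Schmidt convergence of P_n chi_B to Q chi_B.
   Finally, for D = (P_n - Q) chi_B, chi_B (P_n - Q) chi_B is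
   (P_n chi_B)^* D + D^* (Q chi_B), so its trace norm tends to 0. *)

Require Import Defs.
From HB Require Import structures.
From mathcomp Require Import all_boot all_order all_algebra finmap generic_quotient.
From mathcomp Require Import all_classical all_reals all_analysis.
From mathcomp Require Import measurable_realfun complex.
From mathcomp Require Import ring lra.

Set Implicit Arguments.
Unset Strict Implicit.
Unset Printing Implicit Defensive.

Import Order.TTheory GRing.Theory Num.Theory.
Import numFieldTopology.Exports numFieldNormedType.Exports.

Local Open Scope classical_set_scope.
Local Open Scope ring_scope.

(** * Real Hilbert spaces *)

(** The trace norm is defined through a chosen positive root of [K^* K], so existence and uniqueness
    of such roots come before any trace estimate; an iteration gives the first, a commutation
    argument the second. Restricting scalars to the reals turns complex linearity into commutation
    with multiplication by i. The lower bound for chi_{E_0} on L is a compactness effect: by (a), 1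
    - chi_{E_0} is Hilbert-Schmidt on L, so it is larger than a small contraction in only finitely
    many orthonormal directions, and (d) allows these to be added back. The constants k_n tend to 0
    because otherwise coefficient vectors with one coordinate equal to 1 and with bounded
    truncations would converge, giving a non-zero element of V in L_2. The domination is not by a
    fixed family, since Q chi_n chi_B depends on n; it is compared with Q chi_B, and the error is
    small in Hilbert-Schmidt norm after passing to adjoints. In the final trace estimate, Young's
    inequality splits each product with a weight that is fixed before n. *)

Lemma nondecreasing_bounded_cauchy (R : realType) (y : nat -> R) (D : R) :
  {homo y : m n / (m <= n)%N >-> m <= n} -> (forall n, y n <= D) ->
  forall e : R, 0 < e -> exists N, forall m n, (N <= m <= n)%N -> y n - y m < e.
Proof.
move=> yh yD e e0.
have hs : has_sup (range y).
  by split; [exists (y 0), 0 | exists D => _ [n _ <-]].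
have [_ [N _ <-] hN] := sup_adherent e0 hs.
exists N => m n /andP[Nm mn].
have := yh _ _ Nm; have : y n <= sup (range y) by apply: ub_le_sup; [exact: hs.2|exists n].
lra.
Qed.

(* Completeness is stated with squared norms, so that most estimates below need no
   square roots. *)
Record hilbertSpace (R : realType) := HilbertSpace {
  hilbert_sort :> lmodType R;
  dot : hilbert_sort -> hilbert_sort -> R;
  dotC : forall x y, dot x y = dot y x;
  dotDl : forall x y z, dot (x + y) z = dot x z + dot y z;
  dotZl : forall a x y, dot (a *: x) y = a * dot x y;
  dot_ge0 : forall x, 0 <= dot x x;
  dot_eq0 : forall x, dot x x = 0 -> x = 0;
  hilbert_complete : forall u : nat -> hilbert_sort,
    (forall e : R, 0 < e -> exists N, forall m n, (N <= m <= n)%N ->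
       dot (u n - u m) (u n - u m) < e) ->
    exists x, forall e : R, 0 < e -> exists N, forall n, (N <= n)%N ->
      dot (u n - x) (u n - x) < e }.

Section HilbertBasics.
Context (R : realType) (H : hilbertSpace R).
Implicit Types (x y z f : H) (M : set H) (A B C K P : H -> H) (u : nat -> H).

Definition sqn x := dot x x.

Lemma sqn_ge0 x : 0 <= sqn x. Proof. exact: dot_ge0. Qed.

Lemma dotNl x y : dot (- x) y = - dot x y.
Proof. by rewrite -scaleN1r dotZl mulN1r. Qed.

Lemma dotBl x y z : dot (x - y) z = dot x z - dot y z.
Proof. by rewrite dotDl dotNl. Qed.

Lemma dotDr x y z : dot x (y + z) = dot x y + dot x z.
Proof. by rewrite dotC dotDl !(dotC x). Qed.

Lemma dotZr a x y : dot x (a *: y) = a * dot x y.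
Proof. by rewrite dotC dotZl dotC. Qed.

Lemma dotNr x y : dot x (- y) = - dot x y.
Proof. by rewrite dotC dotNl dotC. Qed.

Lemma dotBr x y z : dot x (y - z) = dot x y - dot x z.
Proof. by rewrite dotDr dotNr. Qed.

Lemma dot0l x : dot 0 x = 0.
Proof. by rewrite -(scale0r x) dotZl mul0r. Qed.

Lemma dot0r x : dot x 0 = 0. Proof. by rewrite dotC dot0l. Qed.

Definition dotE := (dot0l, dot0r, dotDl, dotBl, dotZl, dotNl, dotDr, dotBr, dotZr, dotNr).

Lemma sqn0 : sqn 0 = 0. Proof. exact: dot0l. Qed.

Lemma sqn_eq0 x : sqn x = 0 -> x = 0. Proof. exact: dot_eq0. Qed.

Lemma sqnZ a x : sqn (a *: x) = a ^+ 2 * sqn x.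
Proof. by rewrite /sqn !dotE mulrA. Qed.

Lemma sqnN x : sqn (- x) = sqn x. Proof. by rewrite /sqn !dotE opprK. Qed.

Lemma sqnBC x y : sqn (x - y) = sqn (y - x). Proof. by rewrite -sqnN opprB. Qed.

Lemma sqnD x y : sqn (x + y) = sqn x + 2 * dot x y + sqn y.
Proof. by rewrite /sqn !dotE (dotC y x); ring. Qed.

Lemma sqnB x y : sqn (x - y) = sqn x - 2 * dot x y + sqn y.
Proof. by rewrite /sqn !dotE (dotC y x); ring. Qed.

Lemma dot_eq x y : (forall z, dot x z = dot y z) -> x = y.
Proof.
move=> xy; apply/subr0_eq/dot_eq0.
by rewrite dotBl xy subrr.
Qed.

End HilbertBasics.

(** Dot products with an arbitrary vector turn an identity of linear combinations into one that
    [ring] decides. *)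
Ltac vring := apply: dot_eq => ?; rewrite !dotE; ring.

Section HilbertGeometry.
Context (R : realType) (H : hilbertSpace R).
Implicit Types (x y z f : H) (M : set H) (A B C K P : H -> H) (u : nat -> H).

Lemma CauchySchwarz x y : dot x y ^+ 2 <= sqn x * sqn y.
Proof.
have [y0|yn0] := eqVneq (sqn y) 0.
  by rewrite (sqn_eq0 y0) dot0r sqn0 mulr0 expr0n.
have yp : 0 < sqn y by rewrite lt_def yn0 sqn_ge0.
have := sqn_ge0 (sqn y *: x - dot x y *: y).
rewrite sqnB !sqnZ !dotE => h.
have {h} : 0 <= sqn y * (sqn x * sqn y - dot x y ^+ 2).
  by move: h; congr (_ <= _); rewrite /sqn; ring.
by rewrite pmulr_rge0// subr_ge0.
Qed.

Lemma sqnD_le x y : sqn (x + y) <= 2 * sqn x + 2 * sqn y.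
Proof. by have := sqn_ge0 (x - y); rewrite sqnB sqnD; lra. Qed.

Lemma sqnB_le x y : sqn (x - y) <= 2 * sqn x + 2 * sqn y.
Proof. by rewrite -(sqnN y); exact: sqnD_le. Qed.

(** Young's inequality with a free weight: a bounded factor can be traded against a small one. *)
Lemma dot_abs_le x y s : 0 < s -> 2 * dot x y <= s * sqn x + s^-1 * sqn y.
Proof.
move=> s0; have := sqn_ge0 (s *: x - y); rewrite sqnB sqnZ dotE => h.
rewrite -(ler_pM2l s0).
rewrite [leRHS](_ : _ = s ^+ 2 * sqn x + sqn y); last by field; rewrite gt_eqF.
by move: h; lra.
Qed.

Definition nrm x := Num.sqrt (sqn x).

Lemma nrm_ge0 x : 0 <= nrm x. Proof. exact: sqrtr_ge0. Qed.

Lemma nrm_sqr x : nrm x ^+ 2 = sqn x. Proof. by rewrite sqr_sqrtr ?sqn_ge0. Qed.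

Lemma dot_le_nrm x y : dot x y <= nrm x * nrm y.
Proof.
apply: (le_trans (ler_norm _)).
rewrite -(ler_pXn2r (n := 2)) ?nnegrE ?mulr_ge0 ?nrm_ge0//.
by rewrite exprMn !nrm_sqr real_normK ?num_real// CauchySchwarz.
Qed.

Lemma nrmD_le x y : nrm (x + y) <= nrm x + nrm y.
Proof.
rewrite -(ler_pXn2r (n := 2)) ?nnegrE ?addr_ge0 ?nrm_ge0//.
rewrite sqrrD !nrm_sqr sqnD; have := dot_le_nrm x y; lra.
Qed.

Lemma nrmZ a x : 0 <= a -> nrm (a *: x) = a * nrm x.
Proof. by move=> a0; rewrite /nrm sqnZ sqrtrM ?sqr_ge0// sqrtr_sqr ger0_norm. Qed.

Lemma nrm_le_sqn x (c : R) : 0 <= c -> nrm x <= c -> sqn x <= c ^+ 2.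
Proof. by move=> c0 h; rewrite -nrm_sqr ler_pXn2r ?nnegrE ?nrm_ge0. Qed.

Definition hcvg u x := forall e : R, 0 < e ->
  exists N, forall n, (N <= n)%N -> sqn (u n - x) < e.

Lemma hcvg_complete u : (forall e : R, 0 < e -> exists N, forall m n, (N <= m <= n)%N ->
  sqn (u n - u m) < e) -> exists x, hcvg u x.
Proof. exact: hilbert_complete. Qed.

Lemma hcvg_uniq u x y : hcvg u x -> hcvg u y -> x = y.
Proof.
move=> ux uy; apply/subr0_eq/sqn_eq0/eqP; rewrite eq_le sqn_ge0 andbT.
apply/ler_addgt0Pr => e e0; rewrite add0r.
have e4 : 0 < e / 4 by lra.
have [N1 h1] := ux _ e4; have [N2 h2] := uy _ e4.
have {}h1 := h1 _ (leq_maxl N1 N2); have {}h2 := h2 _ (leq_maxr N1 N2).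
set n := maxn _ _ in h1 h2.
rewrite (_ : x - y = (u n - y) - (u n - x)); last by vring.
have := sqnB_le (u n - y) (u n - x); lra.
Qed.

Lemma hcvg_dot u x z (c : R) : hcvg u x -> (forall n, dot (u n) z = c) -> dot x z = c.
Proof.
move=> ux uc; apply/subr0_eq/eqP; rewrite -sqrf_eq0 eq_le sqr_ge0 andbT.
apply/ler_addgt0Pr => e e0; rewrite add0r.
have e' : 0 < e / (sqn z + 1) by rewrite divr_gt0// ltr_wpDl ?sqn_ge0.
have [N /(_ _ (leqnn N)) hN] := ux _ e'.
rewrite -(uc N) -dotBl; apply: (le_trans (CauchySchwarz _ _)).
rewrite sqnBC.
rewrite ltr_pdivlMr ?ltr_wpDl ?sqn_ge0// in hN.
by have := sqn_ge0 (u N - x); lra.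
Qed.

Definition adjp A B := forall x y, dot (A x) y = dot x (B y).

Definition selfadj A := adjp A A.

Definition bdd A := exists2 M : R, 0 < M & forall x, sqn (A x) <= M * sqn x.

Definition contr A := forall x, sqn (A x) <= sqn x.

Lemma adjpC A B : adjp A B -> adjp B A.
Proof. by move=> AB x y; rewrite dotC -AB dotC. Qed.

Lemma adjpM A B C D : adjp A B -> adjp C D -> adjp (A \o C) (D \o B).
Proof. by move=> AB CD x y; rewrite /= AB CD. Qed.

Lemma adjpB A B C D : adjp A B -> adjp C D ->
  adjp (fun x => A x - C x) (fun x => B x - D x).
Proof. by move=> AB CD x y; rewrite /= !dotE AB CD. Qed.

Lemma adjp_linear A B : adjp A B ->
  forall a x y, A (a *: x + y) = a *: A x + A y.
Proof. by move=> AB a x y; apply: dot_eq => z; rewrite AB !dotE !AB. Qed.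

Lemma adjpD A B : adjp A B -> {morph A : x y / x + y}.
Proof. by move=> AB x y; have := adjp_linear AB 1 x y; rewrite !scale1r. Qed.

Lemma adjp0 A B : adjp A B -> A 0 = 0.
Proof. by move=> AB; apply: dot_eq => z; rewrite AB !dot0l. Qed.

Lemma adjpZ A B : adjp A B -> forall a, {morph A : x / a *: x}.
Proof. by move=> AB a x; have := adjp_linear AB a x 0; rewrite (adjp0 AB) !addr0. Qed.

Lemma adjpN A B : adjp A B -> {morph A : x / - x}.
Proof. by move=> AB x; rewrite -scaleN1r (adjpZ AB) scaleN1r. Qed.

Lemma adjpBE A B : adjp A B -> {morph A : x y / x - y}.
Proof. by move=> AB x y; rewrite (adjpD AB) (adjpN AB). Qed.

Lemma bdd_hcvg A B u x : adjp A B -> bdd A -> hcvg u x -> hcvg (A \o u) (A x).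
Proof.
move=> AB [M M0 AM] ux e e0; have [N hN] := ux _ (divr_gt0 e0 M0).
exists N => n /hN; rewrite ltr_pdivlMr// => h /=.
by rewrite -(adjpBE AB); apply: (le_lt_trans (AM _)); rewrite mulrC.
Qed.

Lemma contr_bdd A : contr A -> bdd A.
Proof. by move=> cA; exists 1 => // x; rewrite mul1r. Qed.

Lemma contrB_bdd A B : contr A -> contr B -> bdd (fun x => A x - B x).
Proof.
move=> cA cB; exists 4 => // x; apply: (le_trans (sqnB_le _ _)).
have := cA x; have := cB x; lra.
Qed.

(** The cross term is at least [- 2 c |x| |y|], hence at least [- c (|x|^2 + |y|^2)]; what remains
    is [(1 - c) (|x|^2 + |y|^2)]. *)
Lemma sqn_le_sqnD x y (c : R) : 0 <= c -> c < 1 -> - dot x y <= c * (nrm x * nrm y) ->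
  sqn x <= (1 - c)^-1 * sqn (x + y) /\ sqn y <= (1 - c)^-1 * sqn (x + y).
Proof.
move=> c0 c1 h.
have e : (1 - c) * (sqn x + sqn y) <= sqn (x + y).
  rewrite sqnD -!nrm_sqr; have := mulr_ge0 c0 (sqr_ge0 (nrm x - nrm y)).
  by rewrite sqrrB; lra.
have c1' : 0 < 1 - c by lra.
have sx := sqn_ge0 x; have sy := sqn_ge0 y.
by split; rewrite ler_pdivlMl//; apply: le_trans e; rewrite ler_pM2l//; lra.
Qed.

(** * Subspaces, minimizing sequences and orthogonal projections *)

Definition subspace M := M 0 /\ forall a x y, M x -> M y -> M (a *: x + y).

Lemma subspaceD M x y : subspace M -> M x -> M y -> M (x + y).
Proof. by move=> [_ h] Mx My; rewrite -(scale1r x); exact: h. Qed.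

Lemma subspaceZ M a x : subspace M -> M x -> M (a *: x).
Proof. by move=> [M0 h] Mx; rewrite -(addr0 (_ *: _)); exact: h. Qed.

Lemma subspaceB M x y : subspace M -> M x -> M y -> M (x - y).
Proof. by move=> [_ h] Mx My; rewrite addrC -scaleN1r; exact: h. Qed.

Definition hclosed M := forall u x, (forall n, M (u n)) -> hcvg u x -> M x.

Definition is_proj M f p := M p /\ forall m, M m -> dot (f - p) m = 0.

(** Existence of projections survives the adjunction of a vector, which replaces closedness
    arguments for sums with finite-dimensional spaces. *)
Definition complemented M := forall f, exists p, is_proj M f p.

Lemma is_proj_uniq M f p q : subspace M -> is_proj M f p -> is_proj M f q -> p = q.
Proof.
move=> sM [Mp fp] [Mq fq]; apply/subr0_eq/dot_eq0.
have Mpq := subspaceB sM Mp Mq.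
by move: (fp _ Mpq) (fq _ Mpq); rewrite !dotBl; lra.
Qed.

(** A minimizing sequence converges to the projection onto the closure of [M]. Keeping the sequence
    in the conclusion serves both closed subspaces and the finite sums in Parseval's identity. *)
Lemma proj_approx M f : subspace M ->
  exists2 p, (forall m, M m -> dot (f - p) m = 0) &
    exists2 u, (forall n, M (u n)) & hcvg u p.
Proof.
move=> sM; pose S := [set sqn (f - m) | m in M].
have iS : has_inf S.
  by split; [exists (sqn (f - 0)), 0 => //; exact: sM.1
    | exists 0 => _ [m _ <-]; exact: sqn_ge0].
pose d := inf S.
have dm m : M m -> d <= sqn (f - m).
  by move=> Mm; apply: ge_inf; [exact: iS.2|exists m].
have /choice [u hu] : forall n, exists m, M m /\ sqn (f - m) < d + n.+1%:R^-1.
  move=> n; have n0 : 0 < n.+1%:R^-1 :> R by rewrite invr_gt0.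
  have [_ [m Mm <-] h] := inf_adherent n0 iS.
  by exists m.
have invn : forall e : R, 0 < e -> exists N, forall n, (N <= n)%N -> n.+1%:R^-1 < e :> R.
  move=> e e0; have := @cvg_harmonic R => /cvgrPdist_lt /(_ _ e0) [N _ hN].
  by exists N => n /hN; rewrite /= sub0r normrN ger0_norm ?invr_ge0.
have [p up] : exists p, hcvg u p.
  apply: hcvg_complete => e e0.
  have e4 : 0 < e / 4 by lra.
  have [N hN] := invn _ e4; exists N => m n /andP[Nm mn].
  have := dm _ (subspaceZ (2^-1) sM (subspaceD sM (hu m).1 (hu n).1)).
  have := hN _ Nm; have := hN _ (leq_trans Nm mn); have := (hu m).2; have := (hu n).2.
  (* Parallelogram law: the midpoint cannot be closer to [f] than the infimum, which forces [u m]
     and [u n] together. *)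
  have -> : sqn (f - 2^-1 *: (u m + u n)) =
     2^-1 * sqn (f - u m) + 2^-1 * sqn (f - u n) - 4^-1 * sqn (u n - u m).
    by rewrite /sqn !dotE (dotC (u m) f) (dotC (u n) f) (dotC (u n) (u m)); field.
  move: (n.+1%:R^-1) (m.+1%:R^-1) => i j; lra.
exists p; last by exists u => // n; exact: (hu n).1.
move=> m Mm; apply/eqP; rewrite -sqrf_eq0 eq_le sqr_ge0 andbT.
have key n : dot (f - u n) m ^+ 2 <= n.+1%:R^-1 * sqn m.
  have [m0|mn0] := eqVneq (sqn m) 0.
    by rewrite (sqn_eq0 m0) dot0r sqn0 mulr0 expr0n.
  have mp : 0 < sqn m by rewrite lt_def mn0 sqn_ge0.
  (* Moving [u n] along [m] by the optimal coefficient lowers the squared distance by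
     [<f - u n, m>^2 / |m|^2], which cannot exceed the defect of [u n]. *)
  have := dm _ (sM.2 (dot (f - u n) m / sqn m) _ _ Mm (hu n).1).
  rewrite (_ : f - _ = (f - u n) - (dot (f - u n) m / sqn m) *: m); last first.
    by move: (_ / _) => t; vring.
  rewrite sqnB sqnZ dotZr; have := (hu n).2.
  set a := dot _ _; set b := sqn m in mp *; set c := sqn (f - _).
  have -> : (a / b) ^+ 2 * b = a ^+ 2 / b by field; rewrite gt_eqF.
  rewrite (_ : a / b * a = a ^+ 2 / b); last by rewrite mulrAC.
  rewrite -ler_pdivrMr//; move: (n.+1%:R^-1) (a ^+ 2 / b) => i q; lra.
apply/ler_addgt0Pr => e e0; rewrite add0r.
have e' : 0 < e / (4 * (sqn m + 1)).
  by rewrite divr_gt0// mulr_gt0// ltr_wpDl ?sqn_ge0.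
have [N1 h1] := up _ e'; have [N2 h2] := invn _ e'.
have {}h1 := h1 _ (leq_maxl N1 N2); have {}h2 := h2 _ (leq_maxr N1 N2).
have {}key := key (maxn N1 N2).
set n := maxn _ _ in h1 h2 key.
have cs := CauchySchwarz (u n - p) m.
have -> : f - p = (f - u n) + (u n - p) by vring.
rewrite dotDl.
have m1 : 0 < 4 * (sqn m + 1) by rewrite mulr_gt0// ltr_wpDl ?sqn_ge0.
rewrite ltr_pdivlMr// in h1; rewrite ltr_pdivlMr// in h2.
have s0 := sqn_ge0 (u n - p).
have n0 : 0 <= n.+1%:R^-1 :> R by rewrite invr_ge0.
have := sqr_ge0 (dot (f - u n) m - dot (u n - p) m).
move: (dot (f - u n) m) (dot (u n - p) m) key cs h1 h2 s0 n0 => a b.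
set q := sqn m; set i := _^-1; set s := sqn (_ - _).
rewrite sqrrB sqrrD; nra.
Qed.

Lemma closed_complemented M : subspace M -> hclosed M -> complemented M.
Proof.
by move=> sM cM f; have [p hp [u Mu up]] := proj_approx f sM; exists p; split=> //; exact: cM up.
Qed.

Definition addline M x : set H := [set y | exists2 m, M m & exists a, y = m + a *: x].

Lemma addline_subspace M x : subspace M -> subspace (addline M x).
Proof.
move=> sM; split; first by exists 0; [exact: sM.1|exists 0; rewrite scale0r addr0].
move=> a _ _ [m Mm [b ->]] [m' Mm' [b' ->]]; exists (a *: m + m'); first exact: sM.2.
by exists (a * b + b'); rewrite scalerDr scalerA scalerDl addrACA.
Qed.

(** One Gram-Schmidt step: [x - q] is orthogonal to [M] and spans the new direction; if it vanishes,
    nothing is added. *)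
Lemma addline_complemented M x : subspace M -> complemented M -> complemented (addline M x).
Proof.
move=> sM cM f; have [p [Mp fp]] := cM f; have [q [Mq xq]] := cM x.
have xqM m : M m -> dot m (x - q) = 0 by move=> /xq; rewrite dotC.
have [x0|xn0] := eqVneq (sqn (x - q)) 0.
  have xE : x = q by apply/subr0_eq/sqn_eq0.
  exists p; split; first by exists p => //; exists 0; rewrite scale0r addr0.
  move=> _ [m Mm [a ->]]; rewrite dotDr dotZr xE fp// fp//; lra.
pose t := dot (f - p) (x - q) / sqn (x - q).
exists (p + t *: (x - q)); split.
  exists (p - t *: q); first by apply: subspaceB => //; exact: subspaceZ.
  by exists t; vring.
move=> _ [m Mm [a ->]].
have -> : m + a *: x = (m + a *: q) + a *: (x - q) by vring.
have Mmq : M (m + a *: q) by apply: subspaceD => //; exact: subspaceZ.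
rewrite opprD addrA dotDr dotBl dotZl fp// (dotC _ (m + _)) xqM//.
rewrite dotZr dotBl dotZl -/(sqn _) /t divfK//; lra.
Qed.

Lemma is_proj_contr M f p : is_proj M f p -> sqn p <= sqn f.
Proof.
move=> [Mp /(_ _ Mp)]; rewrite dotBl -/(sqn p) => h.
have := sqn_ge0 (f - p); rewrite sqnB; lra.
Qed.

Lemma proj_op M : subspace M -> complemented M -> exists q,
  [/\ forall f, is_proj M f (q f), selfadj q, contr q, (forall f, q (q f) = q f) & forall f, M f -> q f = f].
Proof.
move=> sM /choice[q hq]; exists q.
have qM f : M f -> q f = f.
  by move=> Mf; apply: is_proj_uniq sM (hq f) _; split=> // m _; rewrite subrr dot0l.
split=> //.
- move=> x y; move: ((hq x).2 _ (hq y).1) ((hq y).2 _ (hq x).1).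
  by rewrite !dotBl (dotC (q y)) (dotC y); lra.
- by move=> x; exact: is_proj_contr (hq x).
- by move=> f; apply: qM; exact: (hq f).1.
Qed.

End HilbertGeometry.

(** * Square roots and polar decomposition *)

Section SquareRoot.
Context (R : realType) (H : hilbertSpace R).
Implicit Types (x y z f : H) (C K P : H -> H).

Section Iteration.
Variables (T : H -> H) (Tadj : selfadj T) (Tcontr : contr T).

(* The limit Y satisfies [2 Y = T + Y^2], so [1 - Y] is a square root of [1 - T]; the
   scalar iteration with [T = 1] bounds norms and increments. *)
Fixpoint sqrt_iter n x : H :=
  if n is n'.+1 then 2^-1 *: (T x + sqrt_iter n' (sqrt_iter n' x)) else 0.

Fixpoint sqrt_bound n : R :=
  if n is n'.+1 then 2^-1 * (1 + sqrt_bound n' ^+ 2) else 0.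

Let Y := sqrt_iter.
Let y := sqrt_bound.

Let y01 n : 0 <= y n <= 1.
Proof. by elim: n => [|n /andP[IH1 IH2]]; rewrite /y /= -/y; [lra|apply/andP; nra]. Qed.

Let yS n : y n <= y n.+1.
Proof. by have /andP[h1 h2] := y01 n; rewrite /y /= -/y; nra. Qed.

Let y_homo : {homo y : m n / (m <= n)%N >-> m <= n}.
Proof. exact: homo_leq lexx le_trans yS. Qed.

Let Yadj n : selfadj (Y n).
Proof.
elim: n => [|n IH] u v; rewrite /Y /= -/Y; first by rewrite dot0l dot0r.
by rewrite !dotE Tadj !IH.
Qed.

Let nrmT x : nrm (T x) <= nrm x.
Proof. by rewrite /nrm ler_sqrt// ?sqn_ge0. Qed.

Let Ybound n x : nrm (Y n x) <= y n * nrm x.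
Proof.
elim: n x => [|n IH] x; rewrite /Y /y /= -/Y -/y.
  by rewrite mul0r /nrm sqn0 sqrtr0.
have /andP[yn0 yn1] := y01 n.
rewrite nrmZ ?invr_ge0// -mulrA ler_pM2l ?invr_gt0//.
apply: (le_trans (nrmD_le _ _)); rewrite mulrDl mul1r lerD//.
by apply: (le_trans (IH _)); rewrite expr2 -mulrA ler_wpM2l.
Qed.

Let YSB n x : nrm (Y n.+1 x - Y n x) <= (y n.+1 - y n) * nrm x.
Proof.
elim: n x => [|n IH] x.
  rewrite /Y /y /= -/Y -/y addr0 subr0 expr0n addr0 mulr1 subr0.
  by rewrite nrmZ ?invr_ge0// ler_pM2l ?invr_gt0.
(* The difference of the squares of two iterates is split with the order of factors kept; the
   induction hypothesis applies once at [x] and once at [Y n x]. *)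
have -> : Y n.+2 x - Y n.+1 x = 2^-1 *: (Y n.+1 (Y n.+1 x - Y n x) +
    (Y n.+1 (Y n x) - Y n (Y n x))).
  rewrite (adjpBE (Yadj _)) [Y n.+2 x]/Y /= -/Y.
  by rewrite [in X in _ - X]/Y /= -/Y; vring.
have /andP[yn0 yn1] := y01 n; have /andP[yn0' yn1'] := y01 n.+1.
have -> : y n.+2 - y n.+1 = 2^-1 * (y n.+1 * (y n.+1 - y n) + (y n.+1 - y n) * y n).
  by rewrite [y n.+2]/y /= -/y [in X in _ - X]/y /= -/y; field.
rewrite nrmZ ?invr_ge0// -mulrA ler_pM2l ?invr_gt0//.
apply: (le_trans (nrmD_le _ _)); rewrite mulrDl lerD//.
  by apply: (le_trans (Ybound _ _)); rewrite -mulrA ler_wpM2l.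
by apply: (le_trans (IH _)); rewrite -mulrA ler_wpM2l// subr_ge0.
Qed.

Let YB m n x : (m <= n)%N -> nrm (Y n x - Y m x) <= (y n - y m) * nrm x.
Proof.
move=> /subnK <-; elim: (n - m)%N => [|k IH].
  by rewrite !subrr mul0r /nrm sqn0 sqrtr0.
rewrite addSn.
have -> : Y (k + m).+1 x - Y m x = (Y (k + m).+1 x - Y (k + m) x) + (Y (k + m) x - Y m x).
  by vring.
apply: (le_trans (nrmD_le _ _)).
have := YSB (k + m) x; lra.
Qed.

Let Ycvg x : exists z, hcvg (fun n => Y n x) z.
Proof.
apply: hcvg_complete => e e0.
have [d d0 hd] : exists2 d : R, 0 < d & (d * nrm x) ^+ 2 < e.
  have n1 : 0 < nrm x + 1 by rewrite ltr_wpDl ?nrm_ge0.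
  exists (Num.sqrt (e / 2) / (nrm x + 1)); first by rewrite divr_gt0// sqrtr_gt0; lra.
  rewrite mulrAC expr_div_n exprMn sqr_sqrtr; last lra.
  rewrite ltr_pdivrMr ?exprn_gt0//.
  have : nrm x ^+ 2 <= (nrm x + 1) ^+ 2.
    by rewrite ler_pXn2r ?nnegrE ?nrm_ge0 ?(ltW n1)// lerDl.
  have : 0 < (nrm x + 1) ^+ 2 by rewrite exprn_gt0.
  nra.
have [N hN] := nondecreasing_bounded_cauchy y_homo (fun n => (andP (y01 n)).2) d0.
exists N => m n mn; have /andP[_ mn'] := mn.
apply: le_lt_trans hd; apply: nrm_le_sqn; first by rewrite mulr_ge0 ?nrm_ge0// ltW.
apply: (le_trans (YB _ mn')); rewrite ler_wpM2r ?nrm_ge0//.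
exact/ltW/hN.
Qed.

(** The commutation clause is recorded because uniqueness of the square root and its complex
    linearity both rest on it. *)
Lemma sqrt_id_minus : exists Z : H -> H,
  [/\ selfadj Z, contr Z,
      forall x, Z x = 2^-1 *: (T x + Z (Z x)) &
      forall C, (forall a x y, C (a *: x + y) = a *: C x + C y) -> bdd C ->
        (forall x, C (T x) = T (C x)) -> forall x, C (Z x) = Z (C x)].
Proof.
have [Z hZ] := choice Ycvg.
have Zadj : selfadj Z.
  move=> u v; apply/subr0_eq/eqP; rewrite -sqrf_eq0 eq_le sqr_ge0 andbT.
  apply/ler_addgt0Pr => e e0; rewrite add0r.
  have v1 : 0 < sqn v + 1 by rewrite ltr_wpDl ?sqn_ge0.
  have u1 : 0 < sqn u + 1 by rewrite ltr_wpDl ?sqn_ge0.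
  have [N1 h1] := hZ u (e / 4 / (sqn v + 1)) ltac:(by rewrite !divr_gt0).
  have [N2 h2] := hZ v (e / 4 / (sqn u + 1)) ltac:(by rewrite !divr_gt0).
  have {}h1 := h1 _ (leq_maxl N1 N2); have {}h2 := h2 _ (leq_maxr N1 N2).
  set n := maxn _ _ in h1 h2.
  have -> : dot (Z u) v - dot u (Z v) = dot u (Y n v - Z v) - dot (Y n u - Z u) v.
    by rewrite !dotE Yadj; ring.
  have c1 := CauchySchwarz (Y n u - Z u) v.
  have c2 := CauchySchwarz u (Y n v - Z v).
  rewrite ltr_pdivlMr// in h1; rewrite ltr_pdivlMr// in h2.
  have s1 := sqn_ge0 (Y n u - Z u); have s2 := sqn_ge0 (Y n v - Z v).
  have := sqr_ge0 (dot (Y n u - Z u) v + dot u (Y n v - Z v)).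
  move: (dot (Y n u - Z u) v) (dot u (Y n v - Z v)) c1 c2 => a b.
  rewrite sqrrB sqrrD; nra.
have Zc x : nrm (Z x) <= nrm x.
  apply/ler_addgt0Pr => e e0.
  have [N /(_ _ (leqnn N)) hN] := hZ x (e ^+ 2) ltac:(by rewrite exprn_gt0).
  rewrite (_ : Z x = Y N x + (Z x - Y N x)); last by vring.
  apply: (le_trans (nrmD_le _ _)); apply: lerD.
    apply: (le_trans (Ybound _ _)); rewrite -[leRHS]mul1r ler_wpM2r ?nrm_ge0//.
    by have /andP[] := y01 N.
  rewrite -(ler_pXn2r (n := 2)) ?nnegrE ?nrm_ge0 ?(ltW e0)//.
  by rewrite nrm_sqr sqnBC ltW.
have Zcontr : contr Z by move=> x; rewrite -!nrm_sqr ler_pXn2r ?nnegrE ?nrm_ge0.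
exists Z; split=> //.
- move=> x; apply: (hcvg_uniq (u := fun n => Y n.+1 x)).
    by move=> e /(hZ x)[N hN]; exists N => n Nn; apply: hN; exact: leqW.
  move=> e e0.
  have e4 : 0 < e / 4 by lra.
  have [N1 h1] := hZ (Z x) _ e4; have [N2 h2] := hZ x _ e4.
  exists (maxn N1 N2) => n; rewrite geq_max => /andP[/h1 {}h1 /h2 {}h2].
  rewrite (_ : _ - _ = 2^-1 *: (Y n (Y n x - Z x) + (Y n (Z x) - Z (Z x)))); last first.
    by rewrite (adjpBE (Yadj _)) /Y /= -/Y; vring.
  rewrite sqnZ.
  have : sqn (Y n (Y n x - Z x)) <= sqn (Y n x - Z x).
    rewrite -!nrm_sqr ler_pXn2r ?nnegrE ?nrm_ge0//.
    apply: (le_trans (Ybound _ _)); rewrite -[leRHS]mul1r ler_wpM2r ?nrm_ge0//.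
    by have /andP[] := y01 n.
  have := sqnD_le (Y n (Y n x - Z x)) (Y n (Z x) - Z (Z x)).
  lra.
- move=> C Clin [M M0 CM] CT x.
  have CY n z : C (Y n z) = Y n (C z).
    elim: n z => [|n IH] z; rewrite /Y /= -/Y.
      by have := Clin (-1) 0 0; rewrite scaleN1r addNr scaleN1r addNr.
    have C0 : C 0 = 0 by have := Clin (-1) 0 0; rewrite scaleN1r addNr scaleN1r addNr.
    rewrite -[2^-1 *: (_ + _)]addr0 Clin C0 addr0; congr (_ *: _).
    by rewrite -{1}(scale1r (T z)) Clin scale1r CT !IH.
  apply: (hcvg_uniq (u := fun n => C (Y n x))).
    move=> e e0; have [N hN] := hZ x _ (divr_gt0 e0 M0).
    exists N => n /hN; rewrite ltr_pdivlMr// => h.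
    have -> : C (Y n x) - C (Z x) = C (Y n x - Z x).
      by rewrite addrC [in RHS]addrC -scaleN1r -(scaleN1r (Z x)) Clin.
    by apply: (le_lt_trans (CM _)); rewrite mulrC.
  by move=> e /(hZ (C x))[N hN]; exists N => n /hN; rewrite CY.
Qed.

End Iteration.

Definition positive P := [/\ selfadj P, bdd P & forall x, 0 <= dot (P x) x].

Lemma sqrt_exists K : selfadj K -> bdd K -> exists P,
  [/\ positive P, forall x, P (P x) = K (K x) &
      forall C, (forall a x y, C (a *: x + y) = a *: C x + C y) -> bdd C ->
        (forall x, C (K (K x)) = K (K (C x))) -> forall x, C (P x) = P (C x)].
Proof.
move=> Kadj [M M0 KM].
(* [M] bounds [K^2], so [T = 1 - K^2 / M] is a contraction; its limit [Z] satisfies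
   [(1 - Z)^2 = 1 - T = K^2 / M]. *)
pose T x := x - M^-1 *: K (K x).
have Mn0 : M != 0 by rewrite gt_eqF.
have Tadj : selfadj T by move=> x y; rewrite /T !dotE !Kadj.
have Tcontr : contr T.
  move=> x; rewrite /T sqnB sqnZ dotZr dotC Kadj -/(sqn _).
  rewrite (_ : M^-1 ^+ 2 * _ = M^-1 * (M^-1 * sqn (K (K x)))); last by rewrite expr2 mulrA.
  have : M^-1 * sqn (K (K x)) <= sqn (K x) by rewrite ler_pdivrMl.
  have M'0 : 0 < M^-1 by rewrite invr_gt0.
  have := sqn_ge0 (K x); nra.
have [Z [Zadj Zc ZE Zcomm]] := sqrt_id_minus Tadj Tcontr.
pose s := Num.sqrt M; have s2 : s * s = M by rewrite -expr2 sqr_sqrtr// ltW.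
have s0 : 0 <= s by exact: sqrtr_ge0.
pose P x := s *: (x - Z x).
have Padj : selfadj P by move=> x y; rewrite /P !dotE Zadj.
exists P; split.
- split=> //.
    exists (4 * M) => [|x]; first by rewrite mulr_gt0.
    rewrite /P sqnZ expr2 s2 -mulrA mulrCA ler_pM2l//.
    have := sqnB_le x (Z x); have := Zc x; lra.
  move=> x; rewrite /P dotZl mulr_ge0// dotBl subr_ge0.
  have := sqn_ge0 (Z x - x); rewrite sqnB; have := Zc x; rewrite -/(sqn x); lra.
- move=> x; rewrite /P (adjpZ Zadj) (adjpBE Zadj).
  have : 2 *: Z x - Z (Z x) = T x.
    rewrite (_ : 2 *: Z x = T x + Z (Z x)); first by vring.
    by rewrite {1}ZE scalerA divff// scale1r.
  move=> h; rewrite (_ : _ *: _ = (s * s) *: (x - (2 *: Z x - Z (Z x)))); last by vring.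
  rewrite h /T s2 opprB addrCA subrr addr0 scalerA divff// scale1r //.
- move=> C Clin bC CK x.
  have C0 : C 0 = 0 by have := Clin (-1) 0 0; rewrite scaleN1r addNr scaleN1r addNr.
  have CB a u v : C (u - a *: v) = C u - a *: C v.
    by rewrite (_ : u - a *: v = - a *: v + u) ?Clin; vring.
  have CZ a v : C (a *: v) = a *: C v by rewrite -[a *: v]addr0 Clin C0 addr0.
  rewrite /P CZ -{1}(scale1r (Z x)) CB scale1r Zcomm//.
  by move=> u; rewrite /T CB CK.
Qed.

(** A nonnegative quadratic form is minimal at its zeros: on the line [x + t P x] the linear term
    [2 t |P x|^2] would make it negative for small [t < 0] unless [P x = 0]. *)
Lemma positive_dot_eq0 P x : positive P -> dot (P x) x = 0 -> P x = 0.
Proof.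
move=> [Padj _ Pge0] Px0; apply: sqn_eq0.
pose b := dot (P (P x)) (P x); have b0 : 0 <= b := Pge0 _.
(* The minimizer would be [- |P x|^2 / b]; the added 1 covers [b = 0]. *)
pose t := - sqn (P x) / (b + 1).
have := Pge0 (x + t *: P x).
rewrite (adjpD Padj) (adjpZ Padj) !dotE Px0 (Padj (P x) x) -/(sqn _) -/b => h.
have b1 : 0 < b + 1 by lra.
have a0 := sqn_ge0 (P x); move: (sqn (P x)) a0 @t h => a a0 t h.
have tb : t * (b + 1) = - a by rewrite /t divfK// gt_eqF.
have {}h : 0 <= (2 * t * a + t ^+ 2 * b) * (b + 1) ^+ 2.
  by rewrite mulr_ge0 ?sqr_ge0//; move: h; congr (_ <= _); ring.
have e : (2 * t * a + t ^+ 2 * b) * (b + 1) ^+ 2 =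
  2 * (t * (b + 1)) * a * (b + 1) + (t * (b + 1)) ^+ 2 * b by ring.
rewrite e tb in h; nra.
Qed.

(** Commutation gives [(P + P') (P - P') = 0], so both forms vanish at [D = (P - P') x]; hence
    [P D = P' D = 0] and [|D|^2 = <x, (P - P') D> = 0]. *)
Lemma sqrt_uniq P P' : positive P -> positive P' ->
  (forall x, P (P x) = P' (P' x)) -> (forall x, P (P' x) = P' (P x)) -> P = P'.
Proof.
move=> pP pP' PP comm; have [aP _ P0] := pP; have [aP' _ P0'] := pP'.
apply/funext => x; apply/subr0_eq; set D := _ - _.
have e : dot (P D) D + dot (P' D) D = 0.
  rewrite -dotDl (_ : _ + _ = 0) ?dot0l//.
  by rewrite /D (adjpBE aP) (adjpBE aP') PP comm; vring.
have PD : P D = 0 by apply: positive_dot_eq0 => //; have := P0 D; have := P0' D; lra.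
have P'D : P' D = 0 by apply: positive_dot_eq0 => //; have := P0 D; have := P0' D; lra.
apply: sqn_eq0; rewrite /sqn {1}/D dotBl aP aP' PD P'D !dot0r; lra.
Qed.

(** The constructed root commutes with every bounded linear map that commutes with [K^2], in
    particular with [P]; uniqueness for commuting roots then identifies the two. *)
Lemma positive_sqrt_comm K P C : selfadj K -> bdd K -> positive P ->
  (forall x, P (P x) = K (K x)) ->
  (forall a x y, C (a *: x + y) = a *: C x + C y) -> bdd C ->
  (forall x, C (K (K x)) = K (K (C x))) -> forall x, C (P x) = P (C x).
Proof.
move=> aK bK pP PK; have [Q [pQ QK Qcomm]] := sqrt_exists aK bK.
suff -> : P = Q by exact: Qcomm.
have [aP bP _] := pP.
apply: sqrt_uniq => // x; first by rewrite PK QK.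
by apply: Qcomm => //; [exact: adjp_linear aP | move=> z; rewrite -!PK].
Qed.

Lemma positive_sqrt_id K P : positive K -> positive P ->
  (forall x, P (P x) = K (K x)) -> P = K.
Proof.
move=> pK pP PK; have [aP bP _] := pP; have [aK bK _] := pK.
apply: sqrt_uniq => // x.
by rewrite -(positive_sqrt_comm aK bK pP PK (adjp_linear aK) bK).
Qed.

(* [J] is the reflection through [ker (P - K)]: as [(P - K) (P + K) = 0], P equals
   K on this kernel and [- K] on its orthogonal complement. *)
Lemma polar_decomposition K P : selfadj K -> bdd K -> positive P ->
  (forall x, P (P x) = K (K x)) ->
  exists J, [/\ selfadj J, contr J & forall x, P x = J (K x)].
Proof.
move=> aK bK pP PK; have [aP bP _] := pP.
have KP := positive_sqrt_comm aK bK pP PK (adjp_linear aK) bK (fun=> erefl).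
pose N := [set x | P x = K x].
have sN : subspace N.
  split; first by rewrite /N /= (adjp0 aP) (adjp0 aK).
  by move=> a x y; rewrite /N /= (adjp_linear aP) (adjp_linear aK) => -> ->.
have cN : hclosed N.
  move=> u x Nu ux; apply: (hcvg_uniq (bdd_hcvg aP bP ux)).
  rewrite (_ : P \o u = K \o u); first exact: bdd_hcvg aK bK ux.
  by apply/funext => n; exact: Nu.
have [q [qN aq cq qq qid]] := proj_op sN (closed_complemented sN cN).
exists (fun x => 2 *: q x - x); split.
- by move=> x y; rewrite !dotE aq.
- move=> x; rewrite sqnB sqnZ dotZl.
  have -> : dot (q x) x = sqn (q x) by rewrite -{1}(qq x) aq.
  lra.
- suff PJ x : P x = K (2 *: q x - x).
    move=> x; apply: dot_eq => z; rewrite aP PJ -aK !dotE.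
    by rewrite aq.
  (* [P + K] maps into [N], to which [x - q x] is orthogonal; by symmetry [P + K] vanishes at
     [x - q x]. *)
  have NPK y : N (P y + K y) by rewrite /N /= (adjpD aP) (adjpD aK) PK KP addrC.
  have xq : P (x - q x) + K (x - q x) = 0.
    apply: dot_eq => z; rewrite dotDl aP aK -dotDr dot0l.
    exact: (qN x).2 (NPK z).
  rewrite (adjpBE aK) (adjpZ aK) -(qN x).1.
  have -> : P x = P (x - q x) + P (q x) by rewrite -(adjpD aP) subrK.
  have /eqP := xq; rewrite addr_eq0 => /eqP ->.
  by rewrite (adjpBE aK) -[K (q x)](qN x).1; vring.
Qed.

End SquareRoot.

(** * Hilbert-Schmidt and trace estimates *)

Section SumBounds.
Context (R : realType) (T : choiceType) (I : set T).
Implicit Types (a b : T -> R) (M c : R).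

(** Index sets are arbitrary, so that bases of any cardinality are covered; a bound in [R] also
    records finiteness. *)
Definition sum_le (J : set T) a M := (\esum_(t in J) (a t)%:E <= M%:E)%E.

Lemma sum_leW (J : set T) a M (N : R) : M <= N -> sum_le J a M -> sum_le J a N.
Proof. by move=> MN /le_trans; apply; rewrite lee_fin. Qed.

Lemma sum_le_mono (J : set T) a b M : (forall t, J t -> a t <= b t) ->
  sum_le J b M -> sum_le J a M.
Proof. by move=> ab; apply: le_trans; apply: le_esum => t /ab; rewrite lee_fin. Qed.

Lemma sum_leD (J : set T) a b M (N : R) : (forall t, 0 <= a t) -> (forall t, 0 <= b t) ->
  sum_le J a M -> sum_le J b N -> sum_le J (fun t => a t + b t) (M + N).
Proof.
move=> a0 b0 aM bN; rewrite /sum_le.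
under eq_esum do rewrite EFinD.
by rewrite esumD ?EFinD ?leeD// => t _; rewrite lee_fin.
Qed.

Lemma sum_leZ (J : set T) a M c : 0 <= c -> (forall t, 0 <= a t) ->
  sum_le J a M -> sum_le J (fun t => c * a t) (c * M).
Proof.
move=> c0 a0 aM; apply: ge_ereal_sup => _ [X [finX XJ] <-].
under eq_fsbigr do rewrite EFinM.
rewrite -ge0_mule_fsumr; last by move=> t; rewrite lee_fin.
rewrite EFinM; apply: lee_wpmul2l; first by rewrite lee_fin.
by apply: le_trans aM; apply: esum_ge; exists X.
Qed.

Lemma sum_le_sum (r : finType) (J : set T) (a : r -> T -> R) (M : r -> R) :
  (forall i t, 0 <= a i t) -> (forall i, sum_le J (a i) (M i)) ->
  sum_le J (fun t => \sum_i a i t) (\sum_i M i).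
Proof.
move=> a0 aM; rewrite /sum_le -sumEFin.
under eq_esum do rewrite -sumEFin.
rewrite esum_sum; last by move=> t i _ _; rewrite lee_fin.
by apply: lee_sum => i _; exact: aM.
Qed.

Lemma sum_le_subset (J K : set T) a M : (forall t, 0 <= a t) -> J `<=` K ->
  sum_le K a M -> sum_le J a M.
Proof.
move=> a0 JK; apply: le_trans; apply: ge_ereal_sup => _ [X [finX XJ] <-].
by apply: esum_ge; exists X => //; split=> // t /XJ/JK.
Qed.

Lemma sum_le_tail a M e : (forall t, 0 <= a t) -> sum_le I a M -> 0 < e ->
  exists X, [/\ finite_set X, X `<=` I & sum_le (I `&` ~` X) a e].
Proof.
move=> a0 aM e0.
have afin : (\esum_(t in I) (a t)%:E)%E \is a fin_num.
  rewrite ge0_fin_numE; first exact: le_lt_trans aM (ltry _).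
  by apply: esum_ge0 => t _; rewrite lee_fin.
have [_ [X [finX XI] <-] hX] := ub_ereal_sup_adherent e0 afin.
exists X; split=> //; rewrite /sum_le.
have aE : (\esum_(t in I) (a t)%:E = \sum_(t \in X) (a t)%:E +
    \esum_(t in I `&` ~` X) (a t)%:E)%E.
  rewrite (esumID X); last by move=> t _; rewrite lee_fin.
  congr (_ + _)%E; rewrite (_ : I `&` X = X) ?esum_fset//; last first.
    by apply/setIidPr.
  by move=> t _; rewrite lee_fin.
have Xfin : (\sum_(t \in X) (a t)%:E)%E \is a fin_num.
  by rewrite fsumEFin.
have {}hX : (\esum_(t in I) (a t)%:E - e%:E < \sum_(t \in X) (a t)%:E)%E := hX.
rewrite aE lteBlDr// lteD2lE// in hX.
exact: ltW.
Qed.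

Lemma sum_finite_cvg0 (X : set T) (f : nat -> T -> R) : finite_set X ->
  (forall n t, 0 <= f n t) ->
  (forall t, X t -> forall e : R, 0 < e -> exists N, forall n, (N <= n)%N -> f n t <= e) ->
  forall e : R, 0 < e -> exists N, forall n, (N <= n)%N -> sum_le X (f n) e.
Proof.
move=> finX f0 ft e e0.
pose s := enum_fset (fset_set X).
have sX t : t \in s -> X t by move=> ts; apply: set_mem; rewrite -in_fset_set.
have [N hN] : exists N, forall n, (N <= n)%N -> \sum_(t <- s) f n t <= e.
  elim: s sX e e0 => [|t s IH] sX e e0; first by exists 0%N => n _; rewrite big_nil ltW.
  have e2 : 0 < e / 2 by lra.
  have [N1 h1] := ft _ (sX _ (mem_head _ _)) _ e2.
  have [|N2 h2] := IH _ _ e2; first by move=> x xs; apply: sX; rewrite inE xs orbT.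
  exists (maxn N1 N2) => n; rewrite geq_max => /andP[/h1 {}h1 /h2 {}h2].
  by rewrite big_cons; lra.
exists N => n /hN h; rewrite /sum_le esum_fset//; last by move=> t _; rewrite lee_fin.
by rewrite fsbig_finite//= sumEFin lee_fin.
Qed.

(** Dominated convergence in which the majorant is a fixed summable family plus an error [g] that
    may vary with [n]. A finite set leaves little of [c a] outside it, and pointwise convergence is
    used on that set. *)
Lemma sum_dominated_cvg0 (a : T -> R) (f : nat -> T -> R) M c :
  (forall t, 0 <= a t) -> (forall n t, 0 <= f n t) -> 0 <= c -> sum_le I a M ->
  (forall e, 0 < e -> exists N, forall n, (N <= n)%N -> exists g : T -> R,
     [/\ forall t, 0 <= g t, forall t, I t -> f n t <= c * a t + g t & sum_le I g e]) ->
  (forall t, I t -> forall e : R, 0 < e -> exists N, forall n, (N <= n)%N -> f n t <= e) ->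
  forall e, 0 < e -> exists N, forall n, (N <= n)%N -> sum_le I (f n) e.
Proof.
move=> a0 f0 c0 aM fag fcvg e e0.
have c1 : 0 < c + 1 by lra.
have e3 : 0 < e / 3 by lra.
have [X [finX XI aX]] := sum_le_tail a0 aM (divr_gt0 e3 c1).
have [N1 h1] := fag _ e3.
have [N2 h2] := sum_finite_cvg0 finX f0 (fun t Xt => fcvg t (XI t Xt)) e3.
exists (maxn N1 N2) => n; rewrite geq_max => /andP[/h1 [g [g0 fg gs]] /h2 {}h2].
rewrite /sum_le (esumID X); last by move=> t _; rewrite lee_fin.
rewrite (_ : I `&` X = X); last exact/setIidPr.
have fX : sum_le (I `&` ~` X) (f n) (c * (e / 3 / (c + 1)) + e / 3).
  apply: (@sum_le_mono _ _ (fun t => c * a t + g t)).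
    by move=> t [It _]; exact: fg.
  apply: sum_leD => //; first by move=> t; rewrite mulr_ge0.
    exact: sum_leZ.
  by apply: sum_le_subset gs.
apply: (le_trans (leeD h2 fX)); rewrite -EFinD lee_fin.
have : c * (e / 3 / (c + 1)) <= e / 3.
  by rewrite mulrA ler_pdivrMr// mulrC ler_pM2l//; lra.
lra.
Qed.

End SumBounds.

(** * Hilbert-Schmidt bounds and traces of differences of projections *)

Section HilbertSchmidt.
Context (R : realType) (H : hilbertSpace R).
Context (T : choiceType) (I : set T) (b : T -> H).
Hypothesis parseval : forall f, (\esum_(t in I) (dot f (b t) ^+ 2)%:E = (sqn f)%:E)%E.
Implicit Types (A B C J K P Q X : H -> H).

Definition hs_le A M := sum_le I (fun t => sqn (A (b t))) M.

(** Expanding each norm by Parseval gives the double sum of [<A b_s, b_t>^2], in which exchanging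
    the indices exchanges [A] with its adjoint. *)
Lemma hs_le_adj A B M : adjp A B -> hs_le A M -> hs_le B M.
Proof.
move=> AB; rewrite /hs_le /sum_le.
under eq_esum do rewrite -parseval.
under [in X in _ -> X]eq_esum do rewrite -parseval.
rewrite !esum_esum; try by move=> *; rewrite lee_fin sqr_ge0.
move=> h; rewrite (@reindex_esum _ _ _ (I `*` I) (I `*` I) (fun k => (k.2, k.1))).
  apply: le_trans h; rewrite le_eqVlt; apply/orP; left; apply/eqP.
  by apply: eq_esum => -[s t] [/= Is It]; rewrite AB dotC.
split.
- by move=> [s t] [].
- by move=> [s t] [s' t'] _ _ [-> ->].
- by move=> [s t] [/= Is It]; exists (t, s).
Qed.

Lemma hs_le_contrl A C M : contr C -> hs_le A M -> hs_le (C \o A) M.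
Proof. by move=> cC; apply: sum_le_mono => t _; exact: cC. Qed.

Lemma hs_le_contrr A B C M : adjp A B -> selfadj C -> contr C ->
  hs_le A M -> hs_le (A \o C) M.
Proof.
move=> AB aC cC AM; apply: (hs_le_adj (A := C \o B)).
  exact/adjpC/adjpM.
exact/hs_le_contrl/(hs_le_adj AB).
Qed.

Lemma sum_dot_le x : sum_le I (fun t => dot x (b t) ^+ 2) (sqn x).
Proof. by rewrite /sum_le parseval. Qed.

(* With [D = (Q' - Q) X], the operator [X (Q' - Q) X] is [(Q' X)^* D + D^* (Q X)]. *)
Lemma trace_bound X Q Q' J P d p q s :
  selfadj X -> selfadj Q -> selfadj Q' -> (forall x, Q (Q x) = Q x) ->
  (forall x, Q' (Q' x) = Q' x) -> selfadj J -> contr J ->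
  (forall x, P x = J (X (Q' (X x)) - X (Q (X x)))) ->
  0 < s ->
  hs_le (fun x => Q' (X x) - Q (X x)) d -> hs_le (Q' \o X) p -> hs_le (Q \o X) q ->
  sum_le I (fun t => dot (P (b t)) (b t)) (s^-1 * d + s / 2 * (p + q)).
Proof.
move=> aX aQ aQ' QQ QQ' aJ cJ PE s0 hD hp hq.
pose D x := Q' (X x) - Q (X x); pose D' x := X (Q' x) - X (Q x).
have DD' : adjp D D' by apply: adjpB; exact: adjpM.
have hDJ : hs_le (D \o J) d by exact: hs_le_contrr DD' aJ cJ hD.
have hpJ : hs_le (Q' \o X \o J) p by exact: (hs_le_contrr (adjpM aQ' aX) aJ cJ hp).
have s2 : 0 < s / 2 by lra. have s2' : 0 < (2 * s)^-1 by rewrite invr_gt0; lra.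
(* Young's inequality gives weight [1 / (2 s)] to the factors containing [D], which will be small,
   and [s / 2] to the bounded ones. *)
pose f t := (2 * s)^-1 * sqn (D (b t)) + s / 2 * sqn ((Q' \o X \o J) (b t)) +
  (s / 2 * sqn ((Q \o X) (b t)) + (2 * s)^-1 * sqn ((D \o J) (b t))).
apply: (@sum_le_mono _ _ _ _ f).
  move=> t _; rewrite PE aJ; set x := b t.
  have -> : dot (X (Q' (X x)) - X (Q (X x))) (J x) =
      dot (D x) (Q' (X (J x))) + dot (Q (X x)) (D (J x)).
    have e' u v : dot (Q' u) (Q' v) = dot (Q' u) v by rewrite -aQ' QQ'.
    have e u v : dot (Q u) (Q v) = dot (Q u) v by rewrite -aQ QQ.
    by rewrite /D !dotE !aX e' e; ring.
  have h1 := dot_abs_le (D x) (Q' (X (J x))) (_ : 0 < s^-1).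
  have h2 := dot_abs_le (Q (X x)) (D (J x)) s0.
  rewrite invr_gt0 invrK in h1; have {}h1 := h1 s0.
  rewrite /f /= -/x invfM.
  by move: (s^-1) h1 h2 => i; lra.
have -> : s^-1 * d + s / 2 * (p + q) = ((2 * s)^-1 * d + s / 2 * p) + (s / 2 * q + (2 * s)^-1 * d).
  by field; rewrite gt_eqF.
have n0 c x : 0 < c -> 0 <= c * sqn x :> R by move=> c0; rewrite mulr_ge0 ?sqn_ge0// ltW.
apply: sum_leD; try by move=> t; rewrite addr_ge0// n0.
- apply: sum_leD; try (by move=> t; rewrite n0); apply: sum_leZ => //;
    by [exact: ltW | move=> t; exact: sqn_ge0].
- apply: sum_leD; try (by move=> t; rewrite n0); apply: sum_leZ => //;
    by [exact: ltW | move=> t; exact: sqn_ge0].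
Qed.

End HilbertSchmidt.

(** * Lower bounds and finite-dimensional perturbations *)

Section LowerBound.
Context (R : realType) (H : hilbertSpace R).
Context (TI : choiceType) (I : set TI) (b : TI -> H).
Hypothesis parseval : forall f, (\esum_(t in I) (dot f (b t) ^+ 2)%:E = (sqn f)%:E)%E.
Implicit Types (x y z f g l : H) (M L : set H) (A q T : H -> H).

Fixpoint orthonormal (s : seq H) : Prop :=
  if s is f :: s' then [/\ sqn f = 1, forall g, g \in s' -> dot f g = 0 & orthonormal s']
  else True.

Lemma bessel (s : seq H) y : orthonormal s -> \sum_(f <- s) dot f y ^+ 2 <= sqn y.
Proof.
elim: s y => [|f s IH] y; first by rewrite big_nil sqn_ge0.
move=> [f1 fs os]; rewrite big_cons.
have := IH (y - dot f y *: f) os.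
rewrite sqnB sqnZ dotZr f1 (dotC y f).
rewrite (eq_big_seq (fun g => dot g y ^+ 2)); last first.
  by move=> g gs; rewrite dotBr dotZr (dotC g f) (fs g gs) mulr0 subr0.
lra.
Qed.

Lemma orthonormal_dot_sum (s : seq H) (c : H -> R) g : orthonormal s -> g \in s ->
  dot g (\sum_(f <- s) c f *: f) = c g.
Proof.
have sum0 h r : (forall k, k \in r -> dot h k = 0) -> dot h (\sum_(k <- r) c k *: k) = 0.
  elim: r => [|k r IH] hr; first by rewrite big_nil dot0r.
  rewrite big_cons dotDr dotZr hr ?mem_head// IH ?mulr0 ?addr0// => k' k'r.
  by apply: hr; rewrite inE k'r orbT.
elim: s => [//|f s IH] [f1 fs os]; rewrite inE big_cons dotDr dotZr => /predU1P[->|gs].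
  by rewrite -/(sqn f) f1 mulr1 sum0// addr0.
by rewrite (dotC g f) (fs g gs) mulr0 add0r IH.
Qed.

(** The lower bound turns convergence of images into a Cauchy condition on preimages. *)
Lemma closed_image M A B c : adjp A B -> bdd A -> hclosed M -> subspace M ->
  0 < c -> (forall m, M m -> sqn m <= c * sqn (A m)) -> hclosed (A @` M).
Proof.
move=> AB bA cM sM c0 Mc u y Mu uy.
have [v hv] := choice (fun n => let: ex_intro2 m Mm e := Mu n in ex_intro (fun m => M m /\ A m = u n) m (conj Mm e)).
have [x vx] : exists x, hcvg v x.
  apply: hcvg_complete => e e0.
  have e4 : 0 < e / (4 * c) by rewrite divr_gt0//; lra.
  have [N hN] := uy _ e4; exists N => m n /andP[Nm mn].
  apply: (le_lt_trans (Mc _ (subspaceB sM (hv n).1 (hv m).1))).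
  rewrite (adjpBE AB) !(hv _).2 (_ : u n - u m = (u n - y) - (u m - y)); last by vring.
  have h1 := hN _ Nm; have h2 := hN _ (leq_trans Nm mn).
  rewrite ltr_pdivlMr in h1; last lra.
  rewrite ltr_pdivlMr in h2; last lra.
  have := sqnB_le (u n - y) (u m - y).
  by rewrite -(ler_pM2l c0); lra.
exists x; first by apply: cM vx => n; exact: (hv n).1.
apply: hcvg_uniq (bdd_hcvg AB bA vx) _.
by rewrite (_ : A \o v = u)//; apply/funext => n; exact: (hv n).2.
Qed.

Definition bounded_below A M := exists2 c : R, 0 < c & forall m, M m -> sqn m <= c * sqn (A m).

(** If [A u] lies in [A M], injectivity puts [u] in [M]. Otherwise the squared distance [d] from
    [A u] to [A M] is positive and controls the coefficient of [u]. *)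
Lemma bounded_below_addline A B M L u : adjp A B -> subspace L -> M `<=` L ->
  (forall l, L l -> A l = 0 -> l = 0) -> subspace M -> complemented (A @` M) ->
  bounded_below A M -> L u ->
  [/\ addline M u `<=` L, subspace (addline M u), complemented (A @` addline M u) &
    bounded_below A (addline M u)].
Proof.
move=> AB sL ML inj sM cAM [c c0 Mc] Lu.
have sAM : subspace (A @` M).
  split; first by exists 0; [exact: sM.1|rewrite (adjp0 AB)].
  move=> a _ _ [x Mx <-] [y My <-]; exists (a *: x + y); first exact: sM.2.
  by rewrite (adjp_linear AB).
split.
- move=> _ [m /ML Lm [a ->]]; apply: subspaceD => //; exact: subspaceZ.
- exact: addline_subspace.
- rewrite (_ : A @` _ = addline (A @` M) (A u)); first exact: addline_complemented.
  apply/seteqP; split.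
    move=> _ [_ [m Mm [a ->]] <-]; exists (A m); first by exists m.
    by exists a; rewrite (adjpD AB) (adjpZ AB).
  move=> _ [_ [m Mm <-] [a ->]]; exists (m + a *: u); first by exists m => //; exists a.
  by rewrite (adjpD AB) (adjpZ AB).
have [p [[m0 Mm0 Am0] up]] := cAM (A u).
have [v0|vn0] := eqVneq (sqn (A u - p)) 0.
  have um0 : u = m0.
    apply/subr0_eq/inj; first by apply: subspaceB => //; exact: ML.
    by rewrite (adjpBE AB) Am0; exact: sqn_eq0.
  exists c => // _ [m Mm [a ->]]; apply: Mc.
  by apply: subspaceD => //; apply: subspaceZ => //; rewrite um0.
have d0 : 0 < sqn (A u - p) by rewrite lt_def vn0 sqn_ge0.
set d := sqn _ in d0.
(* From [|m + a u|^2 <= 2 |m|^2 + 2 a^2 |u|^2] and [|m|^2 <= 2 c (|A m + a p|^2 + a^2 |p|^2)]; [k]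
   collects the coefficient of [a^2], and [a^2 d <= |A (m + a u)|^2]. *)
pose k := 4 * c * sqn p + 2 * sqn u.
have k0 : 0 <= k by rewrite addr_ge0 ?mulr_ge0 ?sqn_ge0//; lra.
exists (4 * c + k / d); first by rewrite ltr_wpDr// ?divr_ge0 ?(ltW d0)//; lra.
move=> _ [m Mm [a ->]].
have Ax : A (m + a *: u) = (A m + a *: p) + a *: (A u - p).
  by rewrite (adjpD AB) (adjpZ AB); vring.
have w : sqn (A (m + a *: u)) = sqn (A m + a *: p) + a ^+ 2 * d.
  rewrite Ax sqnD sqnZ dotZr dotC up; first by rewrite -/d; ring.
  apply: (subspaceD sAM); first by exists m.
  by apply: (subspaceZ _ sAM); exists m0.
have h1 := sqnD_le m (a *: u); have h2 := Mc _ Mm.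
have h3 : sqn (A m) <= 2 * sqn (A m + a *: p) + 2 * sqn (a *: p).
  by rewrite -{1}(addrK (a *: p) (A m)); exact: sqnB_le.
rewrite !sqnZ in h1 h3.
rewrite w mulrDl [X in _ <= _ + X]mulrDr (_ : k / d * (a ^+ 2 * d) = k * a ^+ 2); last first.
  by field; rewrite gt_eqF.
have q0 := sqn_ge0 (A m + a *: p).
have h4 : 0 <= k / d * sqn (A m + a *: p) by rewrite mulr_ge0 ?divr_ge0 ?(ltW d0).
have h5 : 0 <= 4 * c * (a ^+ 2 * d).
  apply: mulr_ge0; first by apply: mulr_ge0 => //; exact: ltW.
  by apply: mulr_ge0; [exact: sqr_ge0|exact: ltW].
have h6 : 2 * sqn m <= 2 * (c * (2 * sqn (A m + a *: p) + 2 * (a ^+ 2 * sqn p))).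
  rewrite ler_pM2l//; apply: (le_trans h2); rewrite ler_pM2l//.
have kE : k * a ^+ 2 = 4 * c * (a ^+ 2 * sqn p) + 2 * (a ^+ 2 * sqn u) by rewrite /k; ring.
apply: (le_trans h1); rewrite kE; move: (k / d) h4 => kd h4; lra.
Qed.

(* A maximal orthonormal family of vectors of [L] with [|f - T f|^2 > |f|^2 / 2] is
   finite, because [q (1 - T)] is Hilbert-Schmidt; on its orthogonal complement in
   [L], T is bounded below. *)
Lemma hs_bounded_below L q T tau : subspace L -> hclosed L ->
  (forall f, is_proj L f (q f)) -> selfadj q -> selfadj T -> (forall x, T (T x) = T x) ->
  bdd T ->
  hs_le I b (fun x => q (x - T x)) tau ->
  (forall l, L l -> T l = 0 -> l = 0) -> bounded_below T L.
Proof.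
move=> sL cL qL aq aT TT bT hq inj.
have qid l : L l -> q l = l.
  by move=> Ll; apply: (is_proj_uniq sL (qL l)); split=> // m _; rewrite subrr dot0l.
have pyth f : sqn (T f) = sqn f - sqn (f - T f).
  have e : dot f (T f) = sqn (T f) by rewrite /sqn aT TT dotC aT.
  by rewrite sqnB e; lra.
pose good s := orthonormal s /\ forall f, f \in s -> L f /\ 1 < 2 * sqn (f - T f).
(* By Parseval, [|f - T f|^2] is the sum of [<f, q (b_t - T b_t)>^2] for [f] in [L]; Bessel's
   inequality over [s] bounds the total by [tau], and each vector contributes more than [1 / 2]. *)
have good_size s : good s -> (size s)%:R <= 2 * tau.
  move=> [os hs].
  have h1 : (size s)%:R <= 2 * \sum_(f <- s) sqn (f - T f).
    elim: s {os} hs => [|f s IH] hs; first by rewrite big_nil mulr0.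
    rewrite big_cons /= -natr1 mulrDr addrC; apply: lerD; first exact/ltW/(hs f (mem_head _ _)).2.
    by apply: IH => g gs; apply: hs; rewrite inE gs orbT.
  apply: (le_trans h1); rewrite ler_pM2l// -lee_fin -sumEFin.
  under eq_bigr do rewrite -parseval.
  rewrite -esum_sum; last by move=> *; rewrite lee_fin sqr_ge0.
  apply: le_trans hq; apply: le_esum => t _; rewrite sumEFin lee_fin.
  rewrite (eq_big_seq (fun f => dot f (q (b t - T (b t))) ^+ 2)); first exact: bessel.
  by move=> f fs; rewrite -aq (qid _ (hs _ fs).1) dotBl dotBr aT.
have [s gs smax] : exists2 s, good s & forall s', good s' -> (size s' <= size s)%N.
  pose P n := `[< exists2 s, good s & size s = n >].
  have P0 : exists n, P n by exists 0%N; apply/asboolP; exists [::].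
  have Pb n : P n -> (n <= Num.bound (2 * tau))%N.
    move=> /asboolP[s gs <-]; rewrite -(ler_nat R).
    apply/ltW/(le_lt_trans (good_size _ gs))/archi_boundP.
    by apply: le_trans (good_size _ gs).
  case: (ex_maxnP P0 Pb) => n /asboolP[s gs sn] nmax; exists s => // s' gs'.
  by rewrite sn; apply: nmax; apply/asboolP; exists s'.
pose M0 := [set l | L l /\ forall g, g \in s -> dot g l = 0].
have sM0 : subspace M0.
  split; first by split=> [|g _]; [exact: sL.1|rewrite dot0r].
  move=> a x y [Lx xs] [Ly ys]; split=> [|g gs']; first exact: sL.2.
  by rewrite dotDr dotZr xs// ys// mulr0 addr0.
have cM0 : hclosed M0.
  move=> u x Mu ux; split=> [|g gs']; first by apply: cL ux => n; exact: (Mu n).1.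
  by rewrite dotC; apply: (hcvg_dot ux) => n; rewrite dotC; exact: (Mu n).2.
have M0b m : M0 m -> sqn m <= 2 * sqn (T m).
  move=> [Lm ms]; rewrite pyth.
  suff : 2 * sqn (m - T m) <= sqn m by lra.
  rewrite leNgt; apply/negP => h.
  have m0 : 0 < sqn m.
    rewrite lt_def sqn_ge0 andbT; apply/eqP => m0; move: h.
    by rewrite m0 (sqn_eq0 m0) (adjp0 aT) subr0 sqn0 mulr0 ltxx.
  pose f := (nrm m)^-1 *: m.
  have i2 : (nrm m)^-1 ^+ 2 = (sqn m)^-1 by rewrite exprVn nrm_sqr.
  suff /smax : good (f :: s) by rewrite /= ltnn.
  split; first split; [|move=> g gs'|exact: gs.1|].
  - by rewrite sqnZ i2 mulVf// gt_eqF.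
  - by rewrite dotZl dotC ms// mulr0.
  - move=> g; rewrite inE => /predU1P[->|]; last exact: gs.2.
    split; first exact: subspaceZ.
    rewrite (adjpZ aT) -scalerBr sqnZ i2 mulrCA ltr_pdivlMl//.
    by rewrite mulr1.
(* The finitely many removed directions are added back one at a time; injectivity of [T] on [L]
   preserves a lower bound at each step. *)
pose Ms r := foldr (fun u M => addline M u) M0 r.
have hMs r : (forall g, g \in r -> L g) -> [/\ Ms r `<=` L, subspace (Ms r),
    complemented (T @` Ms r) & bounded_below T (Ms r)].
  elim: r => [_|g r IH gr] /=.
    split=> //; first by move=> l [].
      apply: closed_complemented; last exact: closed_image M0b.
      split; first by exists 0; [exact: sM0.1|rewrite (adjp0 aT)].
      move=> a _ _ [x Mx <-] [y My <-]; exists (a *: x + y); first exact: sM0.2.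
      by rewrite (adjp_linear aT).
    by exists 2.
  have [|h1 h2 h3 h4] := IH; first by move=> k kr; apply: gr; rewrite inE kr orbT.
  by apply: (bounded_below_addline aT sL h1 inj h2 h3 h4); apply: gr; exact: mem_head.
have [|_ _ _ [c c0 hc]] := hMs s; first by move=> g /gs.2[].
exists c => // l Ll; apply: hc.
have sumL r (k : H -> R) : (forall g, g \in r -> L g) -> L (\sum_(g <- r) k g *: g).
  elim: r => [|g r IH] gr; first by rewrite big_nil; exact: sL.1.
  rewrite big_cons; apply: sL.2; first exact/gr/mem_head.
  by apply: IH => g' g'r; apply: gr; rewrite inE g'r orbT.
have inMs r (k : H -> R) m : M0 m -> Ms r (m + \sum_(g <- r) k g *: g).
  move=> M0m; elim: r => [|g r IH]; first by rewrite big_nil addr0.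
  by rewrite big_cons /=; exists (m + \sum_(g <- r) k g *: g) => //; exists (k g); vring.
rewrite -(subrK (\sum_(g <- s) dot g l *: g) l).
apply: inMs; split.
  by apply: subspaceB => //; apply: sumL => g /gs.2[].
by move=> g gs'; rewrite dotBr orthonormal_dot_sum ?subrr//; exact: gs.1.
Qed.

End LowerBound.

(** * Linear combinations of finite families *)

Section FiniteDimensional.
Context (R : realType) (H : hilbertSpace R).
Implicit Types (x y z f g l : H) (M : set H).

Definition lincomb d (x : 'I_d -> H) (a : 'I_d -> R) : H := \sum_i a i *: x i.

Lemma lincombB d (x : 'I_d -> H) a a' :
  lincomb x (fun i => a i - a' i) = lincomb x a - lincomb x a'.
Proof. by rewrite /lincomb -sumrB; apply: eq_bigr => i _; rewrite scalerBl. Qed.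

Lemma lincombZ d (x : 'I_d -> H) c a : lincomb x (fun i => c * a i) = c *: lincomb x a.
Proof. by rewrite /lincomb scaler_sumr; apply: eq_bigr => i _; rewrite scalerA. Qed.

Lemma adjp_lincomb A B d (x : 'I_d -> H) a : adjp A B ->
  A (lincomb x a) = lincomb (A \o x) a.
Proof.
move=> AB; rewrite /lincomb (big_morph A (adjpD AB) (adjp0 AB)).
by apply: eq_bigr => i _; rewrite (adjpZ AB).
Qed.

Lemma span_complemented M d (x : 'I_d -> H) : subspace M -> complemented M ->
  subspace [set m + lincomb x a | m in M & a in setT] /\
  complemented [set m + lincomb x a | m in M & a in setT].
Proof.
move=> sM cM; elim: d x => [|d IH] x.
  rewrite (_ : [set _ | _ in _ & _ in _] = M)//; apply/seteqP; split.
    by move=> _ [m Mm [a _ <-]]; rewrite /lincomb big_ord0 addr0.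
  by move=> m Mm; exists m => //; exists (fun=> 0) => //; rewrite /lincomb big_ord0 addr0.
have [sS cS] := IH (fun i => x (lift ord0 i)); set S := (X in subspace X) in sS cS.
rewrite (_ : [set _ | _ in _ & _ in _] = addline S (x ord0)).
  by split; [exact: addline_subspace|exact: addline_complemented].
apply/seteqP; split.
  move=> _ [m Mm [a _ <-]]; exists (m + lincomb (fun i => x (lift ord0 i)) (fun i => a (lift ord0 i))).
    by exists m => //; exists (fun i => a (lift ord0 i)).
  by exists (a ord0); rewrite /lincomb big_ord_recl /=; vring.
move=> _ [_ [m Mm [a _ <-]] [c ->]]; exists m => //.
exists (fun i => oapp a c (unlift ord0 i)) => //.
rewrite /lincomb big_ord_recl unlift_none /=.
by under eq_bigr do rewrite liftK /=; vring.
Qed.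

Lemma nrm_lincomb d (x : 'I_d -> H) a e : (forall i, `|a i| <= e) ->
  nrm (lincomb x a) <= e * \sum_i nrm (x i).
Proof.
move=> ae; rewrite /lincomb mulr_sumr.
elim/big_ind2 : _ => [|u v u' v' h h'|i _]; first by rewrite /nrm sqn0 sqrtr0.
- by apply: (le_trans (nrmD_le _ _)); exact: lerD.
- by rewrite /nrm sqnZ sqrtrM ?sqr_ge0// sqrtr_sqr ler_wpM2r ?sqrtr_ge0.
Qed.

End FiniteDimensional.

(** * Coordinates of combinations under growing truncations *)

Section Dini.
Context (R : realType) (H : hilbertSpace R).
Context (d : nat) (x : nat -> 'I_d -> H) (chi : nat -> H -> H).
Hypothesis chi_adj : forall n, selfadj (chi n).
Hypothesis chi_contr : forall n, contr (chi n).
Hypothesis chi_x : forall m n i, (m <= n)%N -> chi m (x n i) = x m i.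
Hypothesis x_inj : forall n a, lincomb (x n) a = 0 -> forall i, a i = 0.
Hypothesis x_unbounded : forall a D, (forall n, sqn (lincomb (x n) a) <= D) ->
  forall i, a i = 0.

Let chi_lincomb m n a : (m <= n)%N -> chi m (lincomb (x n) a) = lincomb (x m) a.
Proof.
move=> mn; rewrite (adjp_lincomb _ _ (chi_adj m)); congr lincomb.
by apply/funext => i /=; exact: chi_x.
Qed.

Let lincomb_mono m n a : (m <= n)%N -> sqn (lincomb (x m) a) <= sqn (lincomb (x n) a).
Proof. by move=> mn; rewrite -(chi_lincomb _ mn); exact: chi_contr. Qed.

(** The combination with coefficients [c] is the component of [x n i] orthogonal to the other
    vectors, so its norm is the distance to their span. *)
Let minimizer n i : exists2 c : 'I_d -> R, c i = 1 &
  forall a, a i = 0 -> dot (lincomb (x n) c) (lincomb (x n) a) = 0.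
Proof.
have s0 : subspace [set (0 : H)] by split=> // a _ _ -> ->; rewrite scaler0 addr0.
have c0 : complemented [set (0 : H)].
  by move=> f; exists 0; split=> // _ ->; rewrite dot0r.
(* Zeroing the [i]-th vector leaves the span of the others while keeping the index type. *)
pose x' j := if j == i then 0 else x n j.
have [p [[_ -> [a _ <-]] hp]] := (span_complemented x' s0 c0).2 (x n i).
have x'E a' : a' i = 0 -> lincomb x' a' = lincomb (x n) a'.
  move=> a0; apply: eq_bigr => j _; rewrite /x'; case: eqP => // ->.
  by rewrite a0 !scale0r.
exists (fun j => (j == i)%:R - (if j == i then 0 else a j)).
  by rewrite eqxx subr0.
move=> a' a'0; rewrite lincombB.
rewrite (_ : lincomb (x n) (fun j => (j == i)%:R) = x n i); last first.
  rewrite /lincomb (bigD1 i)//= eqxx scale1r big1 ?addr0// => j /negPf->.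
  by rewrite scale0r.
rewrite -x'E ?eqxx// -x'E//.
rewrite (_ : lincomb x' _ = 0 + lincomb x' a).
  by apply: hp; exists 0 => //; exists a' => //; rewrite add0r.
rewrite add0r; apply: eq_bigr => j _; rewrite /x'; case: eqP => // _.
by rewrite !scaler0.
Qed.

Let coord_bound n i c : c i = 1 ->
  (forall a, a i = 0 -> dot (lincomb (x n) c) (lincomb (x n) a) = 0) ->
  forall a, a i ^+ 2 * sqn (lincomb (x n) c) <= sqn (lincomb (x n) a).
Proof.
move=> c1 hc a; pose a' j := a j - a i * c j.
have aE : lincomb (x n) a = a i *: lincomb (x n) c + lincomb (x n) a'.
  by rewrite lincombB lincombZ addrC subrK.
rewrite aE sqnD sqnZ dotZl hc; last by rewrite /a' c1 mulr1 subrr.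
by have := sqn_ge0 (lincomb (x n) a'); lra.
Qed.

Let minimizer_gt0 n i c : c i = 1 -> 0 < sqn (lincomb (x n) c).
Proof.
move=> c1; rewrite lt_def sqn_ge0 andbT; apply/eqP => /sqn_eq0/x_inj/(_ i).
by rewrite c1 => /eqP; rewrite oner_eq0.
Qed.

Lemma coord_le n i : exists2 k : R, 0 < k &
  forall a, a i ^+ 2 <= k * sqn (lincomb (x n) a).
Proof.
have [c c1 hc] := minimizer n i; have c0 := minimizer_gt0 n c1.
exists (sqn (lincomb (x n) c))^-1; first by rewrite invr_gt0.
by move=> a; rewrite ler_pdivlMl// mulrC; exact: coord_bound.
Qed.

(* If the distance [delta n] from [x n i] to the span of the other vectors stayed
   bounded, the minimizers [c n] would converge to a non-zero bounded combination. *)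
Lemma coord_small i (e : R) : 0 < e -> exists N, forall n, (N <= n)%N ->
  forall a, a i ^+ 2 <= e * sqn (lincomb (x n) a).
Proof.
move=> e0.
have [c hc] := choice (fun n => let: ex_intro2 c c1 h := minimizer n i in
  ex_intro (fun c => c i = 1 /\ forall a, a i = 0 -> dot (lincomb (x n) c) (lincomb (x n) a) = 0)
  c (conj c1 h)).
pose delta n := sqn (lincomb (x n) (c n)).
(* The coefficients [c n] still have [i]-th coordinate 1 at level [m], so Pythagoras measures their
   distance from the minimizer there. *)
have deltaE m n : (m <= n)%N -> delta m + sqn (lincomb (x m) (fun j => c n j - c m j)) <= delta n.
  move=> mn; apply: le_trans (lincomb_mono (c n) mn).
  have -> : lincomb (x m) (c n) = lincomb (x m) (c m) + lincomb (x m) (fun j => c n j - c m j).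
    by rewrite lincombB addrC subrK.
  rewrite sqnD (hc m).2 ?mulr0 ?addr0//.
  by rewrite (hc n).1 (hc m).1 subrr.
have delta_mono : {homo delta : m n / (m <= n)%N >-> m <= n}.
  by move=> m n /deltaE; apply: le_trans; rewrite lerDl sqn_ge0.
have [[N hN]|bounded] := pselect (exists N, e^-1 < delta N).
  exists N => n Nn a; have h := coord_bound (hc n).1 (hc n).2 a.
  have dn := lt_le_trans hN (delta_mono _ _ Nn).
  rewrite -ler_pdivrMl// mulrC; apply: le_trans h.
  by rewrite ler_wpM2l ?sqr_ge0// ltW.
have deltaD n : delta n <= e^-1 by rewrite leNgt; apply/negP => h; apply: bounded; exists n.
have cauchy_c j : exists l : R, (fun n => c n j) @ \oo --> l.
  suff : cauchy ((fun n => c n j) @ \oo).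
    move=> h; have /cvg_ex[l hl] : cvg ((fun n => c n j) @ \oo) by exact/cauchy_cvgP.
    by exists l.
  apply: cauchy_exP => eps eps0.
  (* At level 0 one constant [k] controls the coordinate for all [n]; the increments of [delta] then
     make it Cauchy. *)
  have [k k0 hk] := coord_le 0 j.
  have ek : 0 < eps ^+ 2 / k by rewrite divr_gt0// exprn_gt0.
  have [N hN] := nondecreasing_bounded_cauchy delta_mono deltaD ek.
  exists (c N j), N => // n /= Nn.
  rewrite /ball/= distrC -(ltr_pXn2r (n := 2)) ?nnegrE ?(ltW eps0)// real_normK ?num_real//.
  apply: (le_lt_trans (hk (fun j => c n j - c N j))).
  rewrite mulrC -ltr_pdivlMr//.
  apply: (le_lt_trans (lincomb_mono _ (leq0n N))).
  apply: le_lt_trans (hN N n _); last by rewrite leqnn.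
  by have := deltaE _ _ Nn; lra.
have [cl hcl] := choice cauchy_c.
have cl1 : cl i = 1.
  have := hcl i; rewrite (_ : (fun n => c n i) = cst 1) => [|]; last first.
    by apply/funext => n; exact: (hc n).1.
  by move=> /cvg_lim <-//; rewrite lim_cst.
(* The square root of [e^-1] bounds the combination with coefficients [c n] at each level [m <= n],
   and 1 absorbs the replacement of [c n] by its limit. *)
suff /x_unbounded/(_ i) : forall n, sqn (lincomb (x n) cl) <= (Num.sqrt e^-1 + 1) ^+ 2.
  by rewrite cl1 => /eqP; rewrite oner_eq0.
move=> m; apply: nrm_le_sqn; first by rewrite addr_ge0 ?sqrtr_ge0.
pose S := \sum_j nrm (x m j).
have S0 : 0 <= S by apply: sumr_ge0 => j _; exact: nrm_ge0.
have S1 : 0 < S + 1 by lra.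
have : \forall n \near \oo, forall j, `|cl j - c n j| <= (S + 1)^-1.
  apply: filter_forall => j.
  have /cvgrPdist_le := hcl j; apply; rewrite invr_gt0//.
move=> [N _ hN].
have mN := leq_maxl m N; have /hN h : (N <= maxn m N)%N by exact: leq_maxr.
set n := maxn m N in mN h.
have -> : lincomb (x m) cl = lincomb (x m) (c n) + lincomb (x m) (fun j => cl j - c n j).
  by rewrite lincombB addrC subrK.
apply: (le_trans (nrmD_le _ _)); apply: lerD.
  rewrite /nrm ler_sqrt ?invr_ge0 ?(ltW e0)//.
  by apply: le_trans (deltaD n); exact: lincomb_mono.
apply: (le_trans (nrm_lincomb _ h)).
by rewrite mulrC ler_pdivrMr// mul1r -/S; lra.
Qed.

End Dini.

(** * Convergence of projections *)

Section ProjectionConvergence.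
Context (R : realType) (H : hilbertSpace R).
Context (TI : choiceType) (I : set TI) (b : TI -> H).
Hypothesis parseval : forall f, (\esum_(t in I) (dot f (b t) ^+ 2)%:E = (sqn f)%:E)%E.
Implicit Types (y z f g l : H).
(** In the application [chi n] truncates to A_n, [X] to a bounded set, and [x n] is a real basis of
    V truncated to A_n. The inequalities [chiL_le] and [x_le] come from the angle condition. *)
Context (L : set H) (Q X : H -> H) (chi P : nat -> H -> H).
Context (d : nat) (x : nat -> 'I_d -> H) (C q : R).
Hypothesis sL : subspace L.
Hypothesis QL : forall f, is_proj L f (Q f).
Hypothesis Q_adj : selfadj Q.
Hypothesis Q_contr : contr Q.
Hypothesis X_adj : selfadj X.
Hypothesis X_contr : contr X.
Hypothesis QX_hs : hs_le I b (Q \o X) q.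
Hypothesis chi_adj : forall n, selfadj (chi n).
Hypothesis chi_contr : forall n, contr (chi n).
Hypothesis chi_comp : forall m n f, (m <= n)%N -> chi n (chi m f) = chi m f.
Hypothesis chi_cvg : forall f, hcvg (fun n => chi n f) f.
Hypothesis chiX : forall n f, chi n (X f) = X (chi n f).
Hypothesis chi_x : forall m n i, (m <= n)%N -> chi m (x n i) = x m i.
Hypothesis Xx_bounded : forall i, exists K : R, forall n, sqn (X (x n i)) <= K.
Hypothesis coord_le : forall n i, exists2 k : R, 0 < k &
  forall a, a i ^+ 2 <= k * sqn (lincomb (x n) a).
Hypothesis coord_small : forall i (e : R), 0 < e -> exists N, forall n, (N <= n)%N ->
  forall a, a i ^+ 2 <= e * sqn (lincomb (x n) a).
Hypothesis C_gt0 : 0 < C.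
Hypothesis L_le : forall n l, L l -> sqn l <= C * sqn (chi n l).
Hypothesis chiL_le : forall n l a, L l ->
  sqn (chi n l) <= C * sqn (chi n l + lincomb (x n) a).
Hypothesis x_le : forall n l a, L l ->
  sqn (lincomb (x n) a) <= C * sqn (chi n l + lincomb (x n) a).
Let Hn n : set H := [set y + lincomb (x n) a | y in chi n @` L & a in setT].
Hypothesis P_proj : forall n f, is_proj (Hn n) f (P n f).
Hypothesis P_adj : forall n, selfadj (P n).
Hypothesis P_contr : forall n, contr (P n).

Let coord_ub n (k : R) := forall i a, a i ^+ 2 <= k * sqn (lincomb (x n) a).

Let coord_ub_ex n : exists2 k : R, 0 < k & coord_ub n k.
Proof.
have [k hk] := choice (fun i => let: ex_intro2 k k0 h := coord_le n i in
  ex_intro (fun k => 0 < k /\ forall a, a i ^+ 2 <= k * sqn (lincomb (x n) a)) k (conj k0 h)).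
exists (\sum_i k i + 1).
  by rewrite ltr_wpDl// sumr_ge0// => i _; exact/ltW/(hk i).1.
move=> i a; apply: (le_trans ((hk i).2 a)); rewrite ler_wpM2r ?sqn_ge0//.
rewrite (bigD1 i)//= -addrA lerDl addr_ge0// sumr_ge0// => j _.
exact/ltW/(hk j).1.
Qed.

Let coord_ub_small (e : R) : 0 < e -> exists N, forall n, (N <= n)%N -> coord_ub n e.
Proof.
move=> e0.
have : \forall n \near \oo, forall i, forall a, a i ^+ 2 <= e * sqn (lincomb (x n) a).
  by apply: filter_forall => i; have [N hN] := coord_small i e0; exists N.
by move=> [N _ hN]; exists N => n /hN.
Qed.

(** The product [C * C] leads from [l] to [chi n l] and on to [P n f]; the factors 2 come from
    absorbing half of [|P n f|^2]; [d.+1] stays positive when [d = 0]. *)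
Let C1 := 2 * (C * C).
Let C2 := 2 * d.+1%:R * C.

Let C1_gt0 : 0 < C1. Proof. by rewrite /C1 !mulr_gt0. Qed.
Let C2_gt0 : 0 < C2. Proof. by rewrite /C2 !mulr_gt0. Qed.

(* Writing [P n f = chi n l + w], both terms are controlled by [P n f], and
   [|P n f|^2 = <l, Q (chi n f)> + <w, f>]. *)
Let P_estimate n (k : R) f : 0 < k -> coord_ub n k ->
  sqn (P n f) <= C1 * sqn (Q (chi n f)) + k * C2 * \sum_i dot (x n i) f ^+ 2.
Proof.
move=> k0 hk; have [[_ [l Ll <-] [a _ pE]] pP] := P_proj n f.
set w := lincomb _ a in pE.
have pp : sqn (P n f) = dot l (Q (chi n f)) + dot w f.
  have : dot (f - P n f) (P n f) = 0.
    by apply: pP; rewrite -pE; exists (chi n l); [exists l | exists a].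
  rewrite dotBl -/(sqn _) dotC => /eqP; rewrite subr_eq0 => /eqP <-.
  rewrite -{1}pE dotDl chi_adj -(Q_adj l); congr (dot _ _ + _).
  by apply: (is_proj_uniq sL _ (QL l)); split=> // m _; rewrite subrr dot0l.
have lP : sqn l <= C * C * sqn (P n f).
  apply: (le_trans (L_le n Ll)); rewrite -mulrA ler_pM2l// -pE.
  exact: chiL_le.
have wP : sqn w <= C * sqn (P n f) by rewrite -pE; exact: x_le.
have CC : 0 < C * C by rewrite mulr_gt0.
(* The weights leave [1 / 4] of [|P n f|^2] in each of [h1] and [h2], so that half of it can be
   moved to the left. *)
have h1 : dot l (Q (chi n f)) <= 4^-1 * sqn (P n f) + C * C * sqn (Q (chi n f)).
  have := dot_abs_le l (Q (chi n f)) (_ : 0 < (2 * (C * C))^-1).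
  rewrite invr_gt0 invrK => /(_ C1_gt0).
  have : (2 * (C * C))^-1 * sqn l <= 2^-1 * sqn (P n f).
    by rewrite invfM -mulrA ler_pM2l ?invr_gt0// ler_pdivrMl.
  by move: ((_)^-1 * sqn l) => u; lra.
have d0 : 0 < d.+1%:R :> R by [].
have h2 : dot w f <= 4^-1 * sqn (P n f) + k * (d.+1%:R * C) * \sum_i dot (x n i) f ^+ 2.
  pose s := d.+1%:R * C * k.
  have s0 : 0 < s by rewrite !mulr_gt0.
  have wE : dot w f = \sum_i a i * dot (x n i) f.
    rewrite /w /lincomb (big_morph (fun y => dot y f) (fun y z => dotDl y z f) (dot0l f)).
    by apply: eq_bigr => i _; rewrite dotZl.
  (* Each of the [d] coordinates may spend [1 / (4 (d + 1))] of [|P n f|^2]; [s] is the matching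
     weight. *)
  have key i : a i * dot (x n i) f <=
      4^-1 * (d.+1%:R^-1 * sqn (P n f)) + s * dot (x n i) f ^+ 2.
    have e1 : a i ^+ 2 <= k * C * sqn (P n f).
      by apply: (le_trans (hk i a)); rewrite -mulrA ler_pM2l.
    have e2 : (4 * s)^-1 * a i ^+ 2 <= 4^-1 * (d.+1%:R^-1 * sqn (P n f)).
      rewrite ler_pdivrMl; last lra.
      apply: (le_trans e1); rewrite le_eqVlt; apply/orP; left; apply/eqP.
      by rewrite /s; field; rewrite ?pnatr_eq0.
    apply: le_trans (lerD e2 (lexx _)).
    have := sqr_ge0 (a i - 2 * s * dot (x n i) f).
    move: (a i) (dot _ _) => u v h; rewrite -(ler_pM2l (ltac:(lra) : 0 < 4 * s)) mulrDr.
    rewrite mulVKf; last by rewrite gt_eqF//; lra.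
    by move: h; rewrite sqrrB; nra.
  rewrite wE; apply: (le_trans (ler_sum _ (fun i _ => key i))).
  rewrite big_split /= -mulr_sumr -[in X in _ + X <= _]mulr_sumr.
  apply: lerD; last by rewrite /s le_eqVlt; apply/orP; left; apply/eqP; ring.
  rewrite ler_pM2l ?invr_gt0// sumr_const card_ord -[_ *+ d]mulr_natl mulrA.
  rewrite -[leRHS]mul1r ler_wpM2r ?sqn_ge0// ler_pdivrMr// mul1r ler_nat.
  exact: leqnSn.
rewrite {}pp in h1 h2 *; rewrite /C1 /C2; lra.
Qed.

(** On L, [P n] approximates [Q z] at least as well as [chi n (Q z)], an element of its range.
    Orthogonally to L, [f] is replaced by [chi m f] with [m] fixed: its products with [x n i] stop
    depending on [n] while the coordinate constant tends to 0. *)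
Let P_cvg z : hcvg (fun n => P n z) (Q z).
Proof.
have cvg_orth f : Q f = 0 -> forall e : R, 0 < e ->
    exists N, forall n, (N <= n)%N -> sqn (P n f) <= e.
  move=> Qf e e0.
  have e1 : 0 < e / (4 * (C1 + 1)) by rewrite divr_gt0//; have := C1_gt0; lra.
  have [m /(_ m (leqnn m)) hm] := chi_cvg f e1.
  pose S := \sum_i dot (x m i) f ^+ 2.
  have S0 : 0 <= S by apply: sumr_ge0 => i _; exact: sqr_ge0.
  have S1 : 0 < 4 * C2 * (S + 1) by have := C2_gt0; nra.
  have [N hN] := coord_ub_small (divr_gt0 e0 S1).
  exists (maxn m N) => n; rewrite geq_max => /andP[mn /hN hn].
  have := P_estimate (chi m f) (divr_gt0 e0 S1) hn.
  rewrite (chi_comp f mn).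
  have -> : \sum_i dot (x n i) (chi m f) ^+ 2 = S.
    by apply: eq_bigr => i _; rewrite -chi_adj chi_x.
  have -> : Q (chi m f) = Q (chi m f - f) by rewrite (adjpBE Q_adj) Qf subr0.
  have h1 := Q_contr (chi m f - f).
  have h2 := P_contr n (f - chi m f).
  have h3 := sqnD_le (P n (chi m f)) (P n (f - chi m f)).
  rewrite -(adjpD (P_adj n)) addrC subrK in h3.
  rewrite sqnBC in h2.
  move=> h4; rewrite ltr_pdivlMr in hm; last by have := C1_gt0; lra.
  have h5 : e / (4 * C2 * (S + 1)) * C2 * S <= e / 4.
    have -> : e / (4 * C2 * (S + 1)) * C2 * S = e / 4 * (S / (S + 1)).
      by field; rewrite !gt_eqF//; lra.
    rewrite -[leRHS]mulr1 ler_wpM2l//; first lra.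
    by rewrite ler_pdivrMr; lra.
  have h6 : C1 * sqn (Q (chi m f - f)) <= C1 * sqn (chi m f - f) by rewrite ler_pM2l.
  lra.
have QQ f : Q (f - Q f) = 0.
  rewrite (adjpBE Q_adj); apply/eqP; rewrite subr_eq0; apply/eqP.
  by apply: (is_proj_uniq sL _ (QL (Q f))); split=> [|m _]; [exact: (QL f).1|rewrite subrr dot0l].
move=> e e0; have e4 : 0 < e / 4 by lra.
have e8 : 0 < e / 8 by lra.
have [N1 h1] := chi_cvg (Q z) e4; have [N2 h2] := cvg_orth _ (QQ z) _ e8.
exists (maxn N1 N2) => n; rewrite geq_max => /andP[/h1 {}h1 /h2 {}h2].
have -> : P n z - Q z = (P n (Q z) - Q z) + P n (z - Q z).
  by rewrite (adjpBE (P_adj n)); vring.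
have h3 : sqn (P n (Q z) - Q z) <= sqn (chi n (Q z) - Q z).
  have [Pm PQ] := P_proj n (Q z).
  rewrite ![sqn (_ - Q z)]sqnBC.
  have -> : Q z - chi n (Q z) = (Q z - P n (Q z)) + (P n (Q z) - chi n (Q z)) by vring.
  have chiH : Hn n (chi n (Q z)).
    exists (chi n (Q z)); first by exists (Q z) => //; exact: (QL z).1.
    by exists (fun=> 0) => //; rewrite /lincomb big1 ?addr0// => i _; rewrite scale0r.
  rewrite [leRHS]sqnD dotBr PQ// PQ//; have := sqn_ge0 (P n (Q z) - chi n (Q z)); lra.
have := sqnD_le (P n (Q z) - Q z) (P n (z - Q z)); lra.
Qed.

(** Parseval reduces the sum to the [|X (x n i)|^2], whose bound uniform in [n] expresses local
    square-integrability of V. *)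
Let Xx_sum : exists2 K : R, 0 <= K & forall n,
  sum_le I (fun t => \sum_i dot (x n i) (X (b t)) ^+ 2) K.
Proof.
have [K hK] := choice Xx_bounded.
exists (\sum_i K i) => [|n].
  by apply: sumr_ge0 => i _; exact: le_trans (sqn_ge0 _) (hK i 0%N).
apply: sum_le_sum => [i t|i]; first exact: sqr_ge0.
apply: sum_leW (hK i n) _.
apply: sum_le_mono (sum_dot_le parseval _) => t _.
by rewrite X_adj.
Qed.

Lemma hs_projection_bounded n : exists M : R, hs_le I b (P n \o X) M.
Proof.
have [k k0 hk] := coord_ub_ex n; have [K K0 hK] := Xx_sum.
exists (C1 * q + k * C2 * K).
apply: (@sum_le_mono _ _ _ _ (fun t => C1 * sqn (Q (X (chi n (b t)))) +
  k * C2 * \sum_i dot (x n i) (X (b t)) ^+ 2)).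
  by move=> t _; rewrite -chiX; exact: P_estimate.
apply: sum_leD.
- by move=> t; rewrite mulr_ge0 ?sqn_ge0// ltW.
- move=> t; apply: mulr_ge0; first by rewrite mulr_ge0 ?(ltW k0) ?(ltW C2_gt0).
  by apply: sumr_ge0 => i _; exact: sqr_ge0.
- apply: sum_leZ; [exact: ltW|by move=> t; exact: sqn_ge0|].
  exact: (hs_le_contrr parseval (adjpM Q_adj X_adj) (chi_adj n) (chi_contr n) QX_hs).
- apply: sum_leZ => //; first by rewrite mulr_ge0 ?(ltW k0) ?(ltW C2_gt0).
  by move=> t; apply: sumr_ge0 => i _; exact: sqr_ge0.
Qed.

(** Strong convergence of [chi n] to 1 acts vector by vector with [1 - chi n] on the left; the
    adjoint [(1 - chi n) X Q] brings it there. *)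
Let tail_hs (e : R) : 0 < e -> exists N, forall n, (N <= n)%N ->
  hs_le I b (fun y => Q (X y - chi n (X y))) e.
Proof.
move=> e0.
have XQ : hs_le I b (X \o Q) q := hs_le_adj parseval (adjpM Q_adj X_adj) QX_hs.
have : exists N, forall n, (N <= n)%N ->
    sum_le I (fun t => sqn (X (Q (b t)) - chi n (X (Q (b t))))) e.
  apply: (sum_dominated_cvg0 (a := fun t => sqn (X (Q (b t)))) (c := 4) _ _ _ XQ) => //.
  - by move=> t; exact: sqn_ge0.
  - by move=> n t; exact: sqn_ge0.
  - move=> e' e'0; exists 0%N => n _; exists (fun=> 0); split=> // [t _|].
      have := sqnB_le (X (Q (b t))) (chi n (X (Q (b t)))).
      by have := chi_contr n (X (Q (b t))); lra.
    by rewrite /sum_le esum1// lee_fin ltW.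
  - move=> t _ e' e'0; have [N hN] := chi_cvg (X (Q (b t))) e'0.
    by exists N => n /hN; rewrite sqnBC => /ltW.
move=> [N hN]; exists N => n /hN.
apply: (hs_le_adj parseval (A := fun y => X (Q y) - chi n (X (Q y)))).
by move=> y z; rewrite !dotE chi_adj !X_adj !Q_adj (adjpBE Q_adj) dotBr -chiX.
Qed.

Lemma hs_projection_cvg (e : R) : 0 < e -> exists N, forall n, (N <= n)%N ->
  hs_le I b (fun y => P n (X y) - Q (X y)) e.
Proof.
(* [|P - Q|^2 <= 2 |P|^2 + 2 |Q|^2], and writing [Q chi n X] as [Q X - Q (1 - chi n) X] costs
   another factor 2: [Q X] gets the coefficient [2 + 4 C1], and the rest is the small error. *)
move: e; apply: (sum_dominated_cvg0 (a := fun t => sqn (Q (X (b t)))) (c := 2 + 4 * C1) _ _ _ QX_hs).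
- by move=> t; exact: sqn_ge0.
- by move=> n t; exact: sqn_ge0.
- by have := C1_gt0; lra.
- move=> e e0; have [K K0 hK] := Xx_sum.
  have K1 : 0 < 4 * C2 * (K + 1) by have := C2_gt0; nra.
  have [N1 h1] := coord_ub_small (divr_gt0 e0 K1).
  have C18 : 0 < 8 * C1 by have := C1_gt0; lra.
  have [N2 h2] := tail_hs (divr_gt0 e0 C18).
  exists (maxn N1 N2) => n; rewrite geq_max => /andP[/h1 {}h1 /h2 {}h2].
  pose k := e / (4 * C2 * (K + 1)); have k0 : 0 < k by rewrite divr_gt0.
  exists (fun t => 4 * C1 * sqn (Q (X (b t) - chi n (X (b t)))) +
    2 * k * C2 * \sum_i dot (x n i) (X (b t)) ^+ 2).
  have g1 t : 0 <= 4 * C1 * sqn (Q (X (b t) - chi n (X (b t)))).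
    by rewrite !mulr_ge0 ?sqn_ge0// ltW.
  have kC : 0 <= 2 * k * C2.
    by apply: mulr_ge0; [apply: mulr_ge0 => //|]; exact: ltW.
  have g2 t : 0 <= \sum_i dot (x n i) (X (b t)) ^+ 2.
    by apply: sumr_ge0 => i _; exact: sqr_ge0.
  split.
  + by move=> t; rewrite addr_ge0// mulr_ge0.
  + move=> t _; have hP := P_estimate (X (b t)) k0 h1.
    have hB := sqnB_le (P n (X (b t))) (Q (X (b t))).
    have hQ := sqnB_le (Q (X (b t))) (Q (X (b t) - chi n (X (b t)))).
    rewrite (_ : _ - Q _ = Q (chi n (X (b t)))) in hQ; last first.
      by rewrite -(adjpBE Q_adj) subKr.
    rewrite -(ler_pM2l C1_gt0) in hQ.
    move: hP hB hQ; rewrite -/k; move: (\sum_i _) (sqn (Q (X (b t) - _))) => S s; lra.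
  + have -> : e = 4 * C1 * (e / (8 * C1)) + e / 2 by field; rewrite gt_eqF.
    apply: sum_leD => //.
    * by move=> t; rewrite mulr_ge0.
    * by apply: sum_leZ => // [|t]; [lra|exact: sqn_ge0].
    * apply: sum_leW (sum_leZ kC g2 (hK n)).
      have -> : 2 * k * C2 * K = e / 2 * (K / (K + 1)).
        by rewrite /k; field; rewrite !gt_eqF//; lra.
      rewrite -[leRHS]mulr1 ler_wpM2l//; first lra.
      by rewrite ler_pdivrMr; lra.
- move=> t _ e e0; have [N hN] := P_cvg (X (b t)) e0.
  by exists N => n /hN /ltW.
Qed.

End ProjectionConvergence.

(** * Parseval's identity for a total orthonormal family *)

Section Parseval.
Context (R : realType) (H : hilbertSpace R) (T : choiceType) (I : set T) (b : T -> H).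
Hypothesis b_orthonormal : forall t u, I t -> I u -> dot (b t) (b u) = (t == u)%:R.
Hypothesis b_total : forall f, (forall t, I t -> dot f (b t) = 0) -> f = 0.
Implicit Types (f x y : H) (s : seq T).

Let partial s f := \sum_(t <- s) dot f (b t) *: b t.

Let dot_sum s (c : T -> R) u : (forall t, t \in s -> I t) -> uniq s -> I u ->
  dot (\sum_(t <- s) c t *: b t) (b u) = if u \in s then c u else 0.
Proof.
move=> + + Iu; elim: s => [|t s IH]; first by rewrite big_nil dot0l.
move=> sI /= /andP[ts us]; rewrite big_cons dotDl dotZl inE.
rewrite b_orthonormal//; last exact/sI/mem_head.
rewrite IH//; last by move=> v vs; apply: sI; rewrite inE vs orbT.
case: (eqVneq t u) ts => [->|tu] ts; last by rewrite mulr0 add0r.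
by rewrite mulr1 (negPf ts) addr0.
Qed.

Let sqn_sub s (c : T -> R) f : (forall t, t \in s -> I t) -> uniq s ->
  sqn (f - \sum_(t <- s) c t *: b t) =
  sqn f - \sum_(t <- s) (2 * c t * dot f (b t) - c t ^+ 2).
Proof.
elim: s => [|t s IH]; first by rewrite !big_nil !subr0.
move=> sI /= /andP[ts us]; rewrite !big_cons.
have sI' u : u \in s -> I u by move=> us'; apply: sI; rewrite inE us' orbT.
rewrite (_ : f - _ = (f - \sum_(t <- s) c t *: b t) - c t *: b t); last by vring.
rewrite sqnB sqnZ IH// dotZr dotBl dot_sum//; last exact/sI/mem_head.
rewrite (negPf ts) subr0 /sqn b_orthonormal ?eqxx; [|exact/sI/mem_head..].
rewrite /= mulr1n; ring.
Qed.

(** Membership means being equal to one's own Fourier sum over a finite list: no coefficients are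
    carried, and the list can be enlarged freely. *)
Let finite_span : set H := [set y | exists s,
  [/\ forall t, t \in s -> I t, uniq s & y = partial s y]].

Let partial_sub s s' y : uniq s -> uniq s' -> {subset s <= s'} ->
  (forall t, t \in s' -> I t) -> y = partial s y -> y = partial s' y.
Proof.
move=> us us' ss' sI' yE; rewrite {1}yE /partial [RHS](bigID (mem s))/=.
rewrite [X in _ + X]big1_seq ?addr0; last first.
  move=> t /andP[ts ts']; rewrite yE dot_sum ?(negPf ts) ?scale0r//; last exact: sI'.
  by move=> u /ss'/sI'.
rewrite -[RHS]big_filter; apply: perm_big; apply: uniq_perm => //; first exact: filter_uniq.
by move=> t; rewrite mem_filter /=; case: (boolP (t \in s)) => // /ss' ->.
Qed.

Let finite_span_subspace : subspace finite_span.
Proof.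
split; first by exists [::]; split=> //; rewrite /partial big_nil.
move=> a x y [s [sI us xE]] [s' [sI' us' yE]].
pose r := undup (s ++ s').
have ur : uniq r by exact: undup_uniq.
have rI t : t \in r -> I t by rewrite mem_undup mem_cat => /orP[/sI|/sI'].
exists r; split=> //.
rewrite [in LHS](@partial_sub s r x)//; last by move=> t ts; rewrite mem_undup mem_cat ts.
rewrite [in LHS](@partial_sub s' r y)//; last by move=> t ts; rewrite mem_undup mem_cat ts orbT.
rewrite /partial scaler_sumr -big_split /=; apply: eq_bigr => t _.
by rewrite dotDl dotZl scalerDl scalerA.
Qed.

(** One direction is Bessel's inequality. For the other, the residual of [f] against the finite span
    is orthogonal to every [b t], hence zero, so [f] is a limit of finite sums. *)
Lemma parseval_orthonormal f : (\esum_(t in I) (dot f (b t) ^+ 2)%:E = (sqn f)%:E)%E.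
Proof.
apply/eqP; rewrite eq_le; apply/andP; split.
  apply: ge_ereal_sup => _ [X [finX XI] <-].
  rewrite fsbig_finite//= sumEFin lee_fin.
  have := sqn_ge0 (f - partial (enum_fset (fset_set X)) f); rewrite sqn_sub//; last first.
    by move=> t; rewrite in_fset_set// => /set_mem/XI.
  rewrite subr_ge0; apply: le_trans; rewrite le_eqVlt; apply/orP; left; apply/eqP.
  by apply: eq_bigr => t _; ring.
have [p fp [u Mu up]] := proj_approx f finite_span_subspace.
have fE : f = p.
  apply/subr0_eq/b_total => t It; apply: fp.
  exists [:: t]; split=> //; first by move=> v; rewrite inE => /eqP ->.
  by rewrite /partial big_seq1 b_orthonormal// eqxx scale1r.
apply/lee_addgt0Pr => e e0.
have [N /(_ N (leqnn N)) hN] := up _ e0.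
have [s [sI us uE]] := Mu N.
have h : sqn f <= \sum_(t <- s) dot f (b t) ^+ 2 + e.
  rewrite -fE sqnBC uE sqn_sub// in hN.
  have : \sum_(t <- s) (2 * dot (u N) (b t) * dot f (b t) - dot (u N) (b t) ^+ 2) <=
      \sum_(t <- s) dot f (b t) ^+ 2.
    apply: ler_sum => t _; have := sqr_ge0 (dot (u N) (b t) - dot f (b t)).
    by rewrite sqrrB; lra.
  lra.
apply: (@le_trans _ _ (\sum_(t <- s) dot f (b t) ^+ 2 + e)%:E); first by rewrite lee_fin.
rewrite EFinD leeD2r//; apply: esum_ge.
exists [set` s]; first by split=> //.
by rewrite -sumEFin fsbig_seq.
Qed.

End Parseval.

(** * The space L_2 *)

Section L2Space.
Context d (T : measurableType d) (R : realType) (mu : {measure set T -> \bar R}).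
Local Notation L0 := (L0 mu).
Implicit Types (f g h : L0) (A B : set T).
Local Notation re f x := (complex.Re (fun_of f x)).
Local Notation im f x := (complex.Im (fun_of f x)).

Lemma normc_sqr (z : R[i]) : cabs z ^+ 2 = complex.Re z ^+ 2 + complex.Im z ^+ 2.
Proof. by case: z => a b /=; rewrite sqr_sqrtr// addr_ge0 ?sqr_ge0. Qed.

Lemma fun_of_measurable f : cmeasurable (fun_of f).
Proof. by rewrite /fun_of; case: (repr f) => h /=; rewrite inE. Qed.

Lemma re_measurable f : measurable_fun setT (fun x => re f x).
Proof. by have [] := fun_of_measurable f. Qed.

Lemma im_measurable f : measurable_fun setT (fun x => im f x).
Proof. by have [] := fun_of_measurable f. Qed.

Lemma L0_eqP f g : {ae mu, forall x, fun_of f x = fun_of g x} -> f = g.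
Proof.
move=> fg; rewrite -(class_of_fun f) -(class_of_fun g).
by apply/pi_L0P; rewrite /fun_of !valKd.
Qed.

Lemma fun_of_pi (h : cmfun T R) :
  {ae mu, forall x, fun_of (\pi_(L0)%qT h) x = h x}.
Proof. by apply/pi_L0P; rewrite reprK. Qed.

Lemma fun_ofD f g : {ae mu, forall x, fun_of (f + g) x = fun_of f x + fun_of g x}.
Proof.
have e : f + g = \pi_(L0)%qT (repr f + repr g).
  by rewrite -{1}[f]reprK -{1}[g]reprK -raddfD.
by apply: filterS (fun_of_pi (repr f + repr g)) => x; rewrite -e.
Qed.

Lemma fun_ofZ a f : {ae mu, forall x, fun_of (a *: f) x = a * fun_of f x}.
Proof. exact: fun_of_pi. Qed.

Lemma fun_of0 : {ae mu, forall x, fun_of (0 : L0) x = 0}.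
Proof.
by apply: filterS (fun_ofZ 0 0) => x; rewrite scale0r mul0r.
Qed.

Lemma fun_ofB f g : {ae mu, forall x, fun_of (f - g) x = fun_of f x - fun_of g x}.
Proof.
apply: filterS2 (fun_ofD f (-1 *: g)) (fun_ofZ (-1) g) => x.
by rewrite scaleN1r mulN1r => -> ->.
Qed.

Lemma fun_of_chi A f : measurable A ->
  {ae mu, forall x, fun_of (chi A f) x = (\1_A x : R)%:C%C * fun_of f x}.
Proof.
move=> mA; apply: fun_of_class; split.
- rewrite (_ : (fun _ => _) = (fun x => (\1_A x : R) * re f x)).
    by apply: measurable_funM => //; exact: re_measurable.
  by apply/funext => x; case: (fun_of f x) => a b /=; rewrite mul0r subr0.
- rewrite (_ : (fun _ => _) = (fun x => (\1_A x : R) * im f x)).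
    by apply: measurable_funM => //; exact: im_measurable.
  by apply/funext => x; case: (fun_of f x) => a b /=; rewrite mul0r addr0.
Qed.

Lemma chiD A f g : measurable A -> chi A (f + g) = chi A f + chi A g.
Proof.
move=> mA; apply: L0_eqP.
near=> x.
rewrite (near (fun_of_chi (f + g) mA) x)// (near (fun_ofD f g) x)//.
rewrite (near (fun_ofD (chi A f) (chi A g)) x)// (near (fun_of_chi f mA) x)//.
by rewrite (near (fun_of_chi g mA) x)// mulrDr.
Unshelve. all: by end_near. Qed.

Lemma chiZ A a f : measurable A -> chi A (a *: f) = a *: chi A f.
Proof.
move=> mA; apply: L0_eqP; near=> x.
rewrite (near (fun_of_chi (a *: f) mA) x)// (near (fun_ofZ a f) x)//.
by rewrite (near (fun_ofZ a (chi A f)) x)// (near (fun_of_chi f mA) x)// mulrCA.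
Unshelve. all: by end_near. Qed.

Lemma chi0 A : measurable A -> chi A (0 : L0) = 0.
Proof. by move=> mA; have := chiZ 0 0 mA; rewrite !scale0r. Qed.

Lemma chi_chi A B f : measurable A -> measurable B -> chi A (chi B f) = chi (A `&` B) f.
Proof.
move=> mA mB; apply: L0_eqP; near=> x.
rewrite (near (fun_of_chi (chi B f) mA) x)// (near (fun_of_chi f mB) x)//.
rewrite (near (fun_of_chi f (measurableI _ _ mA mB)) x)//.
by rewrite mulrA -rmorphM indicI.
Unshelve. all: by end_near. Qed.

Definition sqf f (x : T) : R := re f x ^+ 2 + im f x ^+ 2.

Lemma sqf_ge0 f x : 0 <= sqf f x.
Proof. by rewrite addr_ge0 ?sqr_ge0. Qed.

Lemma sqf_measurable f : measurable_fun setT (sqf f).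
Proof.
by apply: measurable_funD; apply: measurable_funX; [exact: re_measurable|exact: im_measurable].
Qed.

Lemma sqnorm_onE A f : sqnorm_on A f = (\int[mu]_(x in A) (sqf f x)%:E)%E.
Proof. by apply: eq_integral => x _; rewrite normc_sqr. Qed.

Definition sqint f : \bar R := sqnorm_on setT f.

Lemma sqintE f : sqint f = (\int[mu]_x (sqf f x)%:E)%E.
Proof. exact: sqnorm_onE. Qed.

Lemma sqint_ge0 f : (0 <= sqint f)%E.
Proof. by rewrite sqintE; apply: integral_ge0 => x _; rewrite lee_fin sqf_ge0. Qed.

Lemma sqint_le (a b : R) f g h : 0 <= a -> 0 <= b ->
  {ae mu, forall x, sqf f x <= a * sqf g x + b * sqf h x} ->
  (sqint f <= a%:E * sqint g + b%:E * sqint h)%E.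
Proof.
move=> a0 b0 fgh; rewrite !sqintE.
have m k : measurable_fun setT (fun x => (sqf k x)%:E : \bar R).
  by apply/measurable_EFinP; exact: sqf_measurable.
have s0 k x : (0 <= (sqf k x)%:E :> \bar R)%E by rewrite lee_fin sqf_ge0.
rewrite -!ge0_integralZl//; [|by move=> x _; exact: s0..].
rewrite -ge0_integralD//; last 4 first.
- by move=> x _; rewrite mule_ge0.
- by apply: measurable_funeM; exact: m.
- by move=> x _; rewrite mule_ge0.
- by apply: measurable_funeM; exact: m.
apply: ae_ge0_le_integral => //.
- by move=> x _; rewrite adde_ge0 ?mule_ge0.
- by apply: emeasurable_funD; apply: measurable_funeM; exact: m.
- apply: filterS fgh => x h1 _; rewrite -!EFinM -EFinD lee_fin; exact: h1.
Qed.

Lemma sqintD_le f g : (sqint (f + g)%R <= 2%:E * sqint f + 2%:E * sqint g)%E.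
Proof.
apply: sqint_le => //; apply: filterS (fun_ofD f g) => x.
rewrite /sqf => ->; case: (fun_of f x) (fun_of g x) => a b [c e] /=.
have := sqr_ge0 (a - c); have := sqr_ge0 (b - e); nra.
Qed.

Lemma sqintZ a f : sqint (a *: f) = ((cabs a ^+ 2)%:E * sqint f)%E.
Proof.
rewrite !sqintE -ge0_integralZl//; last 3 first.
- by apply/measurable_EFinP; exact: sqf_measurable.
- by move=> x _; rewrite lee_fin sqf_ge0.
- by rewrite lee_fin sqr_ge0.
apply: ge0_ae_eq_integral => //.
- by apply/measurable_EFinP; exact: sqf_measurable.
- by apply/measurable_funeM/measurable_EFinP; exact: sqf_measurable.
- by move=> x _; rewrite lee_fin sqf_ge0.
- by move=> x _; rewrite mule_ge0// lee_fin ?sqr_ge0 ?sqf_ge0.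
- apply: filterS (fun_ofZ a f) => x; rewrite /sqf => -> _.
  rewrite -EFinM; congr EFin; rewrite normc_sqr.
  by case: a (fun_of f x) => a b [c e] /=; ring.
Qed.

Lemma sqint0 : sqint 0 = 0%E.
Proof. by rewrite -(scale0r (0 : L0)) sqintZ normc_sqr /= !expr0n addr0 mul0e. Qed.

Lemma sqint_eq0 f : sqint f = 0%E -> f = 0.
Proof.
rewrite sqintE => f0; apply: L0_eqP.
have /(ae_eq_integral_abs mu measurableT) : measurable_fun setT (fun x => (sqf f x)%:E : \bar R).
  by apply/measurable_EFinP; exact: sqf_measurable.
move=> [+ _]; under eq_integral do rewrite gee0_abs ?lee_fin ?sqf_ge0//.
move=> /(_ f0) h; apply: filterS2 h fun_of0 => x /(_ I) /= [+] ->.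
rewrite /sqf; case: (fun_of f x) => a b /= /eqP.
by rewrite paddr_eq0 ?sqr_ge0// !sqrf_eq0 => /andP[/eqP-> /eqP->].
Qed.

Lemma sqf_chi A f : measurable A ->
  {ae mu, forall x, sqf (chi A f) x = \1_A x * sqf f x}.
Proof.
move=> mA; apply: filterS (fun_of_chi f mA) => x; rewrite /sqf => ->.
rewrite indicE; case: (fun_of f x) => a b /=; case: (x \in A) => /=;
  by rewrite ?(mul0r, mul1r, subr0, addr0, expr0n).
Qed.

Lemma sqnorm_on_chi A f : measurable A -> sqnorm_on A f = sqint (chi A f).
Proof.
move=> mA; rewrite sqnorm_onE integral_mkcond sqintE.
apply: ge0_ae_eq_integral => //.
- apply/(measurable_restrictT _ mA).1.
  by apply: measurable_funTS; apply/measurable_EFinP; exact: sqf_measurable.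
- by apply/measurable_EFinP; exact: sqf_measurable.
- by move=> x _; apply: erestrict_ge0 => y _; rewrite lee_fin sqf_ge0.
- by move=> x _; rewrite lee_fin sqf_ge0.
- apply: filterS (sqf_chi f mA) => x -> _; rewrite patchE indicE.
  by case: (x \in A); rewrite ?mul1r ?mul0r.
Qed.

Lemma sqint_chi_le A B f : measurable A -> measurable B -> A `<=` B ->
  (sqint (chi A f) <= sqint (chi B f))%E.
Proof.
move=> mA mB AB.
have := @sqint_le 1 0 (chi A f) (chi B f) 0 ler01 (lexx _).
rewrite mul1e mul0e adde0; apply.
apply: filterS2 (sqf_chi f mA) (sqf_chi f mB) => x -> ->.
rewrite mul0r addr0 mul1r ler_wpM2r ?sqf_ge0//.
by rewrite !indicE ler_nat; case: (boolP (x \in A)) => //= /set_mem/AB/mem_set ->.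
Qed.

Lemma chiT f : chi setT f = f.
Proof.
apply: L0_eqP; apply: filterS (fun_of_chi f measurableT) => x ->.
by rewrite indicT mul1r.
Qed.

Lemma chi_setU_le A B f : measurable A -> measurable B ->
  (sqint (chi (A `|` B) f) <= sqint (chi A f) + sqint (chi B f))%E.
Proof.
move=> mA mB.
have h : {ae mu, forall x, sqf (chi (A `|` B) f) x <=
    1 * sqf (chi A f) x + 1 * sqf (chi B f) x}.
  apply: filterS3 (sqf_chi f (measurableU _ _ mA mB)) (sqf_chi f mA) (sqf_chi f mB) => x -> -> ->.
  rewrite !mul1r -mulrDl ler_wpM2r ?sqf_ge0//.
  by rewrite !indicE in_setU -natrD ler_nat; case: (x \in A); case: (x \in B).
by rewrite -[sqint (chi A f)]mul1e -[sqint (chi B f)]mul1e; exact: sqint_le.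
Qed.

Lemma L2E f : L2 f <-> (sqint f < +oo)%E. Proof. by []. Qed.

Lemma sqint_fin f : L2 f -> sqint f \is a fin_num.
Proof. by move=> f2; rewrite ge0_fin_numE ?sqint_ge0. Qed.

Lemma chi_L2 A f : measurable A -> L2 f -> L2 (chi A f).
Proof.
move=> mA /L2E f2; apply/L2E; apply: le_lt_trans f2.
by rewrite -{2}(chiT f); apply: sqint_chi_le.
Qed.

Lemma chi_sub A f : measurable A -> chi A f - f = -1 *: chi (~` A) f.
Proof.
move=> mA; apply: L0_eqP; near=> x.
rewrite (near (fun_ofB (chi A f) f) x)// (near (fun_of_chi f mA) x)//.
rewrite (near (fun_ofZ (-1) (chi (~` A) f)) x)//.
rewrite (near (fun_of_chi f (measurableC mA)) x)// !indicE in_setC.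
by case: (x \in A); rewrite /= ?rmorph1 ?rmorph0 ?mul1r ?mul0r ?subrr ?mulr0 ?sub0r ?mulN1r.
Unshelve. all: by end_near. Qed.

Lemma cvg_sqint_chi (A : nat -> set T) f : (forall n, measurable (A n)) ->
  {homo A : m n / (m <= n)%N >-> m `<=` n} -> \bigcup_n A n = setT ->
  (fun n => sqint (chi (A n) f)) @ \oo --> sqint f.
Proof.
move=> mA ndA UA.
have m : measurable_fun setT (fun x => (sqf f x)%:E : \bar R).
  by apply/measurable_EFinP; exact: sqf_measurable.
rewrite (_ : (fun n => _) = (fun n => \int[mu]_(x in A n) (sqf f x)%:E)%E); last first.
  by apply/funext => n; rewrite -sqnorm_on_chi// sqnorm_onE.
rewrite sqintE -UA; apply: ge0_nondecreasing_set_cvg_integral => //.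
- by move=> p q /ndA; rewrite subsetEset.
- by move=> i; exact: measurable_funTS.
- by move=> i x _; rewrite lee_fin sqf_ge0.
Qed.

(** Monotone convergence; this is how bounded truncations place an element of V in L_2. *)
Lemma sqint_le_chi (A : nat -> set T) f (D : \bar R) : (forall n, measurable (A n)) ->
  {homo A : m n / (m <= n)%N >-> m `<=` n} -> \bigcup_n A n = setT ->
  (forall n, (sqint (chi (A n) f) <= D)%E) -> (sqint f <= D)%E.
Proof.
move=> mA ndA UA hD; have h := @cvg_sqint_chi A f mA ndA UA.
rewrite -(cvg_lim _ h)//; apply: lime_le; first by apply/cvg_ex; exists (sqint f).
exact: nearW.
Qed.

Lemma chi_cvg (A : nat -> set T) f : (forall n, measurable (A n)) ->
  {homo A : m n / (m <= n)%N >-> m `<=` n} -> \bigcup_n A n = setT -> L2 f ->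
  forall e : R, 0 < e -> exists N, forall n, (N <= n)%N ->
    (sqint (chi (A n) f - f)%R < e%:E)%E.
Proof.
move=> mA ndA UA f2 e e0.
have m : measurable_fun setT (fun x => (sqf f x)%:E : \bar R).
  by apply/measurable_EFinP; exact: sqf_measurable.
have s0 x : setT x -> (0 <= (sqf f x)%:E :> \bar R)%E by rewrite lee_fin sqf_ge0.
have split n : (sqint f = sqint (chi (A n) f) + sqint (chi (A n) f - f)%R)%E.
  have mC := measurableC (mA n).
  rewrite chi_sub// sqintZ normc_sqr /= oppr0 expr0n addr0 sqrrN expr1n mul1e.
  rewrite -!sqnorm_on_chi// !sqnorm_onE -ge0_integral_setU//.
  - by rewrite setUv sqintE.
  - by rewrite setUv.
  - by rewrite setUv => x /s0.
  - by apply/disj_setPS; rewrite setICr.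
have ffin := sqint_fin f2.
have := @cvg_sqint_chi A f mA ndA UA.
rewrite -(fineK ffin) => /fine_cvgP[_] /cvgrPdist_lt /(_ _ e0)[N _ hN].
exists N => n /hN /= h.
have := ffin; rewrite (split n) fin_numD => /andP[cfin bfin].
rewrite -(fineK bfin) lte_fin; apply: le_lt_trans h.
apply: le_trans (ler_norm _).
by rewrite lerBrDl -fineD// -split.
Qed.

End L2Space.

(** * The real inner product on L_2 *)

Section L2RealInner.
Context d (T : measurableType d) (R : realType) (mu : {measure set T -> \bar R}).
Local Notation L0 := (L0 mu).
Implicit Types (f g h : L0) (A B : set T).
Local Notation re f x := (complex.Re (fun_of f x)).
Local Notation im f x := (complex.Im (fun_of f x)).

Definition rdot_fun f g (x : T) : R := re f x * re g x + im f x * im g x.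

Definition rdot f g : R := \int[mu]_x rdot_fun f g x.

Lemma rdot_fun_measurable f g : measurable_fun setT (rdot_fun f g).
Proof.
by apply: measurable_funD; apply: measurable_funM;
  [exact: re_measurable|exact: re_measurable|exact: im_measurable|exact: im_measurable].
Qed.

Lemma Rintegral_ae (u v : T -> R) : measurable_fun setT u -> measurable_fun setT v ->
  {ae mu, forall x, u x = v x} -> \int[mu]_x u x = \int[mu]_x v x.
Proof.
move=> mu_ mv uv; congr fine; apply: ae_eq_integral => //; try exact/measurable_EFinP.
by apply: filterS uv => x -> _.
Qed.

Lemma sqf_integrable f : L2 f -> mu.-integrable setT (EFin \o sqf f).
Proof.
move=> f2; apply/integrableP; split; first exact/measurable_EFinP/sqf_measurable.
under eq_integral do rewrite /= ger0_norm ?sqf_ge0//.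
by rewrite -sqintE.
Qed.

Lemma rdot_fun_integrable f g : L2 f -> L2 g ->
  mu.-integrable setT (EFin \o rdot_fun f g).
Proof.
move=> f2 g2.
apply: (@le_integrable _ _ _ mu setT measurableT _ (EFin \o (fun x => sqf f x + sqf g x))).
- exact/measurable_EFinP/rdot_fun_measurable.
- move=> x _ /=; rewrite lee_fin [leRHS]ger0_norm; last exact: addr_ge0 (sqf_ge0 _ _) (sqf_ge0 _ _).
  rewrite ler_norml /sqf /rdot_fun.
  move: (fun_of f x) (fun_of g x) => [a b] [c e] /=.
  have := sqr_ge0 (a - c); have := sqr_ge0 (b - e).
  have := sqr_ge0 (a + c); have := sqr_ge0 (b + e).
  by move=> h1 h2 h3 h4; apply/andP; split; nra.
- exact: (integrableD measurableT (sqf_integrable f2) (sqf_integrable g2)).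
Qed.

Lemma rdotC f g : rdot f g = rdot g f.
Proof. by apply: eq_Rintegral => x _; rewrite /rdot_fun mulrC [X in _ + X]mulrC. Qed.

Lemma rdotDl f g h : L2 f -> L2 g -> L2 h -> rdot (f + g) h = rdot f h + rdot g h.
Proof.
move=> f2 g2 h2; rewrite /rdot -RintegralD//; [|exact: rdot_fun_integrable..].
apply: Rintegral_ae; first exact: rdot_fun_measurable.
  by apply: measurable_funD; exact: rdot_fun_measurable.
apply: filterS (fun_ofD f g) => x; rewrite /rdot_fun => ->.
by move: (fun_of f x) (fun_of g x) => [a b] [c e] /=; ring.
Qed.

Lemma rdotZl (r : R) f h : L2 f -> L2 h -> rdot (r%:C%C *: f) h = r * rdot f h.
Proof.
move=> f2 h2; rewrite /rdot -RintegralZl//; last exact: rdot_fun_integrable.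
apply: Rintegral_ae; first exact: rdot_fun_measurable.
  by apply: measurable_funM => //; exact: rdot_fun_measurable.
apply: filterS (fun_ofZ r%:C%C f) => x; rewrite /rdot_fun => ->.
by move: (fun_of f x) => [a b] /=; ring.
Qed.

Lemma rdot_sqint f : rdot f f = fine (sqint f).
Proof.
rewrite sqintE; congr fine; apply: eq_integral => x _; congr EFin.
Qed.

Lemma rdot_iZ f g : L2 f -> L2 ('i%C *: g) -> rdot ('i%C *: f) g = - rdot f ('i%C *: g).
Proof.
move=> f2 g2; rewrite -mulN1r /rdot -RintegralZl//; last exact: rdot_fun_integrable.
apply: Rintegral_ae; first exact: rdot_fun_measurable.
  by apply: measurable_funM => //; exact: rdot_fun_measurable.
apply: filterS2 (fun_ofZ 'i%C f) (fun_ofZ 'i%C g) => x; rewrite /rdot_fun => -> ->.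
by move: (fun_of f x) (fun_of g x) => [a b] [c e] /=; ring.
Qed.

(** By conjugate-linearity in [g], the imaginary part of [<f, g>] is the real part of [<f, i g>]. *)
Lemma innerE f g : inner f g = (rdot f g +i* rdot f ('i%C *: g))%C.
Proof.
rewrite /inner; congr (_ +i* _)%C.
  apply: eq_Rintegral => x _; rewrite /rdot_fun.
  by move: (fun_of f x) (fun_of g x) => [a b] [c e] /=; ring.
apply: Rintegral_ae; last 2 first.
- exact: rdot_fun_measurable.
- apply: filterS (fun_ofZ 'i%C g) => x; rewrite /rdot_fun => ->.
  by move: (fun_of f x) (fun_of g x) => [a b] [c e] /=; ring.
rewrite (_ : (fun _ => _) = (fun x => im f x * re g x - re f x * im g x)).
  by apply: measurable_funB; apply: measurable_funM;
    [exact: im_measurable|exact: re_measurable|exact: re_measurable|exact: im_measurable].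
apply/funext => x.
by move: (fun_of f x) (fun_of g x) => [a b] [c e] /=; ring.
Qed.

Lemma norm2E f : norm2 f = Num.sqrt (rdot f f).
Proof. by rewrite rdot_sqint. Qed.

Lemma L2D f g : L2 f -> L2 g -> L2 (f + g).
Proof.
move=> f2 g2; apply/L2E; apply: (le_lt_trans (sqintD_le f g)).
by rewrite lte_add_pinfty// lte_mul_pinfty// ?sqint_fin.
Qed.

Lemma L2Z a f : L2 f -> L2 (a *: f).
Proof.
by move=> f2; apply/L2E; rewrite sqintZ lte_mul_pinfty// lee_fin sqr_ge0.
Qed.

Lemma L2_0 : L2 (0 : L0). Proof. by apply/L2E; rewrite sqint0. Qed.

Lemma L2B f g : L2 f -> L2 g -> L2 (f - g).
Proof. by move=> f2 g2; apply: L2D => //; rewrite -scaleN1r; exact: L2Z. Qed.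

Lemma rdot_chi A f g : measurable A -> rdot (chi A f) g = rdot f (chi A g).
Proof.
move=> mA; apply: Rintegral_ae; try exact: rdot_fun_measurable.
apply: filterS2 (fun_of_chi f mA) (fun_of_chi g mA) => x; rewrite /rdot_fun => -> ->.
by rewrite indicE; move: (fun_of f x) (fun_of g x) => [a b] [c e] /=; ring.
Qed.

End L2RealInner.

(** * Completeness of L_2 *)

Section L2Completeness.
Context d (T : measurableType d) (R : realType) (mu : {measure set T -> \bar R}).
Local Notation L0 := (L0 mu).
Implicit Types (f g h : L0) (v : nat -> L0).
Local Notation re f x := (complex.Re (fun_of f x)).
Local Notation im f x := (complex.Im (fun_of f x)).

Lemma geometric_increments (r : nat -> R) (c : R) : 0 <= c ->
  (forall k, `|r k.+1 - r k| <= c * 2^-1 ^+ k) ->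
  exists l : R, r @ \oo --> l /\ forall k, `|r k - l| <= 2 * c * 2^-1 ^+ k.
Proof.
move=> c0 h.
have h2 k n : `|r (n + k)%N - r k| <= 2 * c * 2^-1 ^+ k - 2 * c * 2^-1 ^+ (n + k).
  elim: n => [|n IH]; first by rewrite !subrr normr0.
  rewrite addSn; apply: (le_trans (ler_distD (r (n + k)%N) _ _)).
  by have := h (n + k)%N; rewrite exprS; lra.
have geo e : 0 < e -> exists N, forall n, (N <= n)%N -> 2 * c * 2^-1 ^+ n < e.
  move=> e0.
  have : (fun n => 2 * c * 2^-1 ^+ n) @ \oo --> (2 * c * 0 : R).
    by apply: cvgMr; apply: cvg_expr; rewrite ger0_norm ?invr_ge0//; lra.
  rewrite mulr0 => /cvgrPdist_lt /(_ _ e0) [N _ hN]; exists N => n /hN /=.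
  by rewrite sub0r normrN; apply: le_lt_trans; exact: ler_norm.
have p0 n : 0 <= 2 * c * 2^-1 ^+ n by rewrite !mulr_ge0 ?exprn_ge0.
have [l rl] : exists l : R, r @ \oo --> l.
  suff hc : cauchy (r @ \oo).
    have /cvg_ex[l hl] : cvg (r @ \oo) by exact/cauchy_cvgP.
    by exists l.
  apply: cauchy_exP => e e0; have [N hN] := geo _ e0.
  exists (r N), N => // n /= Nn; rewrite /ball/= distrC.
  have := h2 N (n - N)%N; rewrite subnK// => h3.
  by apply: (le_lt_trans h3); have := hN _ (leqnn N); have := p0 n; lra.
exists l; split=> // k.
rewrite distrC; have : (fun n => `|r n - r k|) @ \oo --> `|l - r k|.
  by apply: cvg_norm; apply: cvgB => //; exact: cvg_cst.
move=> /cvg_lim <-//; apply: limr_le.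
  by apply/cvg_ex; exists `|l - r k|; apply: cvg_norm; apply: cvgB => //; exact: cvg_cst.
exists k => // n /= kn; have := h2 k (n - k)%N; rewrite subnK//.
by have := p0 n; lra.
Qed.

(* [sum_k 4^k |v (k+1) - v k|^2] is integrable, hence a.e. finite, which makes [v]
   converge geometrically a.e. *)
Lemma fast_cauchy_cvg v : (forall k, (sqint (v k.+1 - v k)%R <= (16^-1 ^+ k)%:E)%E) ->
  exists F, forall k, (sqint (v k - F)%R <= (16 * 4^-1 ^+ k)%:E)%E.
Proof.
move=> vS.
pose w k x : R := (re (v k.+1) x - re (v k) x) ^+ 2 + (im (v k.+1) x - im (v k) x) ^+ 2.
have w0 k x : 0 <= w k x by rewrite addr_ge0 ?sqr_ge0.
have mre k : measurable_fun setT (fun x => re (v k) x) := re_measurable (v k).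
have mim k : measurable_fun setT (fun x => im (v k) x) := im_measurable (v k).
have mw k : measurable_fun setT (w k).
  by apply: measurable_funD; apply: measurable_funX; apply: measurable_funB.
have iw k : (\int[mu]_x (w k x)%:E = sqint (v k.+1 - v k)%R)%E.
  rewrite sqintE; apply: ge0_ae_eq_integral => //.
  - exact/measurable_EFinP.
  - exact/measurable_EFinP/sqf_measurable.
  - by move=> x _; rewrite lee_fin.
  - by move=> x _; rewrite lee_fin sqf_ge0.
  - apply: filterS (fun_ofB (v k.+1) (v k)) => x; rewrite /sqf => -> _.
    by rewrite /w; move: (fun_of (v k.+1) x) (fun_of (v k) x) => [a b] [c e].
pose h k x : \bar R := (4 ^+ k * w k x)%:E.
have h0 k x : (0 <= h k x)%E by rewrite lee_fin mulr_ge0 ?exprn_ge0.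
have mh k : measurable_fun setT (h k).
  by apply/measurable_EFinP; apply: measurable_funM.
pose g x : \bar R := (\sum_(k <oo) h k x)%E.
have g0 x : (0 <= g x)%E by apply: nneseries_ge0 => k _ _.
have mg : measurable_fun setT g by apply: ge0_emeasurable_sum => // k x _ _; exact: h0.
(* The terms are at most [4^k 16^-k = 4^-k], and the geometric series sums to [4 / 3]. *)
have ig : (\int[mu]_x g x <= 2%:E)%E.
  rewrite integral_nneseries//.
  apply: lime_le; first by apply: is_cvg_nneseries => k _ _; exact: integral_ge0.
  apply: nearW => n.
  apply: (@le_trans _ _ (\sum_(0 <= k < n) (4^-1 ^+ k)%:E)%E).
    apply: lee_sum => k _; rewrite /h.
    under eq_integral do rewrite EFinM.
    rewrite ge0_integralZl_EFin ?exprn_ge0//; [|by move=> x _; rewrite lee_fin|exact/measurable_EFinP].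
    rewrite iw; apply: (@le_trans _ _ ((4 ^+ k)%:E * (16^-1 ^+ k)%:E)%E).
      by apply: lee_wpmul2l => //; rewrite lee_fin exprn_ge0.
    rewrite -EFinM lee_fin -exprMn le_eqVlt; apply/orP; left; apply/eqP.
    by congr (_ ^+ _); lra.
  rewrite sumEFin lee_fin.
  suff : \sum_(0 <= k < n) 4^-1 ^+ k <= 4 / 3 - 4 / 3 * 4^-1 ^+ n :> R.
    have p : 0 <= 4^-1 ^+ n :> R by rewrite exprn_ge0.
    by lra.
  elim: n => [|n IH]; first by rewrite big_geq// expr0; lra.
  rewrite big_nat_recr//= exprS.
  have p : 0 <= 4^-1 ^+ n :> R by rewrite exprn_ge0.
  by lra.
have gfin : {ae mu, forall x, (g x < +oo)%E}.
  have : mu.-integrable setT g.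
    apply/integrableP; split=> //.
    under eq_integral do rewrite gee0_abs//.
    exact: le_lt_trans ig (ltry _).
  move=> /(integrable_ae measurableT); apply: filterS => x /(_ I).
  by rewrite ge0_fin_numE.
pose G := [set x | (g x < +oo)%E].
have mG : measurable G.
  by rewrite -[G]setTI; exact: emeasurable_fun_infty_o.
have hg x k : G x -> 4 ^+ k * w k x <= fine (g x).
  move=> Gx; rewrite -lee_fin fineK ?ge0_fin_numE//.
  apply: le_trans (nneseries_lim_ge k.+1 _); last by move=> *; exact: h0.
  by rewrite big_nat_recr//= leeDr// sume_ge0.
have inc x k : G x -> w k x <= (Num.sqrt (fine (g x)) * 2^-1 ^+ k) ^+ 2.
  move=> Gx; rewrite exprMn sqr_sqrtr ?fine_ge0// -exprM mulnC exprM.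
  have -> : 2^-1 ^+ 2 = 4^-1 :> R by lra.
  by rewrite exprVn ler_pdivlMr ?exprn_gt0// mulrC; exact: hg.
have sq_le (a b c : R) : 0 <= c -> a ^+ 2 + b ^+ 2 <= c ^+ 2 -> `|a| <= c.
  move=> c0 ab; rewrite -(ler_pXn2r (n := 2)) ?nnegrE// real_normK ?num_real//.
  by apply: le_trans ab; rewrite lerDl sqr_ge0.
have sq_le' (a b c : R) : 0 <= c -> a ^+ 2 + b ^+ 2 <= c ^+ 2 -> `|b| <= c.
  by move=> c0; rewrite addrC; exact: sq_le.
have p0 x k : 0 <= Num.sqrt (fine (g x)) * 2^-1 ^+ k by rewrite mulr_ge0 ?sqrtr_ge0 ?exprn_ge0.
have lre x : exists l : R, G x -> (fun k => re (v k) x) @ \oo --> l /\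
    forall k, `|re (v k) x - l| <= 2 * Num.sqrt (fine (g x)) * 2^-1 ^+ k.
  have [Gx|] := pselect (G x); last by exists 0.
  have [l hl] := geometric_increments (sqrtr_ge0 _)
    (fun k => sq_le _ _ _ (p0 x k) (inc x k Gx)).
  by exists l.
have lim_ x : exists l : R, G x -> (fun k => im (v k) x) @ \oo --> l /\
    forall k, `|im (v k) x - l| <= 2 * Num.sqrt (fine (g x)) * 2^-1 ^+ k.
  have [Gx|] := pselect (G x); last by exists 0.
  have [l hl] := geometric_increments (sqrtr_ge0 _)
    (fun k => sq_le' _ _ _ (p0 x k) (inc x k Gx)).
  by exists l.
have [fr hfr] := choice lre; have [fi hfi] := choice lim_.
have mlim (a : nat -> T -> R) (l : T -> R) : (forall k, measurable_fun setT (a k)) ->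
    (forall x, G x -> (fun k => a k x) @ \oo --> l x) ->
    measurable_fun setT (fun x => \1_G x * l x).
  move=> ma al; apply: (@measurable_fun_cvg _ _ _ _ (fun k x => \1_G x * a k x)).
    by move=> k; apply: measurable_funM => //; exact: measurable_indic.
  move=> x _; rewrite /= indicE; case: (boolP (x \in G)) => [/set_mem Gx|_].
    by apply: cvgMr; exact: al.
  by rewrite mul0r; under eq_fun do rewrite mul0r; exact: cvg_cst.
(* The limits are arbitrary off [G]; the indicator makes [F0] a pointwise limit of measurable
   functions everywhere. *)
pose F0 x := ((\1_G x * fr x) +i* (\1_G x * fi x))%C.
have mF0 : cmeasurable F0.
  split; first by apply: mlim mre _ => x /hfr[].
  by apply: mlim mim _ => x /hfi[].
exists (class_of mu F0) => k.
(* Real and imaginary parts each contribute [4 * 4^-k * g], and [g] has integral at most 2: hence 8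
   here and 16 in the conclusion. *)
rewrite sqintE; apply: (@le_trans _ _ (\int[mu]_x ((8 * 4^-1 ^+ k)%:E * g x))%E).
  apply: ae_ge0_le_integral => //.
  - by move=> x _; rewrite lee_fin sqf_ge0.
  - exact/measurable_EFinP/sqf_measurable.
  - by move=> x _; rewrite mule_ge0// lee_fin mulr_ge0 ?exprn_ge0.
  - exact: measurable_funeM.
  - apply: filterS3 gfin (fun_ofB (v k) (class_of mu F0)) (fun_of_class mu mF0) => x Gx.
    rewrite /sqf => -> -> _; rewrite /F0 indicE mem_set// !mul1r.
    rewrite -(fineK (_ : g x \is a fin_num)) ?ge0_fin_numE// -EFinM lee_fin.
    have [_ /(_ k) hr] := hfr _ Gx; have [_ /(_ k) hi] := hfi _ Gx.
    have E : (2 * Num.sqrt (fine (g x)) * 2^-1 ^+ k) ^+ 2 = 4 * 4^-1 ^+ k * fine (g x).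
      rewrite !exprMn sqr_sqrtr ?fine_ge0// -exprM mulnC exprM.
      have -> : 2^-1 ^+ 2 = 4^-1 :> R by lra.
      by ring.
    have q0 : 0 <= 2 * Num.sqrt (fine (g x)) * 2^-1 ^+ k.
      by rewrite -mulrA mulr_ge0.
    have sqn_le (a : R) : `|a| <= 2 * Num.sqrt (fine (g x)) * 2^-1 ^+ k ->
        a ^+ 2 <= 4 * 4^-1 ^+ k * fine (g x).
      by move=> ha; rewrite -E -real_normK ?num_real// ler_pXn2r ?nnegrE.
    have := sqn_le _ hr; have := sqn_le _ hi.
    move: (fun_of (v k) x) => [a b] /=; move: (4^-1 ^+ k) (fine _) => p q; lra.
rewrite ge0_integralZl_EFin ?mulr_ge0 ?exprn_ge0//.
apply: (@le_trans _ _ ((8 * 4^-1 ^+ k)%:E * 2%:E)%E).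
  by apply: lee_wpmul2l => //; rewrite lee_fin mulr_ge0 ?exprn_ge0.
by rewrite -EFinM lee_fin; move: (4^-1 ^+ k) => p; lra.
Qed.

Lemma L2_complete (u : nat -> L0) : (forall n, L2 (u n)) ->
  (forall e : R, 0 < e -> exists N, forall m n, (N <= m <= n)%N ->
     (sqint (u n - u m)%R < e%:E)%E) ->
  exists2 F, L2 F & forall e : R, 0 < e -> exists N, forall n, (N <= n)%N ->
     (sqint (u n - F)%R < e%:E)%E.
Proof.
move=> u2 uc.
have [N hN] := choice (fun k => uc (16^-1 ^+ k) ltac:(by rewrite exprn_gt0)).
(* Summing the thresholds makes the indices nondecreasing while each stays above its own
   threshold. *)
pose n k := (\sum_(j < k.+1) N j)%N.
have nS k : (n k <= n k.+1)%N by rewrite /n [leqRHS]big_ord_recr /= leq_addr.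
have Nn k : (N k <= n k)%N by rewrite /n big_ord_recr /= leq_addl.
have [F hF] : exists F, forall k, (sqint (u (n k) - F)%R <= (16 * 4^-1 ^+ k)%:E)%E.
  by apply: (@fast_cauchy_cvg (fun k => u (n k))) => k; apply: ltW; apply: hN; rewrite Nn nS.
exists F.
  rewrite (_ : F = u (n 0%N) - (u (n 0%N) - F)); last by rewrite opprB addrC subrK.
  apply: L2B => //; apply/L2E; exact: le_lt_trans (hF _) (ltry _).
move=> e e0.
(* The bound below is [2 * 16^-k + 32 * 4^-k], at most [34 * 4^-k]; 40 leaves a margin. *)
have [k hk] : exists k, 40 * 4^-1 ^+ k < e.
  have : (fun k => 40 * 4^-1 ^+ k) @ \oo --> (40 * 0 : R).
    by apply: cvgMr; apply: cvg_expr; rewrite ger0_norm ?invr_ge0//; lra.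
  rewrite mulr0 => /cvgrPdist_lt /(_ _ e0) [k _ hk]; exists k.
  by have := hk k (leqnn k); rewrite /= sub0r normrN; apply: le_lt_trans; exact: ler_norm.
exists (n k) => m nm.
rewrite (_ : u m - F = (u m - u (n k)) + (u (n k) - F)); last by rewrite addrA subrK.
apply: (le_lt_trans (sqintD_le _ _)).
apply: (@le_lt_trans _ _ (2%:E * (16^-1 ^+ k)%:E + 2%:E * (16 * 4^-1 ^+ k)%:E)%E).
  apply: leeD; apply: lee_wpmul2l => //.
  by apply: ltW; apply: hN; rewrite Nn nm.
rewrite -!EFinM -EFinD lte_fin.
have : 16^-1 ^+ k <= 4^-1 ^+ k :> R by apply: lerXn2r; rewrite ?nnegrE; lra.
lra.
Qed.

End L2Completeness.

(** * Operators on L_2 *)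

(* [H] is L_2 with its scalars restricted to the reals: the operator theory above is
   real, and complex linearity becomes commutation with multiplication by [i]. *)
Record is_L2_model d (T : measurableType d) (R : realType) (mu : {measure set T -> \bar R})
    (H : hilbertSpace R) (val : H -> L0 mu) : Prop := IsL2Model {
  model_L2 : forall x, L2 (val x);
  model_surj : forall f, L2 f -> exists x, val x = f;
  model_D : forall x y, val (x + y) = val x + val y;
  model_Z : forall (a : R) x, val (a *: x) = a%:C%C *: val x;
  model_dot : forall x y, dot x y = rdot (val x) (val y) }.

Section Operators.
Context d (T : measurableType d) (R : realType) (mu : {measure set T -> \bar R}).
Local Notation L0 := (L0 mu).
Context (H : hilbertSpace R) (val : H -> L0).
Hypothesis hval : is_L2_model val.
Implicit Types (f g h : L0) (x y z : H) (K : L0 -> L0) (A B P : H -> H).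

Let val_L2 := model_L2 hval.
Let val_surj := model_surj hval.
Let valD := model_D hval.
Let valZ := model_Z hval.
Let dot_val := model_dot hval.

Lemma model_inj x y : val x = val y -> x = y.
Proof. by move=> xy; apply: dot_eq => z; rewrite !dot_val xy. Qed.

Lemma valN x : val (- x) = - val x.
Proof. by rewrite -scaleN1r valZ rmorphN rmorph1 scaleN1r. Qed.

Lemma valB x y : val (x - y) = val x - val y. Proof. by rewrite valD valN. Qed.

Lemma val0 : val 0 = 0. Proof. by rewrite -(subrr 0) valB subrr. Qed.

Definition unval f : H := xget 0 [set x | val x = f].

Lemma unvalK f : L2 f -> val (unval f) = f.
Proof. by move=> /val_surj[x xf]; rewrite /unval; case: xgetP => [_ -> //|/(_ x)]. Qed.

Lemma unval_val x : unval (val x) = x.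
Proof. exact/model_inj/unvalK/val_L2. Qed.

Definition imul x : H := unval ('i%C *: val x).

Lemma imulE x : val (imul x) = 'i%C *: val x.
Proof. by rewrite unvalK//; apply/L2Z/val_L2. Qed.

Lemma imul_adj : adjp imul (fun x => - imul x).
Proof.
move=> x y; rewrite dotNr !dot_val !imulE rdot_iZ//.
exact/L2Z/val_L2.
Qed.

Lemma imul_imul x : imul (imul x) = - x.
Proof. by apply: model_inj; rewrite !imulE valN scalerA -expr2 sqr_i scaleN1r. Qed.

Lemma sqn_imul x : sqn (imul x) = sqn x.
Proof. by rewrite /sqn imul_adj imul_imul opprK. Qed.

Lemma imul_bdd : bdd imul.
Proof. by apply: contr_bdd => x; rewrite sqn_imul. Qed.

Lemma dot_imul_self x : dot x (imul x) = 0.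
Proof. by have := imul_adj x x; rewrite dotNr dotC; lra. Qed.

Definition cscale (a : R[i]) x : H := complex.Re a *: x + complex.Im a *: imul x.

Lemma val_cscale a x : val (cscale a x) = a *: val x.
Proof.
rewrite valD !valZ imulE scalerA -scalerDl; congr (_ *: _).
by rewrite [RHS]complexE mulrC.
Qed.

Lemma inner_val x y : inner (val x) (val y) = (dot x y +i* dot x (imul y))%C.
Proof. by rewrite innerE !dot_val imulE. Qed.

Lemma inner_eq0 x y : inner (val x) (val y) = 0 <-> dot x y = 0 /\ dot x (imul y) = 0.
Proof. by rewrite inner_val; split=> [[-> ->]|[-> ->]]. Qed.

Lemma norm2_val x : norm2 (val x) = nrm x.
Proof. by rewrite norm2E /nrm /sqn dot_val. Qed.

Lemma L2_ind (Q : L0 -> Prop) : (forall x, Q (val x)) -> forall f, L2 f -> Q f.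
Proof. by move=> hQ f /val_surj[x <-]. Qed.

Definition represents K A := forall x, K (val x) = val (A x).

Definition complex_linear A := forall x, A (imul x) = imul (A x).

Lemma adjp_cscale A B a x : adjp A B -> complex_linear A -> A (cscale a x) = cscale a (A x).
Proof. by move=> AB AI; rewrite /cscale (adjpD AB) !(adjpZ AB) AI. Qed.

Lemma bdd_nrm A : bdd A -> exists M : R, forall x, nrm (A x) <= M * nrm x.
Proof.
move=> [M M0 h]; exists (Num.sqrt M) => x.
by rewrite /nrm -sqrtrM ?(ltW M0)// ler_sqrt// mulr_ge0 ?sqn_ge0// ltW.
Qed.

Lemma nrm_bdd A (M : R) : (forall x, nrm (A x) <= M * nrm x) -> bdd A.
Proof.
move=> h; exists (M ^+ 2 + 1); first by rewrite ltr_wpDl ?sqr_ge0.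
move=> x; apply: (@le_trans _ _ (M ^+ 2 * sqn x)).
  rewrite -[sqn (A x)]nrm_sqr -[sqn x]nrm_sqr -exprMn.
  rewrite lerXn2r ?nnegrE ?nrm_ge0//.
  exact: le_trans (nrm_ge0 _) (h x).
by rewrite ler_wpM2r ?sqn_ge0// lerDl.
Qed.

Lemma bounded_op_of K A B : represents K A -> adjp A B -> bdd A -> complex_linear A ->
  bounded_op K.
Proof.
move=> KA AB bA AI; split.
- by apply: L2_ind => x; rewrite KA.
- move=> a f g f2 g2; rewrite -(unvalK f2) -(unvalK g2) -val_cscale -valD !KA.
  by rewrite (adjpD AB) (adjp_cscale _ _ AB AI) valD val_cscale.
- have [M hM] := bdd_nrm bA; exists M; apply: L2_ind => x.
  by rewrite KA !norm2_val.
Qed.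

Lemma bounded_op_repr K : bounded_op K -> exists A,
  [/\ represents K A, (forall (a : R) x y, A (a *: x + y) = a *: A x + A y), bdd A &
    complex_linear A].
Proof.
move=> [K2 Klin [M KM]]; exists (fun x => unval (K (val x))).
have KA : represents K (fun x => unval (K (val x))).
  by move=> x; rewrite unvalK//; exact/K2.
split=> //.
- by move=> a x y; apply: model_inj; rewrite -KA !valD !valZ -!KA Klin.
- by apply: (@nrm_bdd _ M) => x; rewrite -!norm2_val -KA; exact: KM.
- move=> x; apply: model_inj; rewrite -KA !imulE -KA.
  have K0 : K 0 = 0.
    by have := Klin (-1) 0 0 (L2_0 mu) (L2_0 mu); rewrite scaleN1r addNr scaleN1r addNr.
  have := Klin 'i%C (val x) 0 (val_L2 x) (L2_0 mu).
  by rewrite K0 !addr0.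
Qed.

Lemma inner_repr_adj K A Ks B : represents K A -> represents Ks B ->
  complex_linear B ->
  (forall f g, L2 f -> L2 g -> inner (K f) g = inner f (Ks g)) <-> adjp A B.
Proof.
move=> KA KB BI; split=> [h x y|AB].
  by have := h _ _ (val_L2 x) (val_L2 y); rewrite KA KB !inner_val => -[].
move=> f g f2 g2; rewrite -(unvalK f2) -(unvalK g2).
by rewrite KA KB !inner_val !AB BI.
Qed.

Lemma positive_op_of K A : represents K A -> positive A -> complex_linear A ->
  positive_op K.
Proof.
move=> KA [aA bA A0] AI; split; first exact: bounded_op_of KA aA bA AI.
apply: L2_ind => x; rewrite KA inner_val.
have -> : dot (A x) (imul x) = 0.
  have e1 : dot (A x) (imul x) = dot x (imul (A x)) by rewrite aA AI.
  by have := imul_adj x (A x); rewrite dotNr dotC; lra.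
by rewrite lecE /= eqxx A0.
Qed.

(** A nonnegative real form need not be symmetric. Here [<A x, x>] also has zero imaginary part;
    polarizing this and replacing [y] by [i y] yields self-adjointness. *)
Lemma positive_op_repr K : positive_op K -> exists A,
  [/\ represents K A, positive A & complex_linear A].
Proof.
move=> [bK K0]; have [A [KA Alin bA AI]] := bounded_op_repr bK.
have h x : 0 <= dot (A x) x /\ dot (A x) (imul x) = 0.
  have := K0 _ (val_L2 x); rewrite KA inner_val lecE /= => /andP[/eqP h0 h1].
  by split.
exists A; split=> //; split=> //; last by move=> x; exact: (h x).1.
have AD x y : A (x + y) = A x + A y by rewrite -{1}(scale1r x) Alin scale1r.
have ID x y : imul (x + y) = imul x + imul y := adjpD imul_adj x y.
have skew x y : dot (A x) (imul y) = - dot (A y) (imul x).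
  have := (h (x + y)).2; rewrite AD ID !dotE (h x).2 (h y).2; lra.
move=> x y; have := skew x (imul y).
rewrite imul_imul dotNr AI imul_adj dotNr imul_imul dotNr.
by rewrite (dotC x) => /oppr_inj; rewrite !opprK dotC => ->.
Qed.


(** [absolute_value] is a choice, so a candidate is exhibited first; afterwards only positivity and
    the equation for the square of the chosen operator are used. *)
Lemma absolute_value_repr K A : represents K A -> selfadj A -> bdd A -> complex_linear A ->
  exists P, [/\ represents (absolute_value K) P, positive P &
    forall x, P (P x) = A (A x)].
Proof.
move=> KA aA bA AI; have bK := bounded_op_of KA aA bA AI.
have imul_lin : forall (a : R) x y, imul (a *: x + y) = a *: imul x + imul y.
  exact: adjp_linear imul_adj.
have [P0 [pP0 P0A P0C]] := sqrt_exists aA bA.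
have P0I : complex_linear P0.
  by move=> x; symmetry; apply: P0C => //; [exact: imul_bdd | move=> y; rewrite !AI].
have abs_ex : exists K0 : L0 -> L0, is_absolute_value K K0.
  pose K' f := val (P0 (unval f)).
  have KP0 : represents K' P0 by move=> x; rewrite /K' unval_val.
  exists K'; split; first exact: positive_op_of KP0 pP0 P0I.
  exists K.
    by split=> //; apply/(inner_repr_adj KA KA AI).
  by apply: L2_ind => x; rewrite !KP0 !KA P0A.
have : is_absolute_value K (absolute_value K) := xgetPex (idfun : L0 -> L0) abs_ex.
move=> [pos [Ks [bKs adjKs] PK]]; have [P [KP pP PI]] := positive_op_repr pos.
have [B [KB _ _ BI]] := bounded_op_repr bKs.
have AB : adjp A B by apply/(inner_repr_adj KA KB BI).
exists P; split=> // x; apply: model_inj.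
rewrite -!KP PK ?KA ?KB; last exact: val_L2.
congr val; apply: dot_eq => y; rewrite dotC -AB aA dotC //.
Qed.

Lemma orthonormal_basis_ex : exists e : set L0, orthonormal_basis e.
Proof.
pose on (e : set L0) := e `<=` @L2 _ _ _ mu /\
  forall f g, e f -> e g -> inner f g = (f == g)%:R.
have [|e [[e2 eon] emax]] := @Zorn_bigcup _ on.
  move=> F Fon Ftot; split; first by move=> f [X /Fon[X2 _] /X2].
  move=> f g [X FX Xf] [Y FY Yg].
  have [XY|YX] := Ftot _ _ FX FY.
    by apply: (Fon _ FY).2 => //; exact: XY.
  by apply: (Fon _ FX).2 => //; exact: YX.
exists e; split=> //.
apply: L2_ind => x xe; rewrite -val0; congr val; apply: contrapT => x0.
have sx : 0 < sqn x.
  by rewrite lt_def sqn_ge0 andbT; apply/eqP => /sqn_eq0.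
pose u := (nrm x)^-1 *: x.
have su : sqn u = 1.
  by rewrite sqnZ exprVn nrm_sqr mulVf// gt_eqF.
have ue g : e g -> inner (val u) g = 0 /\ inner g (val u) = 0.
  move=> eg; have /val_surj[y yg] := e2 _ eg.
  have := xe _ eg; rewrite -yg => /inner_eq0[xy xIy].
  have uy : dot u y = 0 by rewrite dotZl xy mulr0.
  have uIy : dot u (imul y) = 0 by rewrite dotZl xIy mulr0.
  split; apply/inner_eq0; split=> //; first by rewrite dotC.
  by have := imul_adj y u; rewrite dotNr dotC uIy; lra.
have euu : inner (val u) (val u) = 1.
  by rewrite inner_val -/(sqn u) su dot_imul_self.
apply: (emax (e `|` [set val u])).
  split; first by move=> f ef; left.
  move=> /(_ (val u) (or_intror erefl)) eu; have := (ue _ eu).1.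
  by rewrite euu => /eqP; rewrite oner_eq0.
have une g : e g -> val u != g.
  move=> eg; apply/eqP => ug; have := (ue _ eg).1.
  by rewrite -ug euu => /eqP; rewrite oner_eq0.
split; first by move=> f [/e2//|->]; exact: val_L2.
move=> f g [ef|->] [eg|->].
- exact: eon.
- by rewrite (ue _ ef).2 eq_sym (negPf (une _ ef)).
- by rewrite (ue _ eg).1 (negPf (une _ eg)).
- by rewrite euu eqxx.
Qed.

Let e : set L0 := xget set0 (@orthonormal_basis _ _ _ mu).

Let e_onb : orthonormal_basis e.
Proof. exact: xgetPex orthonormal_basis_ex. Qed.

(* For a complex-linear operator, sums over this real basis are twice those over [e]. *)
Definition real_basis (t : L0 * bool) : H :=
  if t.2 then imul (unval t.1) else unval t.1.

Definition real_basis_index : set (L0 * bool) := e `*` setT.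

Local Notation I := real_basis_index.
Local Notation b := real_basis.

Lemma real_basis_parseval x : (\esum_(t in I) (dot x (b t) ^+ 2)%:E = (sqn x)%:E)%E.
Proof.
have [e2 eon etot] := e_onb.
have dot0 f g : e f -> e g -> dot (unval f) (unval g) = (f == g)%:R /\
    dot (unval f) (imul (unval g)) = 0.
  move=> ef eg; have := eon _ _ ef eg.
  rewrite -{1}(unvalK (e2 _ ef)) -{1}(unvalK (e2 _ eg)) inner_val.
  by case: (f == g) => -[].
apply: parseval_orthonormal.
- move=> [f s] [g s'] [/= ef _] [/= eg _]; have [h1 h2] := dot0 _ _ ef eg.
  rewrite /b /=; case: s; case: s'; rewrite xpair_eqE ?andbT ?andbF.
  + by rewrite imul_adj imul_imul opprK.
  + by rewrite imul_adj dotNr h2 oppr0.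
  + by rewrite h2.
  + by rewrite h1.
- move=> y yb; apply: model_inj; rewrite val0; apply: etot => // g eg.
  rewrite -(unvalK (e2 _ eg)); apply/inner_eq0; split.
    exact: (yb (g, false)).
  exact: (yb (g, true)).
Qed.

Lemma esum_real_basis (a : L0 * bool -> \bar R) : (forall t, (0 <= a t)%E) ->
  (\esum_(t in I) a t = \esum_(f in e) (a (f, false) + a (f, true)))%E.
Proof.
move=> a0; transitivity (\esum_(k in e `*`` (fun=> setT)) a (k.1, k.2))%E.
  by apply: eq_esum => -[].
rewrite -(@esum_esum _ _ _ e (fun=> setT) (fun f s => a (f, s))).
  apply: eq_esum => f _.
  rewrite (esumID [set false]) ?setTI//.
  rewrite (_ : ~` [set false] = [set true]); last first.
    by apply/seteqP; split=> [[//|/(_ erefl)//]|_ ->] /=.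
  by rewrite !esum_set1.
by move=> *; exact: a0.
Qed.

Lemma sum_esum_e (a : L0 * bool -> R) M : (forall t, 0 <= a t) -> sum_le I a M ->
  (\esum_(f in e) (a (f, false))%:E <= M%:E)%E.
Proof.
move=> a0; apply: le_trans; rewrite (@esum_real_basis (fun t => (a t)%:E)).
  by apply: le_esum => f _; rewrite leeDl// lee_fin.
by move=> t; rewrite lee_fin.
Qed.

Lemma op_traceE K A : represents K A ->
  op_trace K = (\esum_(f in e) (dot (A (b (f, false))) (b (f, false)))%:E)%E.
Proof.
move=> KA; apply: eq_esum => f ef.
have f2 : L2 f by have [e2 _ _] := e_onb; exact: e2.
by rewrite -{1 2}(unvalK f2) KA inner_val.
Qed.

(** Half of the real basis gives a smaller sum of nonnegative terms. The bound is asked of every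
    positive root because the chosen absolute value is known only through these properties. *)
Lemma trace_norm_le K A M : represents K A -> selfadj A -> bdd A -> complex_linear A ->
  (forall P, positive P -> (forall x, P (P x) = A (A x)) ->
     sum_le I (fun t => dot (P (b t)) (b t)) M) ->
  (0 <= trace_norm K <= M%:E)%E.
Proof.
move=> KA aA bA AI hM.
have [P [KP pP PA]] := absolute_value_repr KA aA bA AI; have [_ _ P0] := pP.
rewrite /trace_norm (op_traceE KP); apply/andP; split.
  by apply: esum_ge0 => f _; rewrite lee_fin.
by apply: (sum_esum_e (a := fun t => dot (P (b t)) (b t))); [move=> t; exact: P0|exact: hM].
Qed.

(** A positive operator is its own absolute value by uniqueness of the root, and the terms at [g]
    and [i g] agree. *)
Lemma trace_class_sum K A : trace_class K -> represents K A -> positive A ->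
  complex_linear A -> exists M : R, sum_le I (fun t => dot (A (b t)) (b t)) M.
Proof.
move=> [_ trK] KA pA AI; have [aA bA A0] := pA.
have [P [KP pP PA]] := absolute_value_repr KA aA bA AI.
have PE := positive_sqrt_id pA pP PA; rewrite PE in KP.
move: trK; rewrite /trace_norm (op_traceE KP); set tr := esum _ _ => tr_fin.
have tr0 : (0 <= tr)%E by apply: esum_ge0 => f _; rewrite lee_fin.
exists (fine (tr + tr)); rewrite /sum_le fineK; last first.
  by rewrite fin_numD !ge0_fin_numE// tr_fin.
rewrite (@esum_real_basis (fun t => (dot (A (b t)) (b t))%:E)); last first.
  by move=> t; rewrite lee_fin.
rewrite esumD; try by move=> f _; rewrite lee_fin.
rewrite leeD2l//; apply: le_esum => f _; rewrite lee_fin /b /=.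
by rewrite AI imul_adj imul_imul opprK.
Qed.

(** * Projections and indicators in the real model *)

Definition pre (M : set L0) : set H := [set x | M (val x)].

Lemma pre_subspace M : linear_subspace M -> subspace (pre M).
Proof.
move=> [M0 Mlin]; split; first by rewrite /pre /= val0.
by move=> a x y Mx My; rewrite /pre /= valD valZ; exact: Mlin.
Qed.

Lemma pre_imul M x : linear_subspace M -> pre M x -> pre M (imul x).
Proof.
move=> [M0 Mlin] Mx; rewrite /pre /= imulE -[_ *: _]addr0; exact: Mlin.
Qed.

(** Stability of [M] under multiplication by i makes real and complex orthogonality to [M] coincide,
    so the real projection represents the complex one. *)
Lemma oproj_repr M : linear_subspace M -> M `<=` @L2 _ _ _ mu -> complemented (pre M) ->
  exists p, [/\ represents (oproj M) p, forall x, is_proj (pre M) x (p x),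
    selfadj p /\ contr p, forall x, p (p x) = p x & complex_linear p].
Proof.
move=> lM M2 cM; have sM := pre_subspace lM.
have [p [pM ap cp pp pid]] := proj_op sM cM.
exists p; split=> //.
- move=> x; rewrite /oproj.
  have hp : M (val (p x)) /\ forall h, M h -> inner (val x - val (p x)) h = 0.
    split; first exact: (pM x).1.
    move=> h Mh; have [y yh] := val_surj (M2 _ Mh); rewrite -yh -valB.
    have My : pre M y by rewrite /pre /= yh.
    apply/inner_eq0; split; apply: (pM x).2 => //.
    exact: pre_imul.
  case: xgetP => [g -> [Mg hg]|/(_ _ hp)//].
  have [y yg] := val_surj (M2 _ Mg); rewrite -yg; congr val.
  apply: is_proj_uniq sM _ (pM x); split; first by rewrite /pre /= yg.
  move=> m Mm; have := hg _ Mm; rewrite -yg -valB.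
  by move=> /inner_eq0[].
- move=> x; apply: is_proj_uniq sM (pM _) _.
  split; first by apply: pre_imul => //; exact: (pM x).1.
  move=> m Mm; rewrite -(adjpBE imul_adj) imul_adj dotNr.
  by rewrite (pM x).2 ?oppr0//; exact: pre_imul.
Qed.

Definition chiH (D : set T) x : H := unval (chi D (val x)).

Lemma chiHE D x : measurable D -> val (chiH D x) = chi D (val x).
Proof. by move=> mD; rewrite unvalK//; exact: chi_L2. Qed.

Lemma chiH_adj D : measurable D -> selfadj (chiH D).
Proof. by move=> mD x y; rewrite !dot_val !chiHE// rdot_chi. Qed.

Lemma chiH_comp D D' x : measurable D -> measurable D' ->
  chiH D (chiH D' x) = chiH (D `&` D') x.
Proof.
move=> mD mD'; apply: model_inj; rewrite !chiHE//; last exact: measurableI.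
exact: chi_chi.
Qed.

Lemma selfadj_idem_contr A : selfadj A -> (forall x, A (A x) = A x) -> contr A.
Proof.
move=> aA AA x; have := sqn_ge0 (x - A x).
have e1 : dot x (A x) = sqn (A x) by rewrite /sqn aA AA.
by rewrite sqnB e1; lra.
Qed.

Lemma chiH_contr D : measurable D -> contr (chiH D).
Proof.
move=> mD; apply: selfadj_idem_contr; first exact: chiH_adj.
by move=> x; rewrite chiH_comp// setIid.
Qed.

Lemma chiH_complex D : measurable D -> complex_linear (chiH D).
Proof.
by move=> mD x; apply: model_inj; rewrite imulE !chiHE// imulE chiZ.
Qed.

Lemma sub_chiH D x : measurable D -> x - chiH D x = chiH (~` D) x.
Proof.
move=> mD; apply: model_inj; rewrite valB !chiHE//; last exact: measurableC.
by rewrite -opprB chi_sub// scaleN1r opprK.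
Qed.

Lemma sqn_sqint x : (sqn x)%:E = sqint (val x).
Proof. by rewrite /sqn dot_val rdot_sqint fineK// sqint_fin. Qed.

Lemma cutoff_repr D K A : measurable D -> represents K A ->
  represents (cutoff D K) (fun x => chiH D (A (chiH D x))).
Proof. by move=> mD KA x; rewrite /cutoff -chiHE// KA chiHE. Qed.

(** The real inequality is applied to [x] and to [y] multiplied by the complex number [u + i v],
    which aligns the phases. *)
Lemma inner_cabs_le x y : cabs (inner (val x) (val y)) <= nrm x * nrm y.
Proof.
rewrite inner_val /= -(ler_pXn2r (n := 2)) ?nnegrE ?sqrtr_ge0 ?mulr_ge0 ?nrm_ge0//.
rewrite sqr_sqrtr ?addr_ge0 ?sqr_ge0// exprMn !nrm_sqr.
set u := dot x y; set v := dot x (imul y); set s := u ^+ 2 + v ^+ 2.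
have s0 : 0 <= s by rewrite addr_ge0 ?sqr_ge0.
have [->|sn0] := eqVneq s 0; first by rewrite mulr_ge0 ?sqn_ge0.
have sp : 0 < s by rewrite lt_def sn0.
have := CauchySchwarz x (u *: y + v *: imul y).
rewrite sqnD !sqnZ sqn_imul !dotE dot_imul_self -/u -/v !mulr0 addr0.
rewrite -[u * u]expr2 -[v * v]expr2 -/s -mulrDl -/s mulrCA expr2 => h.
by rewrite -(ler_pM2l sp).
Qed.

End Operators.

(** * Construction of the real Hilbert space *)

Section L2Hilbert.
Context d (T : measurableType d) (R : realType) (mu : {measure set T -> \bar R}).
Local Notation L0 := (L0 mu).

Definition L2pred : {pred L0} := mem [set f : L0 | L2 f].

Lemma L2pred_zmod : zmod_closed L2pred.
Proof.
split; first by rewrite inE; exact: L2_0.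
by move=> f g; rewrite !inE; exact: L2B.
Qed.

HB.instance Definition _ := GRing.isZmodClosed.Build _ L2pred L2pred_zmod.

Record L2elt := L2Elt { L2val : L0; _ : L2val \in L2pred }.
HB.instance Definition _ := [isSub for L2val].
HB.instance Definition _ := [Choice of L2elt by <:].
HB.instance Definition _ := [SubChoice_isSubZmodule of L2elt by <:].

Lemma L2valP (f : L2elt) : L2 (L2val f).
Proof. by case: f => f /= fL; have := fL; rewrite inE. Qed.

Definition toL2 (f : L0) : L2elt := insubd 0 f.

Lemma toL2K f : L2 f -> L2val (toL2 f) = f.
Proof. by move=> f2; rewrite /toL2 insubdK// inE. Qed.

Lemma L2val_inj : injective L2val. Proof. exact: val_inj. Qed.

Lemma L2valD f g : L2val (f + g) = L2val f + L2val g. Proof. by []. Qed.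
Lemma L2valB f g : L2val (f - g) = L2val f - L2val g. Proof. by []. Qed.

Definition L2scale (a : R) (f : L2elt) : L2elt := toL2 (a%:C%C *: L2val f).

Lemma L2scaleE a f : L2val (L2scale a f) = a%:C%C *: L2val f.
Proof. by rewrite toL2K//; apply/L2Z/L2valP. Qed.

Lemma L2scaleA a b f : L2scale a (L2scale b f) = L2scale (a * b) f.
Proof. by apply: L2val_inj; rewrite !L2scaleE scalerA -rmorphM. Qed.

Lemma L2scale1 : left_id 1 L2scale.
Proof. by move=> f; apply: L2val_inj; rewrite L2scaleE rmorph1 scale1r. Qed.

Lemma L2scaleDr : right_distributive L2scale +%R.
Proof. by move=> a f g; apply: L2val_inj; rewrite L2valD !L2scaleE L2valD scalerDr. Qed.

Lemma L2scaleDl f : {morph L2scale^~ f : a b / a + b}.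
Proof. by move=> a b; apply: L2val_inj; rewrite L2valD !L2scaleE rmorphD scalerDl. Qed.

HB.instance Definition _ := GRing.Zmodule_isLmodule.Build R L2elt
  L2scaleA L2scale1 L2scaleDr L2scaleDl.

Lemma L2valZ (a : R) (f : L2elt) : L2val (a *: f) = a%:C%C *: L2val f.
Proof. exact: L2scaleE. Qed.

Definition L2dot (f g : L2elt) : R := rdot (L2val f) (L2val g).

Lemma L2dotE_sqint f : (L2dot f f)%:E = sqint (L2val f).
Proof. by rewrite /L2dot rdot_sqint fineK// sqint_fin//; exact: L2valP. Qed.

Lemma L2dot_eq0 f : L2dot f f = 0 -> f = 0.
Proof.
move=> f0; apply: L2val_inj; apply: sqint_eq0.
by rewrite -L2dotE_sqint f0.
Qed.

Lemma L2dot_ge0 f : 0 <= L2dot f f.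
Proof. by rewrite -lee_fin L2dotE_sqint sqint_ge0. Qed.

Lemma L2dot_complete (u : nat -> L2elt) :
  (forall e : R, 0 < e -> exists N, forall m n, (N <= m <= n)%N ->
     L2dot (u n - u m) (u n - u m) < e) ->
  exists x, forall e : R, 0 < e -> exists N, forall n, (N <= n)%N ->
    L2dot (u n - x) (u n - x) < e.
Proof.
move=> uc; have [|e e0|F F2 hF] := @L2_complete _ _ _ mu (L2val \o u).
- by move=> n; exact: L2valP.
- have [N hN] := uc _ e0; exists N => m n mn /=.
  by rewrite -L2valB -L2dotE_sqint lte_fin; exact: hN.
exists (toL2 F) => e /hF[N hN]; exists N => n /hN /=.
by rewrite -lte_fin L2dotE_sqint L2valB toL2K.
Qed.

Definition L2hilbert : hilbertSpace R := @HilbertSpace R L2elt L2dot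
  (fun f g => rdotC _ _)
  (fun f g h => rdotDl (L2valP f) (L2valP g) (L2valP h))
  (fun a f g => ltac:(rewrite /L2dot L2valZ; exact: rdotZl (L2valP f) (L2valP g)))
  L2dot_ge0 L2dot_eq0 L2dot_complete.

End L2Hilbert.

Lemma L2_hilbert_model d (T : measurableType d) (R : realType)
    (mu : {measure set T -> \bar R}) :
  exists (H : hilbertSpace R) (val : H -> L0 mu), is_L2_model val.
Proof.
exists (L2hilbert mu), (@L2val _ _ _ mu); split.
- exact: L2valP.
- by move=> f f2; exists (toL2 f); exact: toL2K.
- exact: L2valD.
- exact: L2valZ.
- by [].
Qed.

(** The spanning vectors may lie outside [V]. The induction passes to the part of [V] spanned
    without the first one; an element of [V] outside that part, if any, is the remaining basis
    vector. *)
Lemma finite_dim_basis (F : fieldType) (W : lmodType F) n (v : 'I_n -> W) (V : set W) :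
  V 0 -> (forall a f g, V f -> V g -> V (a *: f + g)) ->
  V `<=` [set \sum_i c i *: v i | c in [set: 'I_n -> F]] ->
  exists m (w : 'I_m -> W), [/\ forall i, V (w i),
    forall f, V f -> exists c : 'I_m -> F, f = \sum_i c i *: w i &
    forall c : 'I_m -> F, \sum_i c i *: w i = 0 -> forall i, c i = 0].
Proof.
elim: n v V => [|n IH] v V V0 Vlin Vv.
  exists 0%N, (fun=> 0); split=> [[]//|f /Vv[c _ <-]|c _ []//].
  by exists (fun=> 0); rewrite !big_ord0.
pose V' := [set f | V f /\ exists c : 'I_n -> F, f = \sum_i c i *: v (lift ord0 i)].
have VZ a f : V f -> V (a *: f) by move=> Vf; rewrite -[a *: f]addr0; exact: Vlin.
have VB f g : V f -> V g -> V (f - g).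
  by move=> Vf Vg; rewrite addrC -scaleN1r; exact: Vlin.
have [|a f g [Vf [c fE]] [Vg [c' gE]]|f [_ [c ->]]|m [w [wV' wspan windep]]] :=
    IH (fun i => v (lift ord0 i)) V'.
- by split=> //; exists (fun=> 0); rewrite big1// => i _; rewrite scale0r.
- split; first exact: Vlin.
  exists (fun i => a * c i + c' i); rewrite fE gE scaler_sumr -big_split /=.
  by apply: eq_bigr => i _; rewrite scalerA scalerDl.
- by exists c.
have [VV'|/existsNP[u /not_implyP[Vu nV'u]]] := pselect (V `<=` V').
  by exists m, w; split=> // [i|f /VV'/wspan//]; exact: (wV' i).1.
have [cu _ uE] := Vv _ Vu; rewrite big_ord_recl in uE.
have cu0 : cu ord0 != 0.
  apply/eqP => c0; apply: nV'u; split=> //.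
  by exists (fun i => cu (lift ord0 i)); rewrite -uE c0 scale0r add0r.
pose w1 i := oapp w u (unlift (@ord0 m) i).
have w1E (c : 'I_m.+1 -> F) : \sum_i c i *: w1 i =
    c ord0 *: u + \sum_i c (lift ord0 i) *: w i.
  rewrite big_ord_recl {1}/w1 unlift_none /=; congr (_ + _).
  by apply: eq_bigr => i _; rewrite /w1 liftK.
exists m.+1, w1; split.
- by move=> i; rewrite /w1; case: unlift => [j|//] /=; exact: (wV' j).1.
- move=> f Vf; have [cf _ fE] := Vv _ Vf; rewrite big_ord_recl in fE.
  pose a := cf ord0 / cu ord0.
  have [c fu] : exists c : 'I_m -> F, f - a *: u = \sum_i c i *: w i.
    apply: wspan; split; first exact/VB/VZ.
    exists (fun i => cf (lift ord0 i) - a * cu (lift ord0 i)).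
    under [RHS]eq_bigr do rewrite scalerBl -scalerA.
    rewrite sumrB -scaler_sumr -fE -uE scalerDr scalerA divfK//.
    by rewrite opprD addrACA subrr add0r.
  exists (fun i => oapp c a (unlift ord0 i)); rewrite w1E unlift_none /=.
  under eq_bigr do rewrite liftK /=.
  by rewrite -fu addrC subrK.
- move=> c; rewrite w1E => c0.
  have cz : c ord0 = 0.
    apply/eqP/negPn/negP => cn0; apply: nV'u.
    have uw : u = \sum_i (- (c ord0)^-1 * c (lift ord0 i)) *: w i.
      under eq_bigr do rewrite -scalerA.
      rewrite -scaler_sumr (_ : \sum_i _ = - (c ord0 *: u)).
        by rewrite scalerN scaleNr opprK scalerA mulVf// scale1r.
      by apply/eqP; rewrite -addr_eq0 addrC c0.
    rewrite uw; elim/big_ind : _ => [|f g [Vf [k fE]] [Vg [k' gE]]|i _].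
    + by split=> //; exists (fun=> 0); rewrite big1// => i _; rewrite scale0r.
    + split; first by rewrite -[f]scale1r; exact: Vlin.
      exists (fun i => k i + k' i); rewrite fE gE -big_split /=.
      by apply: eq_bigr => i _; rewrite scalerDl.
    + have [Vw [k wE]] := wV' i; split; first exact: VZ.
      exists (fun j => - (c ord0)^-1 * c (lift ord0 i) * k j).
      by rewrite {1}wE scaler_sumr; apply: eq_bigr => j _; rewrite scalerA.
  move: c0; rewrite cz scale0r add0r => /windep h i.
  by case: (unliftP ord0 i) => [j ->|->].
Qed.

Lemma ereal_cvg0 (R : realType) (u : nat -> \bar R) : (forall n, 0 <= u n)%E ->
  (forall e : R, 0 < e -> exists N, forall n, (N <= n)%N -> (u n <= e%:E)%E) ->
  u @ \oo --> 0%E.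
Proof.
move=> u0 ue; apply/fine_cvgP; split.
  have [N hN] := ue 1 ltr01; exists N => // n /hN h.
  by rewrite ge0_fin_numE//; exact: le_lt_trans h (ltry _).
apply/cvgrPdist_le => e e0; have [N hN] := ue e e0; exists N => // n /hN h /=.
rewrite sub0r normrN ger0_norm ?fine_ge0// -lee_fin fineK//.
by rewrite ge0_fin_numE//; exact: le_lt_trans h (ltry _).
Qed.

(** * Angles and trace norms of cutoffs *)

Section ModelEstimates.
Context d (T : measurableType d) (R : realType) (mu : {measure set T -> \bar R}).
Context (H : hilbertSpace R) (val : H -> L0 mu) (hval : is_L2_model val).
Implicit Types (x y : H) (p q : H -> H) (D : set T).

Lemma angle_bound (alpha0 : R) : 0 < alpha0 -> exists2 C : R, 0 < C &
  forall M N : set (L0 mu), (alpha0%:E <= subspace_angle M N)%E ->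
  forall x y, M (val x) -> N (val y) ->
    sqn x <= C * sqn (x + y) /\ sqn y <= C * sqn (x + y).
Proof.
(* [alpha0] may exceed pi when a subspace is zero and the infimum is infinite; [a] lies where [cos]
   decreases, and [c] is cut at 0 to be a nonnegative coefficient. *)
move=> a0; pose a := Order.min alpha0 pi.
have aint : a \in `[0, pi].
  by rewrite in_itv /= le_min (ltW a0) pi_ge0 ge_min lexx orbT.
have ap : 0 < a by rewrite lt_min a0 pi_gt0.
have ca1 : cos a < 1.
  by rewrite -cos0 ltr_cos// in_itv /= lexx pi_ge0.
pose c := Order.max 0 (cos a).
have c0 : 0 <= c by rewrite le_max lexx.
have c1 : 0 < 1 - c by rewrite subr_gt0 gt_max ltr01.
exists (1 - c)^-1; first by rewrite invr_gt0.
have C1 : 1 <= (1 - c)^-1 by rewrite invf_ge1// lerBlDr lerDl.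
move=> M N hMN x y Mx Ny.
(* Zero vectors are excluded from the angle; for them the bounds hold because the constant is at
   least 1. *)
have [x0|/eqP xn0] := eqVneq (sqn x) 0.
  rewrite (sqn_eq0 x0) add0r sqn0; split; first by rewrite mulr_ge0 ?sqn_ge0 ?invr_ge0 ?ltW.
  by rewrite -[leLHS]mul1r ler_wpM2r ?sqn_ge0.
have [y0|/eqP yn0] := eqVneq (sqn y) 0.
  rewrite (sqn_eq0 y0) addr0 sqn0; split; last by rewrite mulr_ge0 ?sqn_ge0 ?invr_ge0 ?ltW.
  by rewrite -[leLHS]mul1r ler_wpM2r ?sqn_ge0.
have val0 z : sqn z <> 0 -> val z <> 0.
  move=> z0 vz; apply: z0; rewrite (_ : z = 0) ?sqn0//; apply: (model_inj hval).
  by rewrite vz (val0 hval).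
have nrm_gt0 z : sqn z <> 0 -> 0 < nrm z.
  by move=> /eqP z0; rewrite sqrtr_gt0 lt_def z0 sqn_ge0.
have nxy : 0 < nrm x * nrm y by rewrite mulr_gt0 ?nrm_gt0.
pose q := cabs (inner (val x) (val y)) / (nrm x * nrm y).
have q0 : 0 <= q by rewrite divr_ge0 ?(ltW nxy)//; case: (inner _ _) => u v; exact: sqrtr_ge0.
have q1 : q <= 1 by rewrite ler_pdivrMr// mul1r inner_cabs_le.
have qint : -1 <= q <= 1 by rewrite q1 andbT (le_trans (lerN10 R)).
have aq : a <= acos q.
  rewrite ge_min; apply/orP; left; rewrite -lee_fin; apply: (le_trans hMN).
  apply: ereal_inf_lbound; exists (val x); first by split=> //; exact: val0.
  exists (val y); first by split=> //; exact: val0.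
  by rewrite /vector_angle !(norm2_val hval).
have qc : q <= c.
  rewrite le_max; apply/orP; right; rewrite leNgt; apply/negP => h.
  have := acosK (_ : q \in `[-1, 1]); rewrite in_itv /= => /(_ qint) qE.
  rewrite -qE ltr_cos// in h; first by move: aq; rewrite leNgt h.
  by rewrite in_itv /= acos_ge0// acos_lepi.
have dxy : - dot x y <= c * (nrm x * nrm y).
  apply: (@le_trans _ _ (cabs (inner (val x) (val y)))).
    rewrite (inner_val hval) /=; apply: (@le_trans _ _ (Num.sqrt (dot x y ^+ 2))).
      by rewrite sqrtr_sqr -normrN ler_norm.
    by rewrite ler_sqrt ?addr_ge0 ?sqr_ge0// lerDl sqr_ge0.
  by rewrite -ler_pdivrMr.
apply: sqn_le_sqnD => //; rewrite gt_max ltr01; exact: ca1.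
Qed.

Definition projection p := [/\ selfadj p, contr p, forall x, p (p x) = p x &
  complex_linear val p].

Local Notation I := (@real_basis_index _ _ _ mu).
Local Notation b := (real_basis val).

Lemma trace_norm_cutoff_le D (K K' : L0 mu -> L0 mu) p q (s hd hp hq : R) :
  measurable D -> represents val K p -> represents val K' q -> projection p -> projection q ->
  0 < s -> hs_le I b (fun x => p (chiH val D x) - q (chiH val D x)) hd ->
  hs_le I b (p \o chiH val D) hp -> hs_le I b (q \o chiH val D) hq ->
  (0 <= trace_norm (cutoff D (fun f => K f - K' f)%R) <= (s^-1 * hd + s / 2 * (hp + hq))%:E)%E.
Proof.
move=> mD Kp Kq [ap cp pp pI] [aq cq qq qI] s0 h1 h2 h3.
have aX := chiH_adj hval mD; have cX := chiH_contr hval mD; have XI := chiH_complex hval mD.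
have Kpq : represents val (fun f => K f - K' f) (fun x => p x - q x).
  by move=> x; rewrite Kp Kq (valB hval).
have Kpq' := cutoff_repr hval mD Kpq.
pose A x := chiH val D (p (chiH val D x) - q (chiH val D x)).
have aA : selfadj A := adjpM (adjpM aX (adjpB ap aq)) aX.
have bA : bdd A.
  have [M M0 hM] := contrB_bdd cp cq; exists M => // x; apply: (le_trans (cX _)).
  by apply: (le_trans (hM _)); rewrite ler_pM2l.
apply: (trace_norm_le hval Kpq') => //.
- by move=> x; rewrite XI pI qI -(adjpBE (imul_adj hval)) XI.
- move=> P pP PA; have [J [aJ cJ PJ]] := polar_decomposition aA bA pP PA.
  apply: (trace_bound (real_basis_parseval hval) aX aq ap qq pp aJ cJ) => // x.
  by rewrite PJ /A (adjpBE aX).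
Qed.

(** The zero operator is a projection: the trace bound for a difference, with second projection zero
    and [s = 1], is already finite. *)
Lemma trace_class_cutoff D (K : L0 mu -> L0 mu) p (M : R) :
  measurable D -> represents val K p -> projection p ->
  hs_le I b (p \o chiH val D) M -> trace_class (cutoff D K).
Proof.
move=> mD Kp pp hM; have [ap cp ppp pI] := pp.
have aX := chiH_adj hval mD; have cX := chiH_contr hval mD; have XI := chiH_complex hval mD.
have Kp' := cutoff_repr hval mD Kp.
have aXpX : selfadj (fun x => chiH val D (p (chiH val D x))).
  exact: (adjpM (adjpM aX ap) aX).
have bXpX : bdd (fun x => chiH val D (p (chiH val D x))).
  apply: contr_bdd => x; apply: (le_trans (cX _)); apply: (le_trans (cp _)).
  exact: cX.
have IXpX : complex_linear val (fun x => chiH val D (p (chiH val D x))).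
  by move=> x; rewrite XI pI XI.
split; first exact: (bounded_op_of hval Kp' aXpX bXpX IXpX).
have /andP[_ h] : (0 <= trace_norm (cutoff D K) <= (1^-1 * M + 1 / 2 * (M + 0))%:E)%E.
  apply: (trace_norm_le hval Kp' aXpX bXpX IXpX) => P pP PA.
  have [J [aJ cJ PJ]] := polar_decomposition aXpX bXpX pP PA.
  have a0 : selfadj (fun=> 0 : H) by move=> x y; rewrite dot0l dot0r.
  apply: (trace_bound (real_basis_parseval hval) aX a0 ap _ ppp aJ cJ) => //.
  - by move=> x; rewrite PJ (adjp0 aX) subr0.
  - by apply: sum_le_mono hM => t _ /=; rewrite subr0.
  - by rewrite /hs_le /sum_le esum1// => t _; rewrite /= sqn0.
exact: le_lt_trans h (ltry _).
Qed.

(** Since [p^2 = p], the quadratic form of the cutoff at [x] is [|p (chi x)|^2], so its trace is a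
    sum of squared norms. *)
Lemma hs_of_trace_class D (K : L0 mu -> L0 mu) p : measurable D ->
  represents val K p -> projection p -> trace_class (cutoff D K) ->
  exists M : R, hs_le I b (p \o chiH val D) M.
Proof.
move=> mD Kp [ap cp pp pI] trK.
have aX := chiH_adj hval mD; have cX := chiH_contr hval mD; have XI := chiH_complex hval mD.
have dotE' x : dot (chiH val D (p (chiH val D x))) x = sqn (p (chiH val D x)).
  by rewrite aX /sqn -{1}pp ap.
have [||M hM] := trace_class_sum hval trK (cutoff_repr hval mD Kp).
- split; first exact: (adjpM (adjpM aX ap) aX).
    apply: contr_bdd => x; apply: (le_trans (cX _)); apply: (le_trans (cp _)).
    exact: cX.
  by move=> x; rewrite dotE' sqn_ge0.
- by move=> x; rewrite XI pI XI.
by exists M; apply: sum_le_mono hM => t _; rewrite dotE'.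
Qed.

End ModelEstimates.

(** The weight [s] is fixed first so that the bounded products cost [e / 2]; then [d] is made small
    against [s]. Capping [d] at 1 keeps [s] independent of it. *)
Lemma trace_bound_small (R : realFieldType) (e M : R) (s := e / (2 + 3 * M))
    (d := Num.min 1 (s * (e / 2))) : 0 < e -> 0 <= M ->
  s^-1 * d + s / 2 * (2 * d + 2 * M + M) <= e.
Proof.
move=> e0 M0; have k0 : 0 < 2 + 3 * M by lra.
have s0 : 0 < s by rewrite divr_gt0.
have d1 : d <= 1 by rewrite ge_min lexx.
have d2 : s^-1 * d <= e / 2 by rewrite ler_pdivrMl// ge_min lexx orbT.
have d3 : s / 2 * (2 * d + 2 * M + M) <= e / 2.
  have -> : e / 2 = s / 2 * (2 + 3 * M) by rewrite /s; field; rewrite gt_eqF.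
  by rewrite ler_pM2l ?divr_gt0//; lra.
by move: (s^-1 * d) (s / 2 * _) d2 d3 => u v; lra.
Qed.

(** * Sums of compressed subspaces *)

Section CompressedSums.
Context d (T : measurableType d) (R : realType) (mu : {measure set T -> \bar R}).
Local Notation L0 := (L0 mu).
Context (H : hilbertSpace R) (val : H -> L0) (hval : is_L2_model val).
Context (L V : set L0) (E0 : set T) (A : nat -> set T) (alpha0 : R).
Hypothesis hL : closed_subspace L.
Hypothesis hV : linear_subspace V.
Hypothesis V_fin : finite_dim V.
Hypothesis mE0 : measurable E0.
Hypothesis mA : forall n, measurable (A n).
Hypothesis E0A : forall n, E0 `<=` A n.
Hypothesis ndA : {homo A : m n / (m <= n)%N >-> m `<=` n}.
Hypothesis UA : \bigcup_n A n = setT.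
Hypothesis tr_compl : trace_class (cutoff (~` E0) (oproj L)).
Hypothesis V_L2 : forall n f, V f -> L2 (chi (A n) f).
Hypothesis V_inj : forall f, V f -> chi E0 f = 0 -> f = 0.
Hypothesis L_inj : forall f, L f -> chi E0 f = 0 -> f = 0.
Hypothesis V_not_L2 : forall f, V f -> L2 f -> f = 0.
Hypothesis alpha0_gt0 : 0 < alpha0.
Hypothesis angle_ge : forall n,
  (alpha0%:E <= subspace_angle (chi (A n) @` L) (chi (A n) @` V))%E.

Local Notation S n := (chi (A n) @` sum_space L V).
Local Notation X n := (chiH val (A n)).
Local Notation I := (@real_basis_index _ _ _ mu).
Local Notation b := (real_basis val).

Let linL : linear_subspace L. Proof. by case: hL. Qed.
Let sL : subspace (pre val L). Proof. exact: (pre_subspace hval linL). Qed.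

Let cL : hclosed (pre val L).
Proof.
case: hL => _ _ hc u x Lu ux; apply: (hc (val \o u)) => //; first exact: model_L2.
apply/cvgrPdist_lt => e e0; have [N hN] := ux _ (exprn_gt0 2 e0).
exists N => // n /= /hN h.
rewrite sub0r normrN ger0_norm ?sqrtr_ge0// -(valB hval) (norm2_val hval).
by rewrite -(ltr_pXn2r (n := 2)) ?nnegrE ?nrm_ge0 ?(ltW e0)// nrm_sqr.
Qed.

Lemma oproj_closed : exists q, [/\ represents val (oproj L) q, projection val q &
  forall x, is_proj (pre val L) x (q x)].
Proof.
have [q [Lq qL [aq cq] qq qI]] := oproj_repr hval linL
  (let: And3 _ h _ := hL in h) (closed_complemented sL cL).
by exists q.
Qed.

Lemma chi_bounded_below : exists2 c : R, 0 < c &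
  forall n x, pre val L x -> sqn x <= c * sqn (X n x).
Proof.
have [q [Lq pq qL]] := oproj_closed; have [aq cq qq qI] := pq.
have [M hM] := hs_of_trace_class hval (measurableC mE0) Lq pq tr_compl.
have aX := chiH_adj hval mE0; have cX := chiH_contr hval mE0.
have XX x : chiH val E0 (chiH val E0 x) = chiH val E0 x by rewrite (chiH_comp hval)// setIid.
have hM' : hs_le I b (fun x => q (x - chiH val E0 x)) M.
  by apply: sum_le_mono hM => t _ /=; rewrite (sub_chiH hval).
have inj l : pre val L l -> chiH val E0 l = 0 -> l = 0.
  move=> Ll l0; apply: (model_inj hval); rewrite (val0 hval); apply: L_inj => //.
  by rewrite -(chiHE hval)// l0 (val0 hval).
have [c c0 hc] := hs_bounded_below (real_basis_parseval hval) sL cL qL aq aX XX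
  (contr_bdd cX) hM' inj.
exists c => // n x Lx; apply: (le_trans (hc _ Lx)); rewrite ler_pM2l//.
(* [E0] lies in every [A n], so its indicator factors through that of [A n] and one constant serves
   all [n]. *)
rewrite (_ : chiH val E0 x = chiH val E0 (X n x)); first exact: chiH_contr.
by rewrite (chiH_comp hval)// setIidl.
Qed.

Lemma compressed_linear n : linear_subspace (S n).
Proof.
have [L0' Llin] := linL; have [V0 Vlin] := hV; split.
  exists 0; first by exists 0 => //; exists 0 => //; rewrite addr0.
  exact: chi0.
move=> a _ _ [_ [l Ll [v Vv <-]] <-] [_ [l' Ll' [v' Vv' <-]] <-].
exists ((a *: l + l') + (a *: v + v')).
  exists (a *: l + l'); first exact: Llin.
  by exists (a *: v + v') => //; exact: Vlin.
by rewrite -chiZ// -chiD// scalerDr addrACA.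
Qed.

Lemma compressed_L2 n : S n `<=` @L2 _ _ _ mu.
Proof.
move=> _ [_ [l Ll [v Vv <-]] <-]; rewrite chiD//; apply: L2D; last exact: V_L2.
by apply: chi_L2 => //; case: hL => _ + _; exact.
Qed.

Section Basis.
Context (m : nat) (w : 'I_m -> L0).
Hypothesis wV : forall i, V (w i).
Hypothesis w_span : forall f, V f -> exists c : 'I_m -> R[i], f = \sum_i c i *: w i.
Hypothesis w_indep : forall c : 'I_m -> R[i], \sum_i c i *: w i = 0 -> forall i, c i = 0.

(** Over the reals each complex basis vector counts twice, as [w j] and as i times it; the halves
    carry the real and imaginary parts of the coefficients. *)
Definition cut_basis n (i : 'I_(m + m)) : H :=
  match fintype.split i with
  | inl j => unval val (chi (A n) (w j))
  | inr j => imul val (unval val (chi (A n) (w j)))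
  end.

Definition complex_coord (a : 'I_(m + m) -> R) (j : 'I_m) : R[i] :=
  (a (lshift m j) +i* a (rshift m j))%C.

Definition combination (a : 'I_(m + m) -> R) : L0 := \sum_j complex_coord a j *: w j.

Let V_sum (r : 'I_m -> R[i]) : V (\sum_j r j *: w j).
Proof.
have [V0 Vlin] := hV.
elim/big_ind: _ => [//|f g Vf Vg|j _]; first by rewrite -[f]scale1r; exact: Vlin.
by rewrite -[_ *: _]addr0; exact: Vlin.
Qed.

Lemma combination_V a : V (combination a). Proof. exact: V_sum. Qed.

Lemma combination_eq0 a : combination a = 0 -> forall i, a i = 0.
Proof.
move=> /w_indep h i; rewrite -(splitK i).
by case: (fintype.split i) => j /=; have := h j => -[].
Qed.

Lemma combination_surj f : V f -> exists a, f = combination a.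
Proof.
move=> /w_span[c ->].
exists (fun i => match fintype.split i with inl j => complex.Re (c j) | inr j => complex.Im (c j) end).
apply: eq_bigr => j _; congr (_ *: _); rewrite /complex_coord.
rewrite -[lshift m j]/(fintype.unsplit (inl j)) -[rshift m j]/(fintype.unsplit (inr j)) !unsplitK.
by case: (c j).
Qed.

Lemma val_lincomb n a : val (lincomb (cut_basis n) a) = chi (A n) (combination a).
Proof.
have -> : lincomb (cut_basis n) a =
    \sum_j cscale val (complex_coord a j) (unval val (chi (A n) (w j))).
  rewrite /lincomb big_split_ord /= -big_split /=; apply: eq_bigr => j _.
  rewrite /cut_basis -[lshift m j]/(fintype.unsplit (inl j)) -[rshift m j]/(fintype.unsplit (inr j)).
  by rewrite !unsplitK.
rewrite (big_morph val (model_D hval) (val0 hval)).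
rewrite /combination (big_morph (chi (A n)) (fun f g => chiD f g (mA n)) (chi0 mu (mA n))).
apply: eq_bigr => j _; rewrite (val_cscale hval) chiZ// (unvalK hval)//.
exact: V_L2.
Qed.

Lemma chi_cut_basis k n i : (k <= n)%N -> X k (cut_basis n i) = cut_basis k i.
Proof.
move=> kn.
have h j : X k (unval val (chi (A n) (w j))) = unval val (chi (A k) (w j)).
  apply: (model_inj hval); rewrite (chiHE hval)// !(unvalK hval) ?chi_chi//.
  - by congr chi; rewrite setIidl//; exact: ndA.
  - exact: V_L2.
  - exact: V_L2.
by rewrite /cut_basis; case: fintype.split => j; rewrite ?(chiH_complex hval)// h.
Qed.

Lemma cut_basis_inj n a : lincomb (cut_basis n) a = 0 -> forall i, a i = 0.
Proof.
move=> a0; apply: combination_eq0; apply: V_inj; first exact: combination_V.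
have : chi (A n) (combination a) = 0 by rewrite -val_lincomb a0 (val0 hval).
move=> /(congr1 (chi E0)); rewrite chi_chi// setIidl// => ->.
exact: chi0.
Qed.

Lemma cut_basis_unbounded a (D : R) : (forall n, sqn (lincomb (cut_basis n) a) <= D) ->
  forall i, a i = 0.
Proof.
move=> aD; apply: combination_eq0; apply: V_not_L2; first exact: combination_V.
apply/L2E; apply: le_lt_trans (ltry D).
apply: (sqint_le_chi mA ndA UA) => n.
by rewrite -val_lincomb -(sqn_sqint hval) lee_fin.
Qed.

Lemma pre_compressed n : pre val (S n) =
  [set y + lincomb (cut_basis n) a | y in X n @` pre val L & a in setT].
Proof.
apply/seteqP; split=> x.
  move=> [_ [l Ll [v /combination_surj[a ->] <-]] xE].
  have l2 : L2 l by case: hL => _ + _; exact.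
  exists (X n (unval val l)).
    by exists (unval val l) => //; rewrite /pre /= (unvalK hval).
  exists a => //; apply: (model_inj hval).
  by rewrite (model_D hval) (chiHE hval)// (unvalK hval)// val_lincomb -chiD.
move=> [_ [l Ll <-] [a _ <-]]; exists (val l + combination a).
  by exists (val l) => //; exists (combination a) => //; exact: combination_V.
by rewrite (model_D hval) (chiHE hval)// val_lincomb chiD.
Qed.

Lemma compressed_complemented n : complemented (pre val (S n)).
Proof.
have aX := chiH_adj hval (mA n); have cX := chiH_contr hval (mA n).
have [c c0 hc] := chi_bounded_below.
rewrite pre_compressed; apply: (span_complemented (M := X n @` pre val L) _ _ _).2.
  split; first by exists 0; [exact: sL.1|exact: (adjp0 aX)].
  move=> a _ _ [x Lx <-] [y Ly <-]; exists (a *: x + y); first exact: sL.2.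
  by rewrite (adjp_linear aX).
apply: closed_complemented.
  split; first by exists 0; [exact: sL.1|exact: (adjp0 aX)].
  move=> a _ _ [x Lx <-] [y Ly <-]; exists (a *: x + y); first exact: sL.2.
  by rewrite (adjp_linear aX).
exact: (closed_image aX (contr_bdd cX) cL sL c0 (hc n)).
Qed.

End Basis.

Lemma real_basis_of_V : exists m (w : 'I_m -> L0), [/\ forall i, V (w i),
  forall f, V f -> exists c : 'I_m -> R[i], f = \sum_i c i *: w i &
  forall c : 'I_m -> R[i], \sum_i c i *: w i = 0 -> forall i, c i = 0].
Proof.
have [V0 Vlin] := hV; have [n [v Vv]] := V_fin.
exact: (finite_dim_basis V0 Vlin Vv).
Qed.

Lemma oproj_compressed : exists p : nat -> H -> H, forall n,
  [/\ represents val (oproj (S n)) (p n), projection val (p n) &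
    forall x, is_proj (pre val (S n)) x (p n x)].
Proof.
have [m [w [wV w_span w_indep]]] := real_basis_of_V.
have /choice[p hp] : forall n, exists p : H -> H,
    [/\ represents val (oproj (S n)) p, projection val p &
        forall x, is_proj (pre val (S n)) x (p x)].
  move=> n; have [p [h1 h2 [h3 h4] h5 h6]] := oproj_repr hval (@compressed_linear n)
    (@compressed_L2 n) (compressed_complemented wV w_span n).
  by exists p.
by exists p.
Qed.

Lemma oproj_compressed_bounded n : bounded_op (oproj (S n)).
Proof.
have [p /(_ n)[hp [ap cp pp pI] _]] := oproj_compressed.
exact: (bounded_op_of hval hp ap (contr_bdd cp) pI).
Qed.

Lemma oproj_compressed_cvg D : measurable D -> trace_class (cutoff D (oproj L)) ->
  (forall f, V f -> L2 (chi D f)) ->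
  (forall n, trace_class (cutoff D (oproj (S n)))) /\
  trace_norm (cutoff D (fun f => oproj (S n) f - oproj L f)) @[n --> \oo] --> 0%E.
Proof.
move=> mD trD VD.
have [m [w [wV w_span w_indep]]] := real_basis_of_V.
have [q [Lq pq qL]] := oproj_closed; have [aq cq qq qI] := pq.
have [p hp] := oproj_compressed.
have pS n : represents val (oproj (S n)) (p n) by have [] := hp n.
have pp n : projection val (p n) by have [] := hp n.
have pP n x : is_proj (pre val (S n)) x (p n x) by have [_ _] := hp n; exact.
have [M QX_hs] := hs_of_trace_class hval mD Lq pq trD.
pose xx n := cut_basis w n; pose XD := chiH val D.
have aXD : selfadj XD := chiH_adj hval mD.
have cXD : contr XD := chiH_contr hval mD.
have aX n : selfadj (X n) := chiH_adj hval (mA n).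
have cX n : contr (X n) := chiH_contr hval (mA n).
have X_comp k n f : (k <= n)%N -> X n (X k f) = X k f.
  by move=> kn; rewrite (chiH_comp hval)// setIidr//; exact: ndA.
have X_cvg f : hcvg (fun n => X n f) f.
  move=> e e0; have [N hN] := chi_cvg mA ndA UA (model_L2 hval f) e0.
  exists N => n /hN; rewrite -lte_fin (sqn_sqint hval) (valB hval) (chiHE hval)//.
have X_XD n f : X n (XD f) = XD (X n f).
  by rewrite /XD !(chiH_comp hval)// setIC.
have X_xx k n i : (k <= n)%N -> X k (xx n i) = xx k i.
  by move=> kn; exact: (chi_cut_basis wV).
have XD_xx i : exists K : R, forall n, sqn (XD (xx n i)) <= K.
  (* Cutting further by [A n] only decreases the norm of [chi D (w j)], which bounds all of them. *)
  have h j : exists K : R, forall n, sqn (XD (unval val (chi (A n) (w j)))) <= K.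
    exists (fine (sqint (chi D (w j)))) => n.
    have D2 := VD _ (wV j).
    rewrite -lee_fin fineK; last exact: sqint_fin.
    rewrite (sqn_sqint hval) (chiHE hval)// (unvalK hval); last exact: V_L2.
    rewrite (chi_chi _ mD (mA n)).
    exact: (sqint_chi_le _ (measurableI _ _ mD (mA n)) mD (@subIsetl _ _ _)).
  rewrite /xx /cut_basis; case: (fintype.split i) => j; have [K hK] := h j; exists K => n //.
  by rewrite /XD (chiH_complex hval)// (sqn_imul hval); exact: hK.
have xx_inj n a : lincomb (xx n) a = 0 -> forall i, a i = 0.
  exact: (cut_basis_inj wV w_indep).
have xx_unb a (K : R) : (forall n, sqn (lincomb (xx n) a) <= K) -> forall i, a i = 0.
  exact: (cut_basis_unbounded wV w_indep).
have xx_le n i := coord_le xx_inj n i.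
have xx_small i (e : R) (e0 : 0 < e) := coord_small aX cX X_xx xx_inj xx_unb i e0.
have [c c0 hc] := chi_bounded_below.
have [c' c'0 hc'] := angle_bound hval alpha0_gt0.
pose C := c + c'; have C0 : 0 < C by rewrite addr_gt0.
have cC : c <= C by rewrite lerDl ltW.
have c'C : c' <= C by rewrite lerDr ltW.
have L_le n l : pre val L l -> sqn l <= C * sqn (X n l).
  by move=> /(hc n) h; apply: (le_trans h); rewrite ler_wpM2r ?sqn_ge0.
have angle n l a : pre val L l ->
    sqn (X n l) <= c' * sqn (X n l + lincomb (xx n) a) /\
    sqn (lincomb (xx n) a) <= c' * sqn (X n l + lincomb (xx n) a).
  move=> Ll; apply: (hc' _ _ (angle_ge n)).
    by exists (val l) => //; rewrite (chiHE hval).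
  by exists (combination w a); [exact: (combination_V wV)|rewrite -(val_lincomb wV)].
have chiL_le n l a : pre val L l ->
    sqn (X n l) <= C * sqn (X n l + lincomb (xx n) a).
  by move=> /(angle n _ a)[h _]; apply: (le_trans h); rewrite ler_wpM2r ?sqn_ge0.
have x_le n l a : pre val L l ->
    sqn (lincomb (xx n) a) <= C * sqn (X n l + lincomb (xx n) a).
  by move=> /(angle n _ a)[_ h]; apply: (le_trans h); rewrite ler_wpM2r ?sqn_ge0.
have pP' n f : is_proj [set y + lincomb (xx n) a | y in X n @` pre val L & a in setT] f (p n f).
  by rewrite -(pre_compressed wV w_span); exact: pP.
have ap n : selfadj (p n) by have [] := pp n.
have cp n : contr (p n) by have [] := pp n.
have pars := real_basis_parseval hval.
have P_bounded n : exists K : R, hs_le I b (p n \o XD) K.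
  exact: (hs_projection_bounded pars sL qL aq aXD QX_hs aX cX X_XD XD_xx xx_le C0 L_le chiL_le x_le pP').
have P_cvg (e : R) (e0 : 0 < e) : exists N, forall n, (N <= n)%N ->
    hs_le I b (fun y => p n (XD y) - q (XD y)) e.
  exact: (hs_projection_cvg pars sL qL aq cq aXD QX_hs aX cX X_comp X_cvg X_XD X_xx XD_xx xx_small C0 L_le chiL_le x_le pP' ap cp e0).
split.
  by move=> n; have [K hK] := P_bounded n; exact: (trace_class_cutoff hval mD (pS n) (pp n) hK).
have tn_ge0 n : (0 <= trace_norm (cutoff D (fun f => oproj (S n) f - oproj L f)%R))%E.
  have [K hK] := P_bounded n.
  have hD : hs_le I b (fun x => p n (XD x) - q (XD x)) (2 * K + 2 * M).
    apply: (@sum_le_mono _ _ _ _ (fun t => 2 * sqn (p n (XD (b t))) + 2 * sqn (q (XD (b t))))).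
      by move=> t _; exact: sqnB_le.
    by apply: sum_leD; try (by move=> t; rewrite mulr_ge0 ?sqn_ge0); apply: sum_leZ => // t;
      exact: sqn_ge0.
  by have /andP[] := trace_norm_cutoff_le hval mD (pS n) Lq (pp n) pq ltr01 hD hK QX_hs.
apply: ereal_cvg0 => // e e0.
pose M0 := Num.max M 0; have MM0 : M <= M0 by rewrite le_max lexx.
have M00 : 0 <= M0 by rewrite le_max lexx orbT.
have k0 : 0 < 2 + 3 * M0 by rewrite ltr_wpDr// mulr_ge0.
pose s := e / (2 + 3 * M0); have s0 : 0 < s by rewrite divr_gt0.
pose dl := Num.min 1 (s * (e / 2)).
have dl0 : 0 < dl by rewrite lt_min ltr01 mulr_gt0// divr_gt0.
have [N hN] := P_cvg _ dl0; exists N => n /hN hD.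
(* Unlike the bounds in [P_bounded], this one is uniform in [n]: it comes from [q] and the small
   difference. *)
have hP : hs_le I b (p n \o XD) (2 * dl + 2 * M0).
  apply: (@sum_le_mono _ _ _ _ (fun t => 2 * sqn (p n (XD (b t)) - q (XD (b t))) +
      2 * sqn (q (XD (b t))))).
    by move=> t _; apply: le_trans (sqnD_le _ _); rewrite subrK.
  apply: sum_leD; try (by move=> t; rewrite mulr_ge0 ?sqn_ge0).
    by apply: sum_leZ => // t; exact: sqn_ge0.
  by apply: sum_leZ => // [t|]; [exact: sqn_ge0|exact: sum_leW QX_hs].
have hQ : hs_le I b (q \o XD) M0 by exact: sum_leW QX_hs.
have /andP[_] := trace_norm_cutoff_le hval mD (pS n) Lq (pp n) pq s0 hD hP hQ.
move=> /le_trans; apply; rewrite lee_fin.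
exact: trace_bound_small.
Qed.

End CompressedSums.

Theorem corollary1 (R : realType) (E : completeMetricType R)
    (mu : {measure set (borel E) -> \bar R}) (L V : set (L0 mu))
    (E0 : set (borel E)) (B : nat -> set (borel E)) :
  locally_compact [set: E] ->
  sigma_finite [set: borel E] mu ->
  closed_subspace L ->
  I1loc (oproj L) ->
  linear_subspace V -> finite_dim V -> V `<=` @L2loc R E mu ->
  measurable E0 ->
  trace_class (cutoff (~` E0) (oproj L)) ->
  chi E0 @` V `<=` @L2 _ _ _ mu ->
  (forall phi, V phi -> (chi E0 @` L) (chi E0 phi) -> phi = 0) ->
  (forall phi, L phi -> chi E0 phi = 0 -> phi = 0) ->
  V `&` @L2 _ _ _ mu = [set 0] ->
  (forall n, metric_bounded (B n) /\ measurable (B n)) ->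
  {homo B : m n / (m <= n)%N >-> m `<=` n} ->
  \bigcup_n B n = ~` E0 ->
  (exists alpha0 : R, 0 < alpha0 /\
     forall n, (alpha0%:E <=
       subspace_angle (chi (E0 `|` B n) @` L) (chi (E0 `|` B n) @` V))%E) ->
  cvg_I1loc (fun n => oproj (chi (E0 `|` B n) @` sum_space L V)) (oproj L).
Proof.
move=> _ _ hL QI hV V_fin V_loc mE0 tr_compl V_E0 V_inj L_inj V_L2 hB ndB UB [a [a0 angle_ge]].
have [H [val hval]] := L2_hilbert_model mu.
have mA n : measurable (E0 `|` B n) by apply: measurableU => //; exact: (hB n).2.
have E0A n : E0 `<=` E0 `|` B n by move=> x; left.
have ndA : {homo (fun n => E0 `|` B n) : m n / (m <= n)%N >-> m `<=` n}.
  by move=> m n mn; apply: setUS; exact: ndB.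
have UA : \bigcup_n (E0 `|` B n) = setT.
  by rewrite bigcupUr ?UB ?setUv//; exists 0%N.
have chiV_L2 (D : set (borel E)) : metric_bounded D -> measurable D -> forall f, V f -> L2 (chi D f).
  by move=> bD mD f /V_loc h; apply/L2E; rewrite -sqnorm_on_chi//; exact: h.
(* Assumption (b) covers [E0], and local square-integrability covers the bounded set [B n]. *)
have V_A n f : V f -> L2 (chi (E0 `|` B n) f).
  move=> Vf; have [bB mB] := hB n.
  apply/L2E; apply: (le_lt_trans (chi_setU_le f mE0 mB)).
  rewrite lte_add_pinfty//; first by apply: V_E0; exists f.
  exact: chiV_L2.
(* Assumption (c) is applied with the zero vector of [L]. *)
have V_inj' f : V f -> chi E0 f = 0 -> f = 0.
  move=> Vf f0; apply: V_inj => //; exists 0; last by rewrite f0 chi0.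
  by case: hL => -[].
have V_not_L2 f : V f -> L2 f -> f = 0.
  by move=> Vf f2; have : (V `&` @L2 _ _ _ mu) f by []; rewrite V_L2.
have cvgD (D : set (borel E)) (bD : metric_bounded D) (mD : measurable D) :=
  oproj_compressed_cvg hval hL hV V_fin mE0 mA E0A ndA UA tr_compl V_A V_inj' L_inj V_not_L2
    a0 angle_ge mD (QI.2 D bD mD) (chiV_L2 D bD mD).
split; [|exact: QI|by move=> D bD mD; exact: (cvgD D bD mD).2].
move=> n; split; last by move=> D bD mD; exact: (cvgD D bD mD).1.
exact: (oproj_compressed_bounded hval hL hV V_fin mE0 mA E0A tr_compl V_A L_inj).
Qed.
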